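(* Let $F$ be a field of characteristic $2$, let $S=(\bar C_\varphi,* )$ be an Okubo superalgebra over $F$, and denote by $\cdot$ the product of the associated Hurwitz superalgebra $C$ (so $S=C$ as a superspace). Let $\Gamma$ be a nontrivial grading on the superalgebra $S$ and let $G$ be its universal grading group. Write $S_i^g=S^g\cap S_i$ for $i=\bar0,\bar1$. Then $\Gamma$ is, up to equivalence, one of the gradings in the following cases. (1) $G=\mathbb{Z}_2^2$, the quaternion algebra $(S_{\bar0},\cdot)$ contains a $2$-dimensional subalgebra $K=F1\oplus Fw$ with $w^{\cdot2}+w+1=0$, there is $0\neq\alpha\in F$ such that $C=\mathrm{CD}(S_{\bar0},\alpha)=S_{\bar0}\oplus S_{\bar0}\cdot u$, $S_{\bar1}=S_{\bar0}\cdot u$, $u^{\cdot2}=\alpha$, and $\varphi$ is the automorphism of order $3$ determined by $\varphi|_{S_{\bar0}}=1$ and $\varphi(u)=w\cdot u$. Moreover, $$S_{\bar0}^{(\bar0,\bar0)}=K,\quad S_{\bar0}^{(\bar1,\bar0)}=K^\perp\cap S_{\bar0},\quad S_{\bar1}^{(\bar0,\bar1)}=K\cdot u,\quad S_{\bar1}^{(\bar1,\bar1)}=(K^\perp\cap S_{\bar0})\cdot u.\qquad(\ast)$$ (2) $G=\mathbb{Z}_2$ and $\Gamma$ is either the main $\mathbb{Z}_2$-grading, or a coarsening of a grading $(\ast)$ given by $S^{\bar0}=K\oplus K\cdot u$, $S^{\bar1}=(K^\perp\cap S_{\bar0})\oplus(K^\perp\cap S_{\bar0})\cdot u$. In cases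 (3)–(8), $(S_{\bar0},\cdot)$ is split, $\tau_{nst}$ and $\tau_\omega$ are defined using a canonical basis of $(S,\cdot)$ such that $S_{\bar0}=\mathrm{span}\{e_1,e_2,u_3,v_3\}$ and $S_{\bar1}=\mathrm{span}\{u_1,u_2,v_1,v_2\}$, and $F$ contains a primitive cubic root of unity $\omega$ whenever $\varphi=\tau_\omega$. (3) $G=\mathbb{Z}^2$, $\varphi=\tau_\omega$, and $S_{\bar0}^{(0,0)}=\mathrm{span}\{e_1,e_2\}$, $S_{\bar0}^{(1,1)}=\mathrm{span}\{v_3\}$, $S_{\bar0}^{(-1,-1)}=\mathrm{span}\{u_3\}$, $S_{\bar1}^{(1,0)}=\mathrm{span}\{u_1\}$, $S_{\bar1}^{(-1,0)}=\mathrm{span}\{v_1\}$, $S_{\bar1}^{(0,1)}=\mathrm{span}\{u_2\}$, $S_{\bar1}^{(0,-1)}=\mathrm{span}\{v_2\}$. (4) $G=\mathbb{Z}$ (3-grading), $\varphi=\tau_\omega$, and either $S_{\bar0}^0=\mathrm{span}\{e_1,e_2,u_3,v_3\}$, $S_{\bar1}^1=\mathrm{span}\{u_1,v_2\}$, $S_{\bar1}^{-1}=\mathrm{span}\{u_2,v_1\}$; or $S^0=\mathrm{span}\{e_1,e_2,u_1,v_1\}$, $S^1=\mathrm{span}\{u_3,v_2\}$, $S^{-1}=\mathrm{span}\{u_2,v_3\}$. (5) $G=\mathbb{Z}$ (5-grading), and either $\varphi=\tau_{nst}$ with $S_{\bar0}^0=\mathrm{span}\{e_1,e_2\}$, $S_{\bar1}^1=\mathrm{span}\{u_1,u_2\}$,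 $S_{\bar0}^2=\mathrm{span}\{v_3\}$, $S_{\bar1}^{-1}=\mathrm{span}\{v_1,v_2\}$, $S_{\bar0}^{-2}=\mathrm{span}\{u_3\}$; or $\varphi=\tau_\omega$ with $S_{\bar0}^0=\mathrm{span}\{e_1,e_2\}$, $S^1=\mathrm{span}\{u_3,u_2\}$, $S_{\bar1}^2=\mathrm{span}\{v_1\}$, $S^{-1}=\mathrm{span}\{v_3,v_2\}$, $S_{\bar1}^{-2}=\mathrm{span}\{u_1\}$. (6) $G=\mathbb{Z}_3$, $\varphi=\tau_{nst}$, and $S_{\bar0}^{\bar0}=\mathrm{span}\{e_1,e_2\}$, $S^{\bar1}=\mathrm{span}\{u_1,u_2,u_3\}$, $S^{\bar2}=\mathrm{span}\{v_1,v_2,v_3\}$. (7) $G=\mathbb{Z}_4$, and either $\varphi=\tau_{nst}$ with $S_{\bar0}^{\bar0}=\mathrm{span}\{e_1,e_2\}$, $S_{\bar1}^{\bar1}=\mathrm{span}\{u_1,u_2\}$, $S_{\bar0}^{\bar2}=\mathrm{span}\{u_3,v_3\}$, $S_{\bar1}^{\bar3}=\mathrm{span}\{v_1,v_2\}$; or $\varphi=\tau_\omega$ with $S_{\bar0}^{\bar0}=\mathrm{span}\{e_1,e_2\}$, $S^{\bar1}=\mathrm{span}\{u_2,u_3\}$, $S_{\bar1}^{\bar2}=\mathrm{span}\{u_1,v_1\}$, $S^{\bar3}=\mathrm{span}\{v_2,v_3\}$. (8) $G=\mathbb{Z}\times\mathbb{Z}_2$, $\varphi=\tau_\omega$, and either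 $S_{\bar0}^{(0,\bar0)}=\mathrm{span}\{e_1,e_2\}$, $S_{\bar1}^{(1,\bar0)}=\mathrm{span}\{u_2\}$, $S_{\bar1}^{(-1,\bar0)}=\mathrm{span}\{v_2\}$, $S_{\bar1}^{(0,\bar1)}=\mathrm{span}\{u_1,v_1\}$, $S_{\bar0}^{(-1,\bar1)}=\mathrm{span}\{u_3\}$, $S_{\bar0}^{(1,\bar1)}=\mathrm{span}\{v_3\}$; or $S_{\bar0}^{(0,\bar0)}=\mathrm{span}\{e_1,e_2\}$, $S_{\bar1}^{(1,\bar0)}=\mathrm{span}\{u_2\}$, $S_{\bar1}^{(-1,\bar0)}=\mathrm{span}\{v_2\}$, $S_{\bar0}^{(0,\bar1)}=\mathrm{span}\{u_3,v_3\}$, $S_{\bar1}^{(-1,\bar1)}=\mathrm{span}\{u_1\}$, $S_{\bar1}^{(1,\bar1)}=\mathrm{span}\{v_1\}$.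
   Context: Gradings. A grading by a group $G$ on an algebra $\mathcal A$ is a decomposition $\Gamma:\mathcal A=\bigoplus_{g\in G}\mathcal A^g$ into subspaces with $\mathcal A^g\mathcal A^h\subseteq\mathcal A^{gh}$; its support is $\{g:\mathcal A^g\neq0\}$. Its universal grading group is the group generated by the support subject to the relations $g_1g_2=g_3$ whenever $0\neq\mathcal A^{g_1}\mathcal A^{g_2}\subseteq\mathcal A^{g_3}$. A superalgebra is a $\mathbb{Z}_2$-graded algebra $\mathcal A=\mathcal A_{\bar0}\oplus\mathcal A_{\bar1}$; this is called the main grading. A grading on the superalgebra $\mathcal A$ is a group grading on the algebra $\mathcal A$ such that $\mathcal A^g=(\mathcal A^g\cap\mathcal A_{\bar0})\oplus(\mathcal A^g\cap\mathcal A_{\bar1})$ for all $g$. The trivial grading is $\mathcal A=\mathcal A^e$. $\Gamma'$ is a coarsening of $\Gamma$ if every component of $\Gamma$ is contained in a component of $\Gamma'$. Two gradings are equivalent if there is an isomorphism of superalgebras (preserving the main grading) mapping each nonzero homogeneous component of the first onto a homogeneous component of the second. All groups considered are abelian (the support of a grading on these superalgebras always generates an abelian group). Hurwitz algebras. A Hurwitz algebra is a unital algebra over $F$ with a regular multiplicative quadratic form $q$ (the norm); its polar form is also denoted $q$, and $\bar x=q(x,1)1-x$. Orthogonal complements ($\perp$) refer to the polar form. A Hurwitz algebra is split if it has a nonzero $x$ with $q(x)=0$. Given a Hurwitz algebra $Q$ and $0\ne\alpha\in F$, $\mathrm{CD}(Q,\alpha)=Q\oplus Qu$ has multiplication $(a+bu)(c+du)=(ac-\alpha\bar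 d b)+(da+b\bar c)u$ for $a,b,c,d\in Q$ and norm $q(a+bu)=q(a)+\alpha q(b)$; it is a superalgebra with even part $Q$ and odd part $Qu$. Okubo superalgebras. Let $\mathrm{char}\,F=2$, let $(C,\cdot)=\mathrm{CD}(Q,\alpha)$ for a quaternion ($4$-dimensional Hurwitz) algebra $Q$ and $0\neq\alpha\in F$, with $C_{\bar0}=Q$, $C_{\bar1}=Qu=Q^\perp$, and let $\varphi\neq1$ be an automorphism of $C$ with $\varphi^3=1$ and $\varphi|_Q=1$. Then $\bar C_\varphi$ is the superspace $C$ with the product $x*y=\varphi(\bar x)\cdot\varphi^2(\bar y)$; these are the Okubo superalgebras. For $x\in C$, $x^{\cdot2}=x\cdot x$. Canonical basis of a split Cayley ($8$-dimensional Hurwitz) algebra: a basis $\{e_1,e_2,u_1,u_2,u_3,v_1,v_2,v_3\}$ with (indices mod $3$) $e_i^2=e_i$, $e_1e_2=e_2e_1=0$, $e_1u_i=u_i=u_ie_2$, $e_2v_i=v_i=v_ie_1$, $e_2u_i=u_ie_1=e_1v_i=v_ie_2=0$, $u_iu_{i+1}=v_{i+2}=-u_{i+1}u_i$, $v_iv_{i+1}=u_{i+2}=-v_{i+1}v_i$, $u_i^2=v_i^2=0$, $u_iv_j=-\delta_{ij}e_1$, $v_iu_j=-\delta_{ij}e_2$. Given a canonical basis, $\tau_{nst}$ is the order-3 automorphism fixing $e_1,e_2,u_3,v_3$ with $\tau_{nst}(u_1)=u_2$, $\tau_{nst}(u_2)=-u_1-u_2$, $\tau_{nst}(v_1)=-v_1+v_2$,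 $\tau_{nst}(v_2)=-v_1$. If $\omega\in F$ is a primitive cubic root of $1$, $\tau_\omega$ is the order-3 automorphism with $\tau_\omega(e_j)=e_j$ ($j=1,2$), $\tau_\omega(u_i)=\omega^iu_i$, $\tau_\omega(v_i)=\omega^{-i}v_i$ ($i=1,2,3$). *)

(* Defs.v *)
From HB Require Import structures.
From mathcomp Require Import all_boot all_order all_algebra.

Set Implicit Arguments.
Unset Strict Implicit.
Unset Printing Implicit Defensive.

Import GRing.Theory.

Local Open Scope ring_scope.

(* Algebras are not assumed associative: an algebra is a vectType with a      *)
(* product; a superalgebra comes with its even part V0 and its odd part V1.   *)

Section Gradings.

Variables (F : fieldType) (V : vectType F) (mul : V -> V -> V).
Variables (V0 V1 : {vspace V}).

(* V is the direct sum of the Gamma g; since V is finite-dimensional only     *)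
(* finitely many Gamma g are nonzero, and s enumerates the support.           *)
Definition decomposition (G : zmodType) (Gamma : G -> {vspace V}) : Prop :=
  exists s : seq G,
    [/\ uniq s, forall g, (g \in s) = (Gamma g != 0%VS),
        directv (\sum_(g <- s) Gamma g) &
        (\sum_(g <- s) Gamma g)%VS = fullv].

Definition alg_grading (G : zmodType) (Gamma : G -> {vspace V}) : Prop :=
  decomposition Gamma /\
  forall g h x y, x \in Gamma g -> y \in Gamma h -> mul x y \in Gamma (g + h).

(* The sum below is direct as soon as V0 and V1 are in direct sum.            *)
Definition superalg_grading (G : zmodType) (Gamma : G -> {vspace V}) : Prop :=
  alg_grading Gamma /\
  forall g, Gamma g = (Gamma g :&: V0 + Gamma g :&: V1)%VS.

Definition trivial_grading (G : zmodType) (Gamma : G -> {vspace V}) : Prop :=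
  Gamma 0 = fullv.

Definition coarsening (G' G : zmodType) (Gamma' : G' -> {vspace V})
    (Gamma : G -> {vspace V}) : Prop :=
  forall g, exists g', (Gamma g <= Gamma' g')%VS.

(* 0 != V^g1 V^g2 and V^g1 V^g2 is contained in V^g3.                         *)
Definition support_relation (G : zmodType) (Gamma : G -> {vspace V})
    (g1 g2 g3 : G) : Prop :=
  (exists x y, [/\ x \in Gamma g1, y \in Gamma g2 & mul x y != 0]) /\
  (forall x y, x \in Gamma g1 -> y \in Gamma g2 -> mul x y \in Gamma g3).

Definition respects_relations (G : zmodType) (Gamma : G -> {vspace V})
    (U : zmodType) (f : G -> U) : Prop :=
  forall g1 g2 g3, support_relation Gamma g1 g2 g3 -> f g1 + f g2 = f g3.

(* U, with deg mapping the support to the generators, is the abelian group    *)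
(* presented by the support and the relations above. Only the values of deg   *)
(* on the support matter: support_relation forces g1, g2, g3 to lie in it.    *)
Definition universal_degree (G : zmodType) (Gamma : G -> {vspace V})
    (U : zmodType) (deg : G -> U) : Prop :=
  respects_relations Gamma deg /\
  forall (H : zmodType) (f : G -> H), respects_relations Gamma f ->
    exists theta : {additive U -> H},
      (forall g, Gamma g != 0%VS -> theta (deg g) = f g) /\
      (forall theta' : {additive U -> H},
        (forall g, Gamma g != 0%VS -> theta' (deg g) = f g) ->
        theta' =1 theta).

Definition universal_group (G : zmodType) (Gamma : G -> {vspace V})
    (U : zmodType) : Prop :=
  exists deg : G -> U, universal_degree Gamma deg.

End Gradings.

Definition superalg_iso (F : fieldType) (V V' : vectType F)
    (mul : V -> V -> V) (V0 V1 : {vspace V})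
    (mul' : V' -> V' -> V') (V0' V1' : {vspace V'}) (f : 'Hom(V, V')) : Prop :=
  [/\ bijective f, {morph f : x y / mul x y >-> mul' x y},
      (f @: V0)%VS = V0' & (f @: V1)%VS = V1'].

Definition equivalent_gradings (F : fieldType) (V V' : vectType F)
    (mul : V -> V -> V) (V0 V1 : {vspace V})
    (mul' : V' -> V' -> V') (V0' V1' : {vspace V'})
    (G G' : zmodType) (Gamma : G -> {vspace V}) (Gamma' : G' -> {vspace V'}) :
    Prop :=
  exists2 f : 'Hom(V, V'), superalg_iso mul V0 V1 mul' V0' V1' f &
    forall g, Gamma g != 0%VS -> exists g', (f @: Gamma g)%VS = Gamma' g'.

(* The family of subspaces indexed by G whose nonzero members are listed in L.*)
Definition components (F : fieldType) (V : vectType F) (G : zmodType)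
    (L : seq (G * {vspace V})) : G -> {vspace V} :=
  fun g => (\sum_(p <- L | p.1 == g) p.2)%VS.

Section QuadraticForms.

Variables (F : fieldType) (V : vectType F) (q : V -> F).

Definition polar (x y : V) : F := q (x + y) - q x - q y.

Definition quadratic_form : Prop :=
  (forall a x, q (a *: x) = a ^+ 2 * q x) /\
  (forall y, scalar (polar^~ y)).

(* Nondegeneracy of the polar form. In characteristic 2 the one-dimensional   *)
(* algebra F is therefore excluded; in even dimension this is the usual       *)
(* notion in every characteristic.                                            *)
Definition regular_form : Prop :=
  forall x, (forall y, polar x y = 0) -> x = 0.

(* polar^~ y is linear when q is a quadratic form, so that linfun is its      *)
(* bundled version and the kernel is the orthogonal of y.                     *)
Definition perp (K : {vspace V}) : {vspace V} :=
  (\bigcap_(y <- vbasis K) lker (linfun (polar^~ y : V -> F^o)))%VS.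

End QuadraticForms.

Record hurwitzAlg (F : fieldType) := HurwitzAlg {
  hw_sort :> vectType F;
  hw_mul : {bilinear hw_sort -> hw_sort -> hw_sort};
  hw_one : hw_sort;
  hw_norm : hw_sort -> F;
  hw_mul1x : left_id hw_one hw_mul;
  hw_mulx1 : right_id hw_one hw_mul;
  hw_normQ : quadratic_form hw_norm;
  hw_normR : regular_form hw_norm;
  hw_normM : {morph hw_norm : x y / hw_mul x y >-> x * y}
}.

Definition hw_conj (F : fieldType) (Q : hurwitzAlg F) (x : Q) : Q :=
  polar (@hw_norm F Q) x (hw_one Q) *: hw_one Q - x.

Section CayleyDickson.

Variables (F : fieldType) (Q : hurwitzAlg F) (alpha : F).

(* The pair (a, b) stands for a + b u.                                        *)
Definition CD : vectType F := (hw_sort Q * hw_sort Q)%type.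

Definition cd_mul (x y : CD) : CD :=
  let: (a, b) := x in let: (c, d) := y in
  (hw_mul Q a c - alpha *: hw_mul Q (hw_conj d) b,
   hw_mul Q d a + hw_mul Q b (hw_conj c)).

Definition cd_one : CD := (hw_one Q, 0).

Definition cd_norm (x : CD) : F := hw_norm x.1 + alpha * hw_norm x.2.

Definition cd_conj (x : CD) : CD := polar cd_norm x cd_one *: cd_one - x.

Definition cd_even : {vspace CD} := limg (linfun (fun a : Q => (a, 0) : CD)).

Definition cd_odd : {vspace CD} := limg (linfun (fun b : Q => (0, b) : CD)).

Definition cd_automorphism (phi : 'End(CD)) : Prop :=
  bijective phi /\ {morph phi : x y / cd_mul x y}.

Definition okubo_mul (phi : 'End(CD)) (x y : CD) : CD :=
  cd_mul (phi (cd_conj x)) (phi (phi (cd_conj y))).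

(* The subspace W . u.                                                        *)
Definition cd_rmul (W : {vspace CD}) (u : CD) : {vspace CD} :=
  (linfun (cd_mul^~ u) @: W)%VS.

Definition even_part_split : Prop :=
  exists2 x, x \in cd_even & x != 0 /\ cd_norm x = 0.

(* The superalgebra is CD(even part, beta) with the element u of the odd part *)
(* in the role of the adjoined element.                                       *)
Definition is_CD_by (beta : F) (u : CD) : Prop :=
  [/\ cd_odd = cd_rmul cd_even u,
      forall a b c d,
        a \in cd_even -> b \in cd_even -> c \in cd_even -> d \in cd_even ->
        cd_mul (a + cd_mul b u) (c + cd_mul d u) =
        (cd_mul a c - beta *: cd_mul (cd_conj d) b) +
        cd_mul (cd_mul d a + cd_mul b (cd_conj c)) u,
      forall a b, a \in cd_even -> b \in cd_even ->
        cd_norm (a + cd_mul b u) = cd_norm a + beta * cd_norm b &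
      cd_mul u u = beta *: cd_one].

Definition is_quadratic_subalgebra (K : {vspace CD}) (w : CD) : Prop :=
  [/\ (K <= cd_even)%VS, \dim K = 2,
      forall x y, x \in K -> y \in K -> cd_mul x y \in K,
      K = (<[cd_one]> + <[w]>)%VS &
      cd_mul w w + w + cd_one = 0].

Definition star_data (phi : 'End(CD)) (K : {vspace CD}) (w u : CD) : Prop :=
  is_quadratic_subalgebra K w /\
  exists2 beta : F, beta != 0 &
    [/\ is_CD_by beta u, forall x, x \in cd_even -> phi x = x &
        phi u = cd_mul w u].

Definition even_perp (K : {vspace CD}) : {vspace CD} :=
  (perp cd_norm K :&: cd_even)%VS.

Definition star_grading (K : {vspace CD}) (u : CD) :
    'Z_2 * 'Z_2 -> {vspace CD} :=
  components [:: ((0, 0), K); ((1, 0), even_perp K);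
                 ((0, 1), cd_rmul K u); ((1, 1), cd_rmul (even_perp K) u)].

(* The indices 1, 2, 3 are taken in 'Z_3, hence modulo 3; u 3 is u 0.         *)
Definition canonical_basis (e1 e2 : CD) (u v : 'Z_3 -> CD) : Prop :=
  let m := cd_mul in
  [/\ basis_of fullv [:: e1; e2; u 1; u 2; u 3; v 1; v 2; v 3],
      [/\ m e1 e1 = e1, m e2 e2 = e2, m e1 e2 = 0 & m e2 e1 = 0],
      forall i, [/\ m e1 (u i) = u i, m (u i) e2 = u i,
                    m e2 (v i) = v i & m (v i) e1 = v i] /\
                [/\ m e2 (u i) = 0, m (u i) e1 = 0,
                    m e1 (v i) = 0 & m (v i) e2 = 0],
      forall i, [/\ m (u i) (u (i + 1)) = v (i + 2),
                    m (u (i + 1)) (u i) = - v (i + 2),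
                    m (v i) (v (i + 1)) = u (i + 2) &
                    m (v (i + 1)) (v i) = - u (i + 2)] /\
                (m (u i) (u i) = 0 /\ m (v i) (v i) = 0) &
      forall i j, m (u i) (v j) = - ((i == j)%:R *: e1) /\
                  m (v i) (u j) = - ((i == j)%:R *: e2)].

Definition adapted_basis (e1 e2 : CD) (u v : 'Z_3 -> CD) : Prop :=
  [/\ canonical_basis e1 e2 u v,
      cd_even = <<[:: e1; e2; u 3; v 3]>>%VS &
      cd_odd = <<[:: u 1; u 2; v 1; v 2]>>%VS].

Definition is_tau_nst (e1 e2 : CD) (u v : 'Z_3 -> CD) (phi : 'End(CD)) : Prop :=
  [/\ [/\ phi e1 = e1, phi e2 = e2, phi (u 3) = u 3 & phi (v 3) = v 3],
      phi (u 1) = u 2, phi (u 2) = - u 1 - u 2,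
      phi (v 1) = - v 1 + v 2 & phi (v 2) = - v 1].

(* The exponent is the representative of i in {0, 1, 2}; omega ^+ 3 = 1.      *)
Definition is_tau_omega (e1 e2 : CD) (u v : 'Z_3 -> CD) (phi : 'End(CD)) :
    Prop :=
  exists2 omega : F, 3.-primitive_root omega &
    [/\ phi e1 = e1, phi e2 = e2,
        forall i : 'Z_3, phi (u i) = omega ^+ (i : nat) *: u i &
        forall i : 'Z_3, phi (v i) = omega ^- (i : nat) *: v i].

Definition okubo_grading (phi : 'End(CD)) (G : zmodType)
    (Gamma : G -> {vspace CD}) : Prop :=
  superalg_grading (okubo_mul phi) cd_even cd_odd Gamma.

(* A is the universal grading group of Gamma, and Gamma is equivalent to the  *)
(* grading Delta, whose degrees are those in its universal group A.           *)
Definition is_up_to_equiv (phi : 'End(CD)) (G : zmodType)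
    (Gamma : G -> {vspace CD}) (A : zmodType) (Delta : A -> {vspace CD}) :
    Prop :=
  [/\ universal_group (okubo_mul phi) Gamma A,
      okubo_grading phi Delta,
      universal_degree (okubo_mul phi) Delta id &
      equivalent_gradings (okubo_mul phi) cd_even cd_odd
                          (okubo_mul phi) cd_even cd_odd Gamma Delta].

End CayleyDickson.

(* Main.v *)
Require Import Defs.
From HB Require Import structures.
From mathcomp Require Import all_boot all_order all_algebra.
From mathcomp Require Import ring.
From Stdlib Require Import Classical FunctionalExtensionality.

Set Implicit Arguments.
Unset Strict Implicit.
Unset Printing Implicit Defensive.

Import GRing.Theory.

Local Open Scope ring_scope.

(* In characteristic 2 the automorphism phi multiplies the odd part on the left
   by an element w of Q with w ^ 2 + w + 1 = 0. The even elements commuting with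
   the even part of (S, * ) form a graded subspace, which is F1, so that 1 has
   degree 0; hence Gamma is also a grading of (C, .), stable under phi and the
   conjugation, and everything can be read off in the associative algebra Q.

   If some homogeneous odd bu has q(b) <> 0, then its degree g satisfies 2g = 0,
   w' = b^-1 w b lies in Q_0, and Gamma is determined by g and the grading of Q.
   That grading is trivial (main grading), or Q_h contains j with q(j) <> 0
   (grading ( * ) or its coarsening), or Q_h and Q_-h are isotropic lines.
   Otherwise all homogeneous odd elements are isotropic, and a dual pair b1, d1
   gives an idempotent e = alpha conj(d1) b1 in Q_0. In the last two situations
   homogeneous dual bases (b1, b2), (d1, d2) of Qe and Q(1 + e) yield a
   homogeneous canonical basis with u_1, u_2 of degrees g, h. When g <> h, the
   vectors b1, b2 are eigenvectors of w and phi is tau_omega; when g = h, a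
   cyclic vector of w in Qe shows that phi is tau_nst. The coincidences among
   0, g, h, g + h and their opposites then give the list, and the universal
   group is the one presented by g, h and these coincidences. *)

(** Right multiplication by 1 in the Okubo product is [phi] composed with the conjugation. These
    commute and have coprime orders 3 and 2, so powers of this single operator recover both of them,
    and then the Hurwitz product: this is why placing 1 in degree 0 is enough. Characteristic 2
    makes the polar form alternating, so coordinates on [Q] come from two orthogonal hyperbolic
    pairs and no sign has to be tracked. Associativity is not among the axioms of a Hurwitz algebra;
    for [Q] it is derived from the norm. The obstacle on the group side is that the additive map
    from a presented group [A] to the given group [H] is in general injective only on the degrees,
    since [H] may satisfy further relations. The relabelled family is therefore shown to be a
    grading from the multiplication table of the canonical basis, and injectivity on degrees is
    reduced to a finite list of differences that must not vanish in [H]. *)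

Section Char2.

Variables (F : fieldType) (charF : 2%N \in [pchar F]).

Lemma add2v (V : lmodType F) (x : V) : x + x = 0.
Proof. by rewrite -mulr2n -scaler_nat (pcharf0 charF) scale0r. Qed.

Lemma opp2v (V : lmodType F) (x : V) : - x = x.
Proof. by apply/eqP; rewrite -subr_eq0 -opprD add2v oppr0. Qed.

Lemma add2f (a : F) : a + a = 0. Proof. exact: addrr_pchar2. Qed.

Lemma opp2f (a : F) : - a = a. Proof. exact: oppr_pchar2. Qed.

Lemma add2vK (V : lmodType F) (x y : V) : x + (x + y) = y.
Proof. by rewrite addrA add2v add0r. Qed.

Lemma add2v_eq0 (V : lmodType F) (x y : V) : x + y = 0 -> x = y.
Proof. by move/eqP; rewrite addr_eq0 opp2v => /eqP. Qed.

End Char2.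

(* The polar form and the conjugation are locked: rewriting with additivity
   would otherwise see the sums in their definitions. *)
HB.lock Definition qform (F : fieldType) (Q : hurwitzAlg F) (x y : Q) : F :=
  polar (@hw_norm F Q) x y.

HB.lock Definition qconj (F : fieldType) (Q : hurwitzAlg F) (x : Q) : Q :=
  hw_conj x.

Notation "x ** y" := (hw_mul _ x y) (at level 40, left associativity).
Notation nq := (@hw_norm _ _).

(** * Norm, polar form and conjugation of a Hurwitz algebra *)

Section Hurwitz.

Variables (F : fieldType) (charF : 2%N \in [pchar F]).
Variables (Q : hurwitzAlg F) (dimQ : \dim {: Q} = 4%N).
Implicit Types (a b : F) (x y z u v : Q).

Local Notation B := (@qform F Q).
Local Notation cj := (@qconj F Q).
Local Notation "1q" := (hw_one Q).

Lemma qmulDl x y z : (x + y) ** z = x ** z + y ** z.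
Proof. exact: linearDl. Qed.
Lemma qmulDr x y z : x ** (y + z) = x ** y + x ** z.
Proof. exact: linearDr. Qed.
Lemma qmulZl a x y : (a *: x) ** y = a *: (x ** y).
Proof. exact: linearZl_LR. Qed.
Lemma qmulZr a x y : x ** (a *: y) = a *: (x ** y).
Proof. exact: linearZr_LR. Qed.
Lemma qmul0 x : 0 ** x = 0. Proof. exact: linear0l. Qed.
Lemma qmulx0 x : x ** 0 = 0. Proof. exact: linear0r. Qed.
Lemma qmul1 x : 1q ** x = x. Proof. exact: hw_mul1x. Qed.
Lemma qmulx1 x : x ** 1q = x. Proof. exact: hw_mulx1. Qed.

Lemma qnormD x y : nq (x + y) = nq x + nq y + B x y.
Proof. by rewrite qform.unlock /polar -[_ - _ - _]addrA -opprD [RHS]addrC subrK. Qed.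

Lemma qnormZ a x : nq (a *: x) = a ^+ 2 * nq x.
Proof. exact: (hw_normQ Q).1. Qed.

Lemma qnormM x y : nq (x ** y) = nq x * nq y.
Proof. exact: hw_normM. Qed.

Lemma qnorm0 : nq (0 : Q) = 0.
Proof. by rewrite -(scale0r (0 : Q)) qnormZ expr0n mul0r. Qed.

Lemma qformC x y : B x y = B y x.
Proof. by rewrite qform.unlock /polar [x + y]addrC addrAC. Qed.

Lemma qformDl x y z : B (x + y) z = B x z + B y z.
Proof.
rewrite qform.unlock; have := (hw_normQ Q).2 z 1 x y.
by rewrite scale1r mul1r.
Qed.

Lemma qformZl a x y : B (a *: x) y = a * B x y.
Proof.
have B0 : B 0 y = 0 by apply: (@addrI _ (B 0 y)); rewrite -qformDl !addr0.
rewrite qform.unlock in B0 *; have := (hw_normQ Q).2 y a x 0.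
by rewrite /= B0 !addr0.
Qed.

Lemma qformDr x y z : B x (y + z) = B x y + B x z.
Proof. by rewrite qformC qformDl !(qformC x). Qed.

Lemma qformZr a x y : B x (a *: y) = a * B x y.
Proof. by rewrite qformC qformZl qformC. Qed.

Lemma qform0 y : B 0 y = 0.
Proof. by rewrite -(scale0r (0 : Q)) qformZl mul0r. Qed.

Lemma qformx0 y : B y 0 = 0.
Proof. by rewrite qformC qform0. Qed.

Lemma qformxx x : B x x = 0.
Proof.
have := qnormD x x; rewrite (add2v charF) qnorm0 (add2f charF) add0r.
by move=> <-.
Qed.

Lemma qform_ex x : x != 0 -> exists y, B x y != 0.
Proof.
move=> x0; apply: NNPP => nex; case/eqP: x0.
apply: hw_normR => y.
by apply: NNPP => /eqP h; apply: nex; exists y; rewrite qform.unlock.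
Qed.

Lemma qform_inj x y : (forall z, B x z = B y z) -> x = y.
Proof.
move=> h; apply/eqP; rewrite -subr_eq0; apply/negP=> /negP.
case/qform_ex=> z; rewrite (opp2v charF) qformDl h (add2f charF).
by rewrite eqxx.
Qed.

Lemma qone_neq0 : 1q != 0.
Proof.
apply/eqP => h1; have : (\dim {: Q} <= 0)%N.
  rewrite leqn0 dimv_eq0 -subv0; apply/subvP => x _.
  by rewrite -(qmul1 x) h1 qmul0 mem0v.
by rewrite dimQ.
Qed.

Lemma qnorm1 : nq 1q = 1.
Proof.
have [y By] := qform_ex qone_neq0.
(* If the norm vanished identically, so would its polar form, against [By]. *)
have [x nx] : exists x, nq x != 0 :> F.
  apply: NNPP => nex.
  have n0 x : nq x = 0 by apply: NNPP => /eqP h; apply: nex; exists x.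
  by have := qnormD 1q y; rewrite !n0 !add0r => /esym/eqP; rewrite (negPf By).
by apply: (mulIf nx); rewrite -qnormM qmul1 mul1r.
Qed.

Lemma qform_mull x y z : B (x ** y) (x ** z) = nq x * B y z.
Proof.
have := qnormM x (y + z); rewrite qmulDr !qnormD !qnormM !mulrDr.
by move/addrI.
Qed.

Lemma qform_mulr x y z : B (x ** z) (y ** z) = B x y * nq z.
Proof.
have := qnormM (x + y) z; rewrite qmulDl !qnormD !qnormM !mulrDl.
by move/addrI.
Qed.

(** Multiplicativity of the norm linearised in both factors. Putting 1 for [z] or for [u] gives the
    two adjunctions [qadjl] and [qadjr]. *)
Lemma qform_mul4 x y z u :
  B (x ** y) (z ** u) + B (x ** u) (z ** y) = B x z * B y u.
Proof.
have := qform_mulr x z (y + u); rewrite qnormD !mulrDr -!qform_mulr.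
rewrite !qmulDr !qformDl !qformDr => h.
apply: (@addrI _ (B (x ** y) (z ** y) + B (x ** u) (z ** u))).
by rewrite -h; ring.
Qed.

Lemma qconjE x : cj x = B x 1q *: 1q + x.
Proof. by rewrite qconj.unlock qform.unlock /hw_conj (opp2v charF). Qed.

Lemma qform11 : B 1q 1q = 0. Proof. exact: qformxx. Qed.

Lemma qtrace_conj x : B (cj x) 1q = B x 1q.
Proof. by rewrite qconjE qformDl qformZl qform11 mulr0 add0r. Qed.

Lemma qconjK x : cj (cj x) = x.
Proof.
by rewrite qconjE qtrace_conj qconjE addrA (add2v charF) add0r.
Qed.

Lemma qconjD x y : cj (x + y) = cj x + cj y.
Proof. by rewrite !qconjE qformDl scalerDl addrACA. Qed.

Lemma qconjZ a x : cj (a *: x) = a *: cj x.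
Proof. by rewrite !qconjE qformZl scalerDr scalerA. Qed.

Lemma qconj1 : cj 1q = 1q.
Proof. by rewrite qconjE qform11 scale0r add0r. Qed.

Lemma qconj0 : cj 0 = 0.
Proof. by rewrite qconjE qform0 scale0r add0r. Qed.

Lemma qconj_tr0 x : B x 1q = 0 -> cj x = x.
Proof. by move=> h; rewrite qconjE h scale0r add0r. Qed.

Lemma qadjl x y z : B (x ** y) z = B y (cj x ** z).
Proof.
have := qform_mul4 x y 1q z; rewrite !qmul1 qconjE qmulDl qmulZl qmul1.
rewrite qformDr qformZr => <-; rewrite -addrA (qformC y).
by rewrite (add2f charF) addr0.
Qed.

Lemma qadjr x y z : B (x ** y) z = B x (z ** cj y).
Proof.
have := qform_mul4 x y z 1q; rewrite !qmulx1 qconjE qmulDr qmulZr qmulx1.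
rewrite qformDr qformZr mulrC => <-; rewrite -addrA.
by rewrite (add2f charF) addr0.
Qed.

Lemma qconjM x y : cj (x ** y) = cj y ** cj x.
Proof.
have tr u v : B (cj u) v = B (u ** v) 1q.
  by rewrite qadjl qmulx1 qformC.
apply: qform_inj => z; rewrite tr [RHS]qadjl qconjK tr.
by rewrite [RHS]qadjl [RHS]qadjr qmulx1 qadjr qmul1 qadjl.
Qed.

Lemma qnorm_conj x : nq (cj x) = nq x.
Proof.
rewrite qconjE qnormD qnormZ qnorm1 qformZl (qformC 1q) mulr1 -expr2.
by rewrite addrC addrA (add2f charF) add0r.
Qed.

(** Adjunction turns the pairing of the left side with [z] into B(xy, xz) = q(x) B(y, z). Together
    with its mirror image this cancellation law stands in for associativity and inverses. *)
Lemma qmul_conjK x y : cj x ** (x ** y) = nq x *: y.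
Proof.
apply: qform_inj => z; rewrite qadjl qconjK qform_mull qformZl.
by [].
Qed.

Lemma qmulK_conj x y : (y ** x) ** cj x = nq x *: y.
Proof.
apply: qform_inj => z; rewrite qadjr qconjK qform_mulr qformZl mulrC.
by [].
Qed.

Lemma qmulK_conjl x y : x ** (cj x ** y) = nq x *: y.
Proof. by rewrite -{1}(qconjK x) qmul_conjK qnorm_conj. Qed.

Lemma qmul_conj x : cj x ** x = nq x *: 1q.
Proof. by rewrite -[X in _ ** X]qmulx1 qmul_conjK. Qed.

Lemma qmulxconj x : x ** cj x = nq x *: 1q.
Proof. by rewrite -[X in X ** _]qmul1 qmulK_conj. Qed.

Lemma qconj_form x y : cj x ** y + cj y ** x = B x y *: 1q.
Proof.
have := qmul_conj (x + y); rewrite qnormD qconjD qmulDl !qmulDr.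
rewrite !qmul_conj !scalerDl => h.
apply: (@addrI _ (nq x *: 1q + nq y *: 1q)).
by rewrite -h addrACA; congr (_ + _); rewrite addrC.
Qed.

Lemma qform_conj x y : x ** cj y + y ** cj x = B x y *: 1q.
Proof.
have := qmulxconj (x + y); rewrite qnormD qconjD qmulDl !qmulDr.
rewrite !qmulxconj !scalerDl => h.
apply: (@addrI _ (nq x *: 1q + nq y *: 1q)).
by rewrite -h addrACA; congr (_ + _); rewrite addrC.
Qed.

Lemma qsqr x : x ** x = B x 1q *: x + nq x *: 1q.
Proof.
by rewrite -qmul_conj qconjE qmulDl qmulZl qmul1 (add2vK charF).
Qed.

End Hurwitz.
(** * Quaternion algebras *)

Section Quaternion.

Variables (F : fieldType) (charF : 2%N \in [pchar F]).
Variables (Q : hurwitzAlg F) (dimQ : \dim {: Q} = 4%N).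
Implicit Types (a b : F) (x y z u v : Q).

Local Notation B := (@qform F Q).
Local Notation cj := (@qconj F Q).
Local Notation "1q" := (hw_one Q).

(** If no such [y] existed, the norm, hence also its polar form, would vanish on the orthogonal of
    the plane <1, x>. That plane is nondegenerate, so its orthogonal would be 0 and [Q] would have
    dimension at most 2. *)
Lemma quaternion_generators :
  exists x y, [/\ B x 1q = 1, B y 1q = 0, B y x = 0 & nq y != 0].
Proof.
have [x0 Bx0] := qform_ex (qone_neq0 dimQ).
pose x := (B 1q x0)^-1 *: x0.
have Bx1 : B x 1q = 1 by rewrite qformZl (qformC x0) mulVf.
clearbody x; clear x0 Bx0.
suff [y [? ? ?]] : exists y, [/\ B y 1q = 0, B y x = 0 & nq y != 0].
  by exists x, y.
apply: NNPP => nex.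
have n0 y : B y 1q = 0 -> B y x = 0 -> nq y = 0.
  by move=> h1 h2; apply: NNPP => /eqP h; apply: nex; exists y.
(* Orthogonal projection along the hyperbolic plane <1, x>, where B(1, x) = 1 and both vectors are
   self-orthogonal. *)
pose p v := v + (B v x *: 1q + B v 1q *: x).
have p1 v : B (p v) 1q = 0.
  rewrite !qformDl !qformZl qform11 // Bx1 mulr0 mulr1 add0r.
  by rewrite (add2f charF).
have px v : B (p v) x = 0.
  rewrite !qformDl !qformZl (qformC 1q) Bx1 qformxx // mulr0 mulr1 addr0.
  by rewrite (add2f charF).
have pE z : z = p z + (B z x *: 1q + B z 1q *: x).
  by rewrite /p -addrA (add2v charF) addr0.
clearbody p; have p0 v : p v = 0.
  apply: (qform_inj charF) => z; rewrite qform0 {1}(pE z).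
  rewrite !qformDr !qformZr p1 px !mulr0 !addr0.
  have := qnormD (p v) (p z).
  have nv := n0 _ (p1 v) (px v); have nz := n0 _ (p1 z) (px z).
  rewrite nv nz !add0r => <-; apply: n0; first by rewrite qformDl !p1 addr0.
  by rewrite qformDl !px addr0.
have : (fullv <= <<[:: 1q; x]>>)%VS.
  apply/subvP => z _; rewrite (pE z) p0 add0r.
  by rewrite rpredD // rpredZ // memv_span // !inE eqxx ?orbT.
move/dimvS/leq_trans/(_ (dim_span _)).
by rewrite dimQ.
Qed.

(** The polar form is alternating, so two mutually orthogonal hyperbolic pairs are free; in
    dimension 4 they form a basis, and each coordinate is the pairing with the partner vector. All
    coordinate formulas below are instances. *)
Lemma hyperbolic_coord x1 y1 x2 y2 :
  B x1 y1 != 0 -> B x2 y2 != 0 ->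
  B x1 x2 = 0 -> B x1 y2 = 0 -> B y1 x2 = 0 -> B y1 y2 = 0 -> forall v,
  v = ((B x1 y1)^-1 * B v y1 *: x1 + (B x1 y1)^-1 * B v x1 *: y1) +
      ((B x2 y2)^-1 * B v y2 *: x2 + (B x2 y2)^-1 * B v x2 *: y2).
Proof.
move=> c1 c2 h1 h2 h3 h4 v.
pose X : 4.-tuple Q := [tuple x1; y1; x2; y2].
have form k : let s := \sum_(i < 4) k i *: X`_i in
    [/\ B s y1 = k ord0 * B x1 y1, B s x1 = k (inord 1) * B x1 y1,
        B s y2 = k (inord 2) * B x2 y2 & B s x2 = k (inord 3) * B x2 y2].
  rewrite /= !big_ord_recl big_ord0 /= !addr0.
  have -> : lift ord0 ord0 = inord 1 :> 'I_4 by apply/val_inj; rewrite /= inordK.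
  have -> : lift ord0 (lift ord0 ord0) = inord 2 :> 'I_4.
    by apply/val_inj; rewrite /= inordK.
  have -> : lift ord0 (lift ord0 (lift ord0 ord0)) = inord 3 :> 'I_4.
    by apply/val_inj; rewrite /= inordK.
  have R := (h1, h2, h3, h4, qformxx charF).
  have R' := (etrans (qformC _ _) h1, etrans (qformC _ _) h2,
    etrans (qformC _ _) h3, etrans (qformC _ _) h4).
  rewrite !qformDl !qformZl !R !R' (qformC y1) (qformC y2).
  by rewrite !(mulr0, addr0, add0r).
have Xfree : free X.
  apply/freeP => k h i; have [] := form k; rewrite h !qform0.
  move=> /esym/eqP + /esym/eqP + /esym/eqP + /esym/eqP.
  rewrite !mulf_eq0 (negPf c1) (negPf c2) !orbF => /eqP k0 /eqP k1 /eqP k2 /eqP k3.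
  have := ltn_ord i; case: i => [[|[|[|[|i]]]] hi] //= _.
  - by rewrite -[RHS]k0; congr k; apply: val_inj.
  - by rewrite -[RHS]k1; congr k; apply: val_inj; rewrite /= inordK.
  - by rewrite -[RHS]k2; congr k; apply: val_inj; rewrite /= inordK.
  - by rewrite -[RHS]k3; congr k; apply: val_inj; rewrite /= inordK.
have Xbasis : basis_of fullv X by rewrite basisEfree Xfree subvf size_tuple dimQ.
have vE := coord_basis Xbasis (memvf v).
have [] := form (fun i => coord X i v); rewrite -vE => -> -> -> ->.
rewrite {1}vE ![_^-1 * _]mulrC !mulfK //.
rewrite !big_ord_recl big_ord0 /= !addr0 -!addrA.
congr (_ *: _ + (_ *: _ + (_ *: _ + _ *: _)));
  by congr (coord _ _ _); apply/val_inj; rewrite /= ?inordK.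
Qed.

Section Coordinates.

Variables x y : Q.
Hypotheses (x1 : B x 1q = 1) (y1 : B y 1q = 0) (yx : B y x = 0).
Hypothesis ny : nq y != 0.

Let xy1 : B (x ** y) 1q = 0.
Proof.
by rewrite qadjl // qmulx1 qconjE // qformDr qformZr y1 yx mulr0 addr0.
Qed.

Let xyx : B (x ** y) x = 0.
Proof. by rewrite qadjl // qmul_conj // qformZr y1 mulr0. Qed.

Let xyy : B (x ** y) y = nq y.
Proof. by rewrite -{2}(qmul1 y) qform_mulr // x1 mul1r. Qed.

Lemma quaternion_coord v :
  v = (B v x *: 1q + B v 1q *: x) +
      ((nq y)^-1 * B v (x ** y) *: y + (nq y)^-1 * B v y *: (x ** y)).
Proof.
have c1 : B 1q x = 1 by rewrite qformC.
have c2 : B y (x ** y) = nq y by rewrite qformC.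
have := @hyperbolic_coord 1q x y (x ** y); rewrite c1 c2 oner_eq0 ny.
move=> /(_ isT isT _ _ _ _ v); rewrite invr1 !mul1r; apply=> //;
  by rewrite qformC.
Qed.

Lemma quaternion_ind (P : Q -> Prop) :
  (forall u v, P u -> P v -> P (u + v)) -> (forall a v, P v -> P (a *: v)) ->
  P 1q -> P x -> P y -> P (x ** y) -> forall v, P v.
Proof.
move=> PD PZ P1 Px Py Pxy v; rewrite (quaternion_coord v).
by apply: (PD _ _ (PD _ _ _ _) (PD _ _ _ _)); apply: PZ.
Qed.

End Coordinates.

(** The associator. The alternative laws follow from [qmul_conjK] and [qmulK_conj]; they make it
    alternating, hence symmetric in characteristic 2. *)
Let asr u v z := (u ** v) ** z + u ** (v ** z).

Let asrDl u u' v z : asr (u + u') v z = asr u v z + asr u' v z.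
Proof. by rewrite /asr !qmulDl addrACA. Qed.
Let asrDm u v v' z : asr u (v + v') z = asr u v z + asr u v' z.
Proof. by rewrite /asr !(qmulDl, qmulDr) addrACA. Qed.
Let asrDr u v z z' : asr u v (z + z') = asr u v z + asr u v z'.
Proof. by rewrite /asr !qmulDr addrACA. Qed.
Let asrZl a u v z : asr (a *: u) v z = a *: asr u v z.
Proof. by rewrite /asr !qmulZl scalerDr. Qed.
Let asrZm a u v z : asr u (a *: v) z = a *: asr u v z.
Proof. by rewrite /asr !(qmulZl, qmulZr) scalerDr. Qed.
Let asrZr a u v z : asr u v (a *: z) = a *: asr u v z.
Proof. by rewrite /asr !qmulZr scalerDr. Qed.

Let asr_altl u v : asr u u v = 0.
Proof.
rewrite /asr qsqr // qmulDl !qmulZl qmul1 -(qmul_conjK charF u v) qconjE //.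
by rewrite qmulDl qmulZl qmul1 (add2vK charF) (add2v charF).
Qed.
Let asr_altr u v : asr v u u = 0.
Proof.
rewrite /asr qsqr // qmulDr !qmulZr qmulx1 -(qmulK_conj charF u v) qconjE //.
by rewrite qmulDr qmulZr qmulx1 (add2vK charF) (add2v charF).
Qed.
Let asr_swapl u v z : asr u v z = asr v u z.
Proof.
apply: (add2v_eq0 charF); have := asr_altl (u + v) z.
by rewrite asrDl !asrDm !asr_altl add0r addr0.
Qed.
Let asr_swapr u v z : asr u v z = asr u z v.
Proof.
apply: (add2v_eq0 charF); have := asr_altr (v + z) u.
by rewrite asrDm !asrDr !asr_altr add0r addr0.
Qed.
Let asr_flex u v : asr u v u = 0.
Proof. by rewrite asr_swapl asr_altr. Qed.
Let asr1l u v : asr 1q u v = 0.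
Proof. by rewrite /asr !qmul1 (add2v charF). Qed.
Let asr1m u v : asr u 1q v = 0.
Proof. by rewrite asr_swapl asr1l. Qed.
Let asr1r u v : asr u v 1q = 0.
Proof. by rewrite asr_swapr asr1m. Qed.

(** On the basis 1, [x], [y], [x ** y] the symmetry of the associator leaves a single triple open,
    namely [x], [y], [x ** y]. There both bracketings equal q(x) q(y), because xy = y conj(x) and
    conj(y) = y. *)
Lemma qmulA u v z : u ** (v ** z) = (u ** v) ** z.
Proof.
apply/esym/(add2v_eq0 charF); rewrite -/(asr u v z).
have [x [y [x1 y1 yx ny]]] := quaternion_generators.
have ind := quaternion_ind x1 y1 yx ny.
have asr0 : asr x y (x ** y) = 0.
  have yxc : x ** y = y ** cj x.
    have := qform_conj charF x y; rewrite (qformC x) yx scale0r.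
    by move/(add2v_eq0 charF) => <-; rewrite (qconj_tr0 charF y1).
  rewrite /asr qsqr //.
  have -> : B (x ** y) 1q = 0.
    by rewrite qadjl // qmulx1 qconjE // qformDr qformZr y1 yx mulr0 addr0.
  rewrite scale0r add0r qnormM.
  have -> : y ** (x ** y) = nq y *: cj x.
    by rewrite yxc -{1}(qconj_tr0 charF y1) qmul_conjK.
  by rewrite qmulZr qmulxconj // scalerA mulrC (add2v charF).
have A3 w : asr x y w = 0.
  by move: w; apply: (ind) => [a b ha hb|a b hb|||//|//];
    rewrite ?asrDr ?asrZr ?ha ?hb ?addr0 ?scaler0 ?asr1r ?asr_flex ?asr_altr.
have A2 v' w : asr x v' w = 0.
  move: v'; apply: (ind) => [a b ha hb|a b hb||||];
    rewrite ?asrDm ?asrZm ?ha ?hb ?addr0 ?scaler0 ?asr1m ?asr_altl ?A3 //.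
  move: w; apply: (ind) => [a b ha hb|a b hb||||];
    rewrite ?asrDr ?asrZr ?ha ?hb ?addr0 ?scaler0 ?asr1r ?asr_flex ?asr_altr //.
  by rewrite asr_swapr A3.
have A2' v' w : asr v' x w = 0 by rewrite asr_swapl A2.
have A2'' v' w : asr v' w x = 0 by rewrite asr_swapr A2'.
have A4 w v' : asr y w v' = 0.
  move: w; apply: (ind) => [a b ha hb|a b hb||||];
    rewrite ?asrDm ?asrZm ?ha ?hb ?addr0 ?scaler0 ?asr1m ?asr_altl ?A2' //.
  move: v'; apply: (ind) => [a b ha hb|a b hb||||];
    by rewrite ?asrDr ?asrZr ?ha ?hb ?addr0 ?scaler0 ?asr1r ?asr_flex ?asr_altr ?A2''.
move: u; apply: (ind) => [a b ha hb|a b hb||||];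
    rewrite ?asrDl ?asrZl ?ha ?hb ?addr0 ?scaler0 ?asr1l //.
move: v; apply: (ind) => [a b ha hb|a b hb||||];
    rewrite ?asrDm ?asrZm ?ha ?hb ?addr0 ?scaler0 ?asr1m ?asr_altl ?A2' //.
by rewrite asr_swapl A4.
Qed.

(** A central [z] is orthogonal to all commutators. Those of [y] with [x], of [x ** y] with [x] and
    of [x ** y] with [y] are nonzero multiples of [y], [x ** y] and 1, so only the coordinate along
    1 survives. *)
Lemma quaternion_center z : (forall u, z ** u = u ** z) -> exists a, z = a *: 1q.
Proof.
move=> zC; have [x [y [x1 y1 yx ny]]] := quaternion_generators.
have Bz u v : B z (u ** v) = B z (v ** u).
  by rewrite qformC qadjl // -zC [RHS]qformC qadjr.
have xyc : x ** y = y ** cj x.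
  have := qform_conj charF x y; rewrite (qformC x) yx scale0r.
  by move/(add2v_eq0 charF) => <-; rewrite (qconj_tr0 charF y1).
have xC : cj x = 1q + x by rewrite qconjE // x1 scale1r.
have yxE : y ** x = y + x ** y.
  by rewrite xyc xC qmulDr qmulx1 (add2vK charF).
have zy : B z y = 0.
  by apply: (@addIr _ (B z (x ** y))); rewrite add0r -qformDr -yxE Bz.
have zxy : B z (x ** y) = 0.
  have := Bz (x ** y) x; rewrite -qmulA yxE qmulDr qformDr => h.
  by apply: (@addIr _ (B z (x ** (x ** y)))); rewrite h add0r.
have z1 : B z 1q = 0.
  have yxy : y ** (x ** y) = nq y *: cj x.
    by rewrite xyc -{1}(qconj_tr0 charF y1) qmul_conjK.
  have := Bz (x ** y) y; rewrite yxy -qmulA qsqr // y1 scale0r add0r qmulZr qmulx1 !qformZr => /(mulfI ny).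
  rewrite xC qformDr => h.
  by apply: (@addIr _ (B z x)); rewrite -h add0r.
exists (B z x); rewrite {1}(quaternion_coord x1 y1 yx ny z) z1 zy zxy.
by rewrite !(mulr0, scale0r, addr0).
Qed.

(** The elements [y] and [x ** y] are their own conjugates, so [p] commutes with them and, after
    cancelling [y], with [x]. But px = conj(x) p = p + xp, which leaves p = 0. *)
Lemma qconj_twist p : (forall u, p ** u = cj u ** p) -> p = 0.
Proof.
move=> h; have [x [y [x1 y1 yx ny]]] := quaternion_generators.
have xy1 : B (x ** y) 1q = 0.
  by rewrite qadjl // qmulx1 qconjE // qformDr qformZr y1 yx mulr0 addr0.
have py := h y; have pxy := h (x ** y); have px := h x.
rewrite (qconj_tr0 charF y1) in py; rewrite (qconj_tr0 charF xy1) in pxy.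
have e : x ** p ** y = p ** x ** y by rewrite -qmulA py qmulA -pxy qmulA.
have {}e : x ** p = p ** x.
  move/(congr1 (fun u => u ** cj y)): e; rewrite !qmulK_conj //.
  exact: scalerI.
move: px; rewrite -e qconjE // x1 scale1r qmulDl qmul1 => px'.
by apply: (@addIr _ (x ** p)); rewrite add0r -px'.
Qed.

End Quaternion.
(** * Decompositions and universal grading groups *)

Section Decompositions.

Variables (F : fieldType) (V : vectType F).

(** A family given by basis vectors with degrees, repetitions of degrees allowed. [components_span]
    identifies it with the lists of subspaces used in the statement. *)
Definition span_comp (G : eqType) (M : seq (G * V)) (g : G) : {vspace V} :=
  <<[seq p.2 | p <- M & p.1 == g]>>%VS.

Lemma directv_seq_indep (I : eqType) (s : seq I) (Us : I -> {vspace V})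
    (c : I -> V) :
  directv (\sum_(i <- s) Us i) -> uniq s ->
  (forall i, i \in s -> c i \in Us i) -> \sum_(i <- s) c i = 0 ->
  forall i, i \in s -> c i = 0.
Proof.
rewrite directvE /= 2!big_tnth -directvE => /directv_sum_independent dU us Uc.
rewrite big_tnth => c0 i si.
have ids : (index i s < size s)%N by rewrite index_mem.
have -> : i = tnth (in_tuple s) (Ordinal ids) by rewrite (tnth_nth i) /= nth_index.
by apply: dU c0 (Ordinal ids) isT => j _; apply: Uc; apply: mem_tnth.
Qed.

Lemma span_comp_mem (G : eqType) (M : seq (G * V)) p :
  p \in M -> p.2 \in span_comp M p.1.
Proof. by move=> pM; apply/memv_span/map_f; rewrite mem_filter eqxx. Qed.

Lemma span_comp_supp (G : eqType) (M : seq (G * V)) g :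
  span_comp M g != 0%VS -> g \in map fst M.
Proof.
apply: contraR => gM; rewrite /span_comp (_ : [seq p <- M | _] = [::]) ?span_nil //.
apply/eqP; rewrite -[_ == _]negbK -has_filter; apply: contra gM.
by case/hasP => p pM /eqP <-; apply/map_f.
Qed.

Lemma span_comp_perm (G : eqType) (M M' : seq (G * V)) :
  perm_eq M M' -> span_comp M =1 span_comp M'.
Proof. by move=> MM' g; apply/eq_span/perm_mem/perm_map/perm_filter. Qed.

Lemma components_span (G : zmodType) (L : seq (G * seq V)) :
  components [seq (p.1, <<p.2>>%VS) | p <- L] =1
  span_comp [seq (p.1, x) | p <- L, x <- p.2].
Proof.
move=> g; rewrite /components; elim: L => [|p L IH].
  by rewrite big_nil /span_comp span_nil.
rewrite /= big_cons IH /span_comp filter_cat map_cat span_cat /=.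
have -> : [seq q.2 | q <- [seq (p.1, x) | x <- p.2] & q.1 == g] =
    if p.1 == g then p.2 else [::].
  by case: ifP => pg; elim: (p.2) => //= x X; rewrite pg //= => ->.
by case: eqP; rewrite ?span_nil ?add0v.
Qed.

Lemma span_comp_full (G : eqType) (M : seq (G * V)) (s : seq G) :
  {subset map fst M <= s} -> <<map snd M>>%VS = fullv ->
  (\sum_(g <- s) span_comp M g)%VS = fullv.
Proof.
move=> Ms spM; apply/eqP; rewrite eqEsubv subvf -spM.
apply/span_subvP => _ /mapP[p pM ->].
have ps : p.1 \in s by apply/Ms/map_f.
by rewrite (big_rem _ ps) /=; apply: (subvP (addvSl _ _)); apply: span_comp_mem.
Qed.

Lemma span_ind (X : seq V) (P : V -> Prop) :
  P 0 -> (forall x y, P x -> P y -> P (x + y)) ->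
  (forall (k : F) x, P x -> P (k *: x)) -> (forall x, x \in X -> P x) ->
  forall x, x \in <<X>>%VS -> P x.
Proof.
move=> P0 PD PZ; elim: X => [|y X IH] PX x.
  by rewrite span_nil memv0 => /eqP ->.
rewrite span_cons => /memv_addP[_ /vlineP[k ->] [z Xz ->]].
apply: PD; first by apply/PZ/PX; rewrite inE eqxx.
by apply: IH => // t tX; apply: PX; rewrite inE tX orbT.
Qed.

(** Directness is a dimension count: the component of degree g has dimension at most the number of
    basis vectors of that degree, and these numbers add up to the dimension of the whole space. *)
Lemma span_comp_decomposition (G : zmodType) (M : seq (G * V)) :
  basis_of fullv (map snd M) -> decomposition (span_comp M).
Proof.
move=> bM; have/andP[/eqP spM frM] := bM.
pose s := undup (map fst M).
have mem_comp := @span_comp_mem G M.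
have full : (\sum_(g <- s) span_comp M g)%VS = fullv.
  by apply: span_comp_full => // g; rewrite mem_undup.
exists s; split=> //; first exact: undup_uniq.
- move=> g; rewrite mem_undup; apply/mapP/idP => [[p pM ->]|].
    have := free_not0 frM (map_f snd pM); apply: contraNneq => p0.
    by have := mem_comp p pM; rewrite p0 memv0.
  move=> nz; case hs: [seq p <- M | p.1 == g] => [|p l].
    by rewrite /span_comp hs span_nil eqxx in nz.
  have : p \in [seq p <- M | p.1 == g] by rewrite hs inE eqxx.
  by rewrite mem_filter => /andP[/eqP <- pM]; exists p.
- rewrite directvEgeq /= full -(span_basis bM).
  have /eqP -> : \dim <<map snd M>> == size (map snd M) by exact: frM.
  rewrite size_map -(size_map fst).
  have -> : size (map fst M) = (\sum_(g <- s) count_mem g (map fst M))%N.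
    rewrite -(perm_size (perm_count_undup _)) size_flatten /shape -map_comp.
    by rewrite sumnE big_map; apply: eq_bigr => g _; rewrite /= size_nseq.
  apply: leq_sum => g _; apply: leq_trans (dim_span _) _.
  by rewrite size_map size_filter count_map.
Qed.

Variables (G : zmodType) (Gamma : G -> {vspace V}).
Hypothesis Gamma_dec : decomposition Gamma.

Lemma decomposition_proj : exists (s : seq G) (pi : G -> V -> V),
  [/\ uniq s, forall g, {morph pi g : x y / x + y},
      forall g x, pi g x \in Gamma g,
      forall g h x, x \in Gamma h -> pi g x = if g == h then x else 0 &
      forall x, x = \sum_(g <- s) pi g x].
Proof.
have [s [us mems dir full]] := Gamma_dec.
pose pi g x := if g \in s then sumv_pi_for (esym full) g x else 0.
have piG g x : pi g x \in Gamma g.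
  by rewrite /pi; case: ifP => _; rewrite ?mem0v ?memv_sum_pi.
have pisum x : x = \sum_(g <- s) pi g x.
  rewrite -[LHS](@sumv_pi_uniq_sum _ _ _ _ _ _ _ (esym full)) ?memvf //.
    by rewrite [LHS]big_seq [RHS]big_seq; apply: eq_bigr => g; rewrite /pi => ->.
  by rewrite filter_predT.
exists s, pi; split=> // [g x y|g h x xh].
  by rewrite /pi; case: ifP; rewrite ?linearD ?addr0.
have [hs|] := boolP (h \in s); last first.
  rewrite mems negbK => /eqP h0; move: xh; rewrite h0 memv0 => /eqP ->.
  by rewrite if_same /pi linear0 if_same.
have [gs|gs] := boolP (g \in s); last first.
  by rewrite /pi (negPf gs); case: eqP gs => // ->; rewrite hs.
have := @directv_seq_indep _ s Gamma (fun k => pi k x - if k == h then x else 0)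
  dir us _ _ g gs.
move/(_ _ _)/eqP; rewrite subr_eq0 => e; apply/eqP/e.
  by move=> k _; case: eqP => [->|_]; rewrite ?subr0 ?rpredB.
rewrite sumrB -pisum -big_mkcond -big_filter filter_pred1_uniq // big_seq1.
by rewrite subrr.
Qed.

Lemma decomposition_disjoint g h x :
  x \in Gamma g -> x \in Gamma h -> x != 0 -> g = h.
Proof.
have [s [pi [_ _ _ piE _]]] := decomposition_proj.
move=> xg xh; have := piE g h x xh; rewrite (piE g g x xg) eqxx.
by case: eqP => // _ ->; rewrite eqxx.
Qed.

(** A homogeneous vector of degree [g] is decomposed along [Delta] and projected back to degree [g]:
    as [theta] is injective on [s], at most one term survives. So inclusions between components are
    equalities, and [Gamma] has no further component. *)
Lemma decomposition_match (A : zmodType) (Delta : A -> {vspace V})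
    (theta : A -> G) (s : seq A) :
  uniq s -> {in s &, injective theta} ->
  (forall a, a \in s -> (Delta a <= Gamma (theta a))%VS) ->
  (\sum_(a <- s) Delta a)%VS = fullv ->
  (forall a, a \in s -> Gamma (theta a) = Delta a) /\
  (forall g, Gamma g != 0%VS -> exists2 a, a \in s & g = theta a).
Proof.
move=> us inj sub full.
have [_ [pi [_ piD piG piE _]]] := decomposition_proj.
have key g x : x \in Gamma g ->
    x = 0 \/ exists a, [/\ a \in s, g = theta a & x \in Delta a].
  move=> xg; pose c a := sumv_pi_for (esym full) a x.
  have cs : \sum_(a <- s) c a = x.
    by rewrite sumv_pi_uniq_sum ?memvf // filter_predT.
  have cD a : c a \in Delta a by rewrite memv_sum_pi.
  have pi0 : pi g 0 = 0 by rewrite (piE g g) ?mem0v // eqxx.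
  have : x = \sum_(a <- s) (if g == theta a then c a else 0).
    have := piE g g x xg; rewrite eqxx => {1}<-.
    rewrite -[in LHS]cs (big_morph _ (piD g) pi0).
    by rewrite [LHS]big_seq [RHS]big_seq; apply: eq_bigr => a sa;
      apply: piE; apply: (subvP (sub a sa)).
  have [/hasP[a sa /eqP ga]|/hasPn no] := boolP (has (fun a => g == theta a) s).
    rewrite (bigD1_seq a) //= ga eqxx big_seq_cond big1 ?addr0 => [->|b].
      by right; exists a.
    move=> /andP[sb ba]; case: eqP => // /inj -/(_ sa sb) ab.
    by rewrite ab eqxx in ba.
  by rewrite big_seq big1 => [->|a /no /negPf ->]; [left|].
split=> [a sa|g nz].
  apply/eqP; rewrite eqEsubv sub // andbT; apply/subvP => x /key[->|].
    exact: mem0v.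
  by case=> b [sb /inj -> //].
have [x xg x0] : exists2 x, x \in Gamma g & x != 0.
  by exists (vpick (Gamma g)); rewrite ?memv_pick ?vpick0.
case: (key g x xg) => [e|[a [sa ga _]]]; first by rewrite e eqxx in x0.
by exists a.
Qed.

End Decompositions.

(** * Universal grading groups and relabelling of degrees *)

Section Universal.

Variables (F : fieldType) (V : vectType F) (mul : V -> V -> V).
Hypotheses (mul0v : forall x, mul 0 x = 0) (mulv0 : forall x, mul x 0 = 0).

Lemma support_relation_nz (G : zmodType) (Gamma : G -> {vspace V}) g1 g2 g3 :
  support_relation mul Gamma g1 g2 g3 ->
  [/\ Gamma g1 != 0%VS, Gamma g2 != 0%VS & Gamma g3 != 0%VS].
Proof.
case=> [[x [y [x1 y2 xy]]] sub]; split.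
- by apply: contraNneq xy => g0; move: x1; rewrite g0 memv0 => /eqP ->; rewrite mul0v.
- by apply: contraNneq xy => g0; move: y2; rewrite g0 memv0 => /eqP ->; rewrite mulv0.
by apply: contraNneq xy => g0; have := sub x y x1 y2; rewrite g0 memv0.
Qed.

Lemma support_relation_add (G : zmodType) (Gamma : G -> {vspace V}) g1 g2 g3 :
  alg_grading mul Gamma -> support_relation mul Gamma g1 g2 g3 -> g1 + g2 = g3.
Proof.
case=> dec gr [[x [y [x1 y2 xy]]] sub].
exact: (decomposition_disjoint dec (gr _ _ _ _ x1 y2) (sub _ _ x1 y2) xy).
Qed.

Lemma grading_support_relation (G : zmodType) (Gamma : G -> {vspace V}) g1 g2 x y :
  alg_grading mul Gamma -> x \in Gamma g1 -> y \in Gamma g2 -> mul x y != 0 ->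
  support_relation mul Gamma g1 g2 (g1 + g2).
Proof. by case=> _ gr x1 y2 xy; split; [exists x, y | apply: gr]. Qed.

Lemma universal_degree_id (A : zmodType) (Delta : A -> {vspace V}) :
  alg_grading mul Delta ->
  (forall (K : zmodType) (f : A -> K), respects_relations mul Delta f ->
    exists theta : {additive A -> K},
      (forall a, Delta a != 0%VS -> theta a = f a) /\
      (forall theta' : {additive A -> K},
        (forall a, Delta a != 0%VS -> theta' a = f a) -> theta' =1 theta)) ->
  universal_degree mul Delta id.
Proof.
by move=> gr univ; split=> // g1 g2 g3; apply: support_relation_add.
Qed.

(** The universal group depends only on the components and the relations among them, not on the
    ambient group; [theta] merely renames the degrees of the support. *)
Lemma universal_group_transfer (G A : zmodType) (Gamma : G -> {vspace V})
    (Delta : A -> {vspace V}) (theta : A -> G) (s : seq A) :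
  {in s &, injective theta} ->
  (forall a, a \in s -> Gamma (theta a) = Delta a) ->
  (forall a, Delta a != 0%VS -> a \in s) ->
  (forall g, Gamma g != 0%VS -> exists2 a, a \in s & g = theta a) ->
  universal_degree mul Delta id -> universal_group mul Gamma A.
Proof.
move=> inj eqGD Ds Gs [resp univ].
(* The inverse of [theta] on the renamed degrees. Elsewhere it takes the default value 0, which is
   harmless since every relation involves degrees of the support only. *)
pose deg g := nth 0 s (index g (map theta s)).
have degK a : a \in s -> deg (theta a) = a.
  move=> sa; have ids : (index (theta a) (map theta s) < size s)%N.
    by rewrite -(size_map theta) index_mem map_f.
  apply: inj => //; first by rewrite /deg mem_nth.
  by rewrite /deg -(nth_map 0 (theta 0)) // nth_index // map_f.
have relE a b c : a \in s -> b \in s -> c \in s ->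
    support_relation mul Gamma (theta a) (theta b) (theta c) <->
    support_relation mul Delta a b c.
  by move=> sa sb sc; rewrite /support_relation !eqGD.
exists deg; split=> [g1 g2 g3 rel|K f fresp].
  have [/Gs[a sa e1] /Gs[b sb e2] /Gs[c sc e3]] := support_relation_nz rel.
  by move: rel; rewrite e1 e2 e3 !degK // relE // => /resp.
have fresp' : respects_relations mul Delta (f \o theta).
  move=> a b c rel; apply: fresp.
  by have [/Ds sa /Ds sb /Ds sc] := support_relation_nz rel; apply/relE.
have [eta [etaE etaU]] := univ K _ fresp'.
exists eta; split=> [g nz|eta' eta'E].
  have [a sa e] := Gs g nz.
  by rewrite e degK // etaE //= -eqGD // -e.
apply: etaU => a nz; have sa := Ds a nz.
by rewrite /= -eta'E ?degK // eqGD.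
Qed.

End Universal.

Section UpToEquiv.

Variables (F : fieldType) (Q : hurwitzAlg F) (alpha : F) (phi : 'End(CD Q)).

Local Notation om := (okubo_mul alpha phi).
Hypotheses (om0v : forall x, om 0 x = 0) (omv0 : forall x, om x 0 = 0).

(** The equivalence is the identity map: the target grading is written in a basis adapted to
    [Gamma], so only the degrees change. *)
Lemma is_up_to_equiv_match (H A : zmodType) (Gamma : H -> {vspace CD Q})
    (Delta : A -> {vspace CD Q}) (theta : A -> H) (s : seq A) :
  okubo_grading alpha phi Gamma -> okubo_grading alpha phi Delta ->
  universal_degree om Delta id ->
  uniq s -> {in s &, injective theta} ->
  (forall a, a \in s -> (Delta a <= Gamma (theta a))%VS) ->
  (\sum_(a <- s) Delta a)%VS = fullv ->
  is_up_to_equiv alpha phi Gamma Delta.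
Proof.
move=> Ggr Dgr univ us inj sub full.
have [eqGD Gs] := decomposition_match Ggr.1.1 us inj sub full.
have [_ Ds] := decomposition_match (theta := id) Dgr.1.1 us
  (fun _ _ _ _ => id) (fun a _ => subvv _) full.
split=> //.
  apply: (universal_group_transfer om0v omv0 inj eqGD _ Gs univ) => a /Ds.
  by case=> b sb ->.
exists \1%VF => [|g /Gs[a sa ->]].
  split=> [|x y||]; rewrite ?lim1g ?id_lfunE //.
  by exists id => x; rewrite id_lfunE.
by exists a; rewrite lim1g eqGD.
Qed.

End UpToEquiv.
(** * Gradings of Okubo superalgebras *)

Section CayleyDicksonChar2.

Variables (F : fieldType) (charF : 2%N \in [pchar F]).
Variables (Q : hurwitzAlg F) (dimQ : \dim {: Q} = 4%N).
Variables (alpha : F) (alpha_neq0 : alpha != 0).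
Implicit Types (a b c d : Q).

Local Notation B := (@qform F Q).
Local Notation cj := (@qconj F Q).
Local Notation "1q" := (hw_one Q).
Local Notation mulC := (@cd_mul F Q alpha).

Lemma cd_mulE a b c d :
  mulC (a, b) (c, d) = (a ** c + alpha *: (cj d ** b), d ** a + b ** cj c) :> CD Q.
Proof. by rewrite /cd_mul qconj.unlock (opp2v charF). Qed.

Lemma cd_mul_ee a c : mulC (a, 0) (c, 0) = (a ** c, 0) :> CD Q.
Proof. by rewrite cd_mulE !(qmul0, qmulx0, scaler0, addr0). Qed.

Lemma cd_mul_eo a d : mulC (a, 0) (0, d) = (0, d ** a) :> CD Q.
Proof. by rewrite cd_mulE !(qmul0, qmulx0, scaler0, addr0). Qed.

Lemma cd_mul_oe b c : mulC (0, b) (c, 0) = (0, b ** cj c) :> CD Q.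
Proof. by rewrite cd_mulE qconj0 // !(qmul0, scaler0, addr0, add0r). Qed.

Lemma cd_mul_oo b d : mulC (0, b) (0, d) = (alpha *: (cj d ** b), 0) :> CD Q.
Proof. by rewrite cd_mulE qconj0 // !(qmul0, qmulx0, addr0, add0r). Qed.

Lemma cd_polarE a b c d :
  polar (cd_norm alpha) ((a, b) : CD Q) (c, d) = B a c + alpha * B b d.
Proof.
rewrite /polar /cd_norm /= !qnormD !mulrDr !(opp2f charF).
set x := nq a; set y := nq c; set z := alpha * nq b; set t := alpha * nq d.
set u := B a c; set v := alpha * B b d.
have -> : x + y + u + (z + t + v) + (x + z) + (y + t) =
          (x + x) + (y + y) + (z + z) + (t + t) + (u + v) by ring.
by rewrite !(add2f charF) !add0r.
Qed.

Lemma cd_conjE a b : cd_conj alpha ((a, b) : CD Q) = (cj a, b).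
Proof.
rewrite /cd_conj cd_polarE qformx0 mulr0 addr0 qconjE //.
by rewrite -[- _](opp2v charF) opprK /cd_one; congr pair; rewrite /= scaler0 add0r.
Qed.

(** The even part is the image of [linfun] of a bare function, which can be evaluated only once that
    function is bundled as a linear map. *)
Lemma even_pairP (x : CD Q) : reflect (exists a, x = (a, 0)) (x \in cd_even Q).
Proof.
have lin : linear (fun a : Q => (a, 0) : CD Q).
  by move=> k a b; rewrite /= -[RHS]/(_, _) /= scaler0 addr0.
pose f : {linear Q -> CD Q} := HB.pack (fun a : Q => (a, 0) : CD Q)
  (GRing.isLinear.Build F Q (CD Q) _ _ lin).
have fE : linfun (fun a : Q => (a, 0) : CD Q) =1 f by move=> a; rewrite (lfunE f).
apply: (iffP memv_imgP) => [[a _ ->]|[a ->]]; first by exists a; rewrite fE.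
by exists a; rewrite ?memvf // fE.
Qed.

Lemma odd_pairP (x : CD Q) : reflect (exists b, x = (0, b)) (x \in cd_odd Q).
Proof.
have lin : linear (fun b : Q => (0, b) : CD Q).
  by move=> k a b; rewrite /= -[RHS]/(_, _) /= scaler0 addr0.
pose f : {linear Q -> CD Q} := HB.pack (fun b : Q => (0, b) : CD Q)
  (GRing.isLinear.Build F Q (CD Q) _ _ lin).
have fE : linfun (fun b : Q => (0, b) : CD Q) =1 f by move=> a; rewrite (lfunE f).
apply: (iffP memv_imgP) => [[a _ ->]|[a ->]]; first by exists a; rewrite fE.
by exists a; rewrite ?memvf // fE.
Qed.

Lemma dim_CD : \dim (fullv : {vspace CD Q}) = 8%N.
Proof. by rewrite dimvf /dim /= -!dimvf dimQ. Qed.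

Variable phi : 'End(CD Q).

(** Write phi(u) = p + wu. Since uc = conj(c) u, the component [p] satisfies the twisted commutation
    of [qconj_twist] and vanishes. Applying [phi] to u squared gives q(w) = 1, and the order of
    [phi] gives the trace. *)
Lemma automorphism_odd_mul :
  cd_automorphism alpha phi -> phi != \1%VF ->
  (forall x, phi (phi (phi x)) = x) -> (forall a : Q, phi (a, 0) = (a, 0)) ->
  exists w : Q, [/\ B w 1q = 1, nq w = 1 & forall a b, phi (a, b) = (a, w ** b)].
Proof.
case=> _ phiM phi1 phi3 phiQ.
case e : (phi (0, 1q)) => [p w].
have phiO b : phi (0, b) = (b ** p, w ** b).
  rewrite -{1}[b]qmul1 -cd_mul_eo phiM phiQ e cd_mulE.
  by rewrite !(qmulx0, qmul0, scaler0, addr0).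
have p0 : p = 0.
  apply: (qconj_twist charF dimQ) => u.
  have := phiM (0, 1q) (u, 0).
  rewrite cd_mul_oe !phiO phiQ cd_mulE !qmul1 qconj0 // qmul0 scaler0 addr0.
  by case.
rewrite {}p0 in e phiO.
have {}phiO b : phi (0, b) = (0, w ** b) by rewrite phiO qmulx0.
have phiE a b : phi (a, b) = (a, w ** b).
  have -> : (a, b) = (a, 0) + (0, b) :> CD Q by congr pair; rewrite /= ?addr0 ?add0r.
  by rewrite linearD /= phiQ phiO; congr pair; rewrite /= ?addr0 ?add0r.
have nw : nq w = 1.
  have := phiM (0, 1q) (0, 1q); rewrite !phiO !cd_mul_oo phiQ !qmulx1.
  rewrite qconj1 // qmul_conj // => -[].
  move=> /(scalerI alpha_neq0)/eqP.
  rewrite -subr_eq0 -{1}(scale1r 1q) -scalerBl scaler_eq0.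
  by rewrite (negPf (qone_neq0 dimQ)) orbF subr_eq0 => /eqP <-.
exists w; split=> //.
have := phi3 (0, 1q); rewrite !phiE qmulx1 => -[].
rewrite qsqr // nw scale1r qmulDr qmulZr qmulx1 qsqr // nw scale1r.
set t := B w 1q => h.
apply: NNPP => t1.
have t1' : t + 1 != 0 by apply/eqP => /eqP; rewrite addr_eq0 (opp2f charF) => /eqP.
(* This is the cube of [w] being 1, reduced by the quadratic equation of [w]. If t were not 1, [w]
   would be a scalar of norm 1, hence 1, and [phi] would be the identity. *)
have h' : (t + 1) *: ((t + 1) *: w) = (t + 1) *: 1q.
  rewrite scalerA; have -> : (t + 1) * (t + 1) = t * t + 1.
    have -> : (t + 1) * (t + 1) = t * t + 1 + (t + t) by ring.
    by rewrite (add2f charF) addr0.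
  rewrite !scalerDl !scale1r -[X in _ = _ + X]h scalerDr scalerA.
  by rewrite addrA addrCA (add2v charF) addr0.
have {h'} wE := scalerI t1' h'.
have : w = (t + 1)^-1 *: 1q by rewrite -wE scalerA mulVf // scale1r.
move=> {}wE; move: nw; rewrite wE qnormZ qnorm1 // mulr1 => c2.
have c1 : (t + 1)^-1 = 1.
  apply/eqP; rewrite -subr_eq0 -sqrf_eq0 (opp2f charF) sqrrD1 c2.
  by rewrite addrAC (add2f charF) add0r mulr2n (add2f charF).
case/eqP: phi1; apply/lfunP => -[a b]; rewrite phiE wE c1 scale1r qmul1.
by rewrite id_lfunE.
Qed.

End CayleyDicksonChar2.

(** * From gradings of the Okubo product to gradings of the Hurwitz product *)

Section OkuboGrading.

Variables (F : fieldType) (charF : 2%N \in [pchar F]).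
Variables (Q : hurwitzAlg F) (dimQ : \dim {: Q} = 4%N).
Variables (alpha : F) (alpha_neq0 : alpha != 0).
Implicit Types (a b c d : Q).

Local Notation B := (@qform F Q).
Local Notation cj := (@qconj F Q).
Local Notation "1q" := (hw_one Q).

Lemma pairD a b c d : (a, b) + (c, d) = (a + c, b + d) :> CD Q.
Proof. by []. Qed.

Lemma pairZ k a b : k *: ((a, b) : CD Q) = (k *: a, k *: b).
Proof. by []. Qed.

(* Even and odd parts of the homogeneous components of a grading of C = Q + Qu,
   as subsets of Q: E g a means a in C_g, and N g b means b.u in C_g. *)
Record qgrading (w : Q) (H : zmodType) (E N : H -> Q -> Prop) : Prop := QGrading {
  qgr_evenD : forall g a b, E g a -> E g b -> E g (a + b);
  qgr_evenZ : forall g k a, E g a -> E g (k *: a);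
  qgr_oddD : forall g a b, N g a -> N g b -> N g (a + b);
  qgr_oddZ : forall g k a, N g a -> N g (k *: a);
  even1 : E 0 1q;
  even_conj : forall g a, E g a -> E g (cj a);
  even_mul : forall g h a b, E g a -> E h b -> E (g + h) (a ** b);
  odd_mul : forall g h b a, N g b -> E h a -> N (g + h) (b ** a);
  odd_conj_mul : forall g h b d, N g b -> N h d -> E (g + h) (cj d ** b);
  odd_w : forall g b, N g b -> N g (w ** b);
  even_uniq : forall g h a, E g a -> E h a -> a != 0 -> g = h;
  odd_uniq : forall g h b, N g b -> N h b -> b != 0 -> g = h;
  even_ind : forall P : Q -> Prop, P 0 -> (forall a b, P a -> P b -> P (a + b)) ->
    (forall g a, E g a -> P a) -> forall a, P a;
  odd_ind : forall P : Q -> Prop, P 0 -> (forall a b, P a -> P b -> P (a + b)) ->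
    (forall g b, N g b -> P b) -> forall b, P b
}.

Variables (phi : 'End(CD Q)) (w : Q).
Hypotheses (Bw : B w 1q = 1) (nw : nq w = 1).
Hypothesis phiE : forall a b, phi (a, b) = (a, w ** b).

Local Notation mulC := (@cd_mul F Q alpha).
Local Notation conjC := (@cd_conj F Q alpha).
Local Notation om := (okubo_mul alpha phi).

Lemma conj_w : cj w = w + 1q.
Proof. by rewrite qconjE // Bw scale1r addrC. Qed.

Lemma sqr_w : w ** w = w + 1q.
Proof. by rewrite qsqr // Bw nw !scale1r. Qed.

Lemma cube_w a : w ** (w ** (w ** a)) = a.
Proof. by rewrite (qmulA charF dimQ w w) sqr_w -conj_w qmul_conjK // nw scale1r. Qed.

Lemma okubo_mul0v (x : CD Q) : om 0 x = 0.
Proof.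
case: x => a b; rewrite /okubo_mul -[0]/(0, 0) !cd_conjE // !phiE cd_mulE //.
by rewrite qconj0 // !(qmul0, qmulx0, scaler0, addr0).
Qed.

Lemma okubo_mulv0 (x : CD Q) : om x 0 = 0.
Proof.
case: x => a b; rewrite /okubo_mul -[0]/(0, 0) !cd_conjE // !phiE cd_mulE //.
by rewrite qconj0 // !(qmul0, qmulx0, qconj0, scaler0, addr0).
Qed.

(** The conjugation and [phi] commute, so the twists in the Okubo product compose with those
    inserted here to the conjugation squared and the cube of [phi], both trivial. *)
Lemma okubo_mulK (x y : CD Q) :
  om (phi (phi (conjC x))) (phi (conjC y)) = mulC x y.
Proof.
case: x y => a b [c d].
rewrite /okubo_mul [conjC (a, b)]cd_conjE // [conjC (c, d)]cd_conjE //.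
rewrite [phi (cj a, b)]phiE [phi (cj a, w ** b)]phiE [phi (cj c, d)]phiE.
rewrite [conjC (cj a, _)]cd_conjE // [conjC (cj c, _)]cd_conjE //.
rewrite [phi (_, w ** (w ** b))]phiE [phi (_, w ** d)]phiE.
by rewrite [phi (_, w ** (w ** d))]phiE !cube_w !qconjK.
Qed.

Section FromGrading.

Variables (H : zmodType) (Gamma : H -> {vspace CD Q}).
Hypothesis Gamma_gr : okubo_grading alpha phi Gamma.

Let dec : decomposition Gamma := Gamma_gr.1.1.

Let Gom g h x y : x \in Gamma g -> y \in Gamma h -> om x y \in Gamma (g + h).
Proof. exact: Gamma_gr.1.2. Qed.

Lemma grading_parts g a b :
  (a, b) \in Gamma g -> ((a, 0) : CD Q) \in Gamma g /\ ((0, b) : CD Q) \in Gamma g.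
Proof.
rewrite {1}(Gamma_gr.2 g) => /memv_addP[u /[!memv_cap]/andP[ug /even_pairP[a' ua]]].
case=> v /[!memv_cap]/andP[vg /odd_pairP[b' vb]].
rewrite ua in ug; rewrite vb in vg; rewrite ua vb pairD add0r addr0 => -[-> ->].
by [].
Qed.

Let fst_sum (G : zmodType) (s : seq G) (c : G -> CD Q) :
  (\sum_(g <- s) c g).1 = \sum_(g <- s) (c g).1.
Proof. exact: (big_morph (fun x : CD Q => x.1)). Qed.

Let snd_sum (G : zmodType) (s : seq G) (c : G -> CD Q) :
  (\sum_(g <- s) c g).2 = \sum_(g <- s) (c g).2.
Proof. exact: (big_morph (fun x : CD Q => x.2)). Qed.

Let even_gen (P : Q -> Prop) : P 0 -> (forall a b, P a -> P b -> P (a + b)) ->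
  (forall g a, ((a, 0) : CD Q) \in Gamma g -> P a) -> forall a, P a.
Proof.
move=> P0 PD PG a; have [s [pi [_ _ piG _ pisum]]] := decomposition_proj dec.
have -> : a = \sum_(g <- s) (pi g (a, 0)).1 by rewrite -fst_sum -pisum.
apply: big_ind => // g _; apply: (PG g).
by have := piG g (a, 0); case: (pi _ _) => a' b' /grading_parts[].
Qed.

Let odd_gen (P : Q -> Prop) : P 0 -> (forall a b, P a -> P b -> P (a + b)) ->
  (forall g a, ((0, a) : CD Q) \in Gamma g -> P a) -> forall a, P a.
Proof.
move=> P0 PD PG a; have [s [pi [_ _ piG _ pisum]]] := decomposition_proj dec.
have -> : a = \sum_(g <- s) (pi g (0, a)).2 by rewrite -snd_sum -pisum.
apply: big_ind => // g _; apply: (PG g).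
by have := piG g (0, a); case: (pi _ _) => a' b' /grading_parts[].
Qed.

Let om_ee a c : om (a, 0) (c, 0) = (cj a ** cj c, 0).
Proof. by rewrite /okubo_mul !cd_conjE // !phiE !qmulx0 cd_mul_ee. Qed.

(* The commuting elements of the even part form a graded subspace, and they
   are the multiples of 1 since Q is central. *)
Lemma grading_one : ((1q, 0) : CD Q) \in Gamma 0.
Proof.
have [s [pi [us piD piG piE pisum]]] := decomposition_proj dec.
pose u g := (pi g (1q, 0)).1.
have uG g : ((u g, 0) : CD Q) \in Gamma g.
  by have := piG g (1q, 0); rewrite /u; case: (pi _ _) => a b /grading_parts[].
have usum : \sum_(g <- s) u g = 1q.
  by rewrite -fst_sum -pisum.
have pi0 g : pi g 0 = 0 by rewrite (piE g g) ?mem0v // eqxx.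
(* The commutators of [y] with the components of 1 lie in pairwise different degrees [g + h], and
   their sum is the commutator with 1, which is 0; so each of them vanishes. *)
have homC h y k : ((y, 0) : CD Q) \in Gamma h -> k \in s ->
    cj (u k) ** cj y = cj y ** cj (u k).
  move=> yh sk; apply: (add2v_eq0 charF).
  pose z g : CD Q := (cj (u g) ** cj y + cj y ** cj (u g), 0).
  have zG g : z g \in Gamma (g + h).
    have -> : z g = om (u g, 0) (y, 0) + om (y, 0) (u g, 0).
      by rewrite !om_ee pairD addr0.
    apply: rpredD; [|rewrite addrC]; exact: Gom.
  have z0 : \sum_(g <- s) z g = 0.
    have zD : {morph (fun v => (cj v ** cj y + cj y ** cj v, 0) : CD Q) : a b / a + b}.
      by move=> a b; rewrite pairD addr0 qconjD // qmulDl qmulDr addrACA.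
    rewrite -(big_morph _ (id2 := 0) zD); last by rewrite qconj0 // qmul0 qmulx0 addr0.
    by rewrite usum qconj1 // qmul1 qmulx1 (add2v charF).
  have : pi (k + h) (z k) = 0.
    rewrite -(pi0 (k + h)) -z0 (big_morph _ (piD _) (pi0 _)).
    rewrite (bigD1_seq k) //= big1 ?addr0 // => g gk; rewrite (piE _ (g + h)) ?zG //.
    by rewrite (inj_eq (addIr h)) eq_sym (negPf gk).
  by rewrite (piE _ (k + h)) ?zG // eqxx => -[].
have scal k : k \in s -> exists c : F, cj (u k) = c *: 1q.
  move=> sk; apply: (quaternion_center charF dimQ) => y; rewrite -(qconjK charF y).
  move: (cj y); apply: even_gen => [|a b ha hb|h a ah]; last exact: homC ah sk.
    by rewrite qconj0 // qmulx0 qmul0.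
  by rewrite qconjD // qmulDl qmulDr ha hb.
(* A nonzero component of 1 is a scalar, so 1 itself is homogeneous of degree [k]; then 1 * 1 = 1
   forces k + k = k. *)
have [k sk uk] : exists2 k, k \in s & u k != 0.
  have : \sum_(g <- s) u g != 0 by rewrite usum (qone_neq0 dimQ).
  move=> nz; apply: NNPP => nex; case/eqP: nz; rewrite big_seq big1 // => g sg.
  by apply: NNPP => /eqP ug; apply: nex; exists g.
have [c uc] := scal k sk.
have {}uc : u k = c *: 1q by rewrite -[u k](qconjK charF) uc qconjZ // qconj1.
have c0 : c != 0 by apply: contraNneq uk => c0; rewrite uc c0 scale0r.
have oneG : ((1q, 0) : CD Q) \in Gamma k.
  have -> : ((1q, 0) : CD Q) = c^-1 *: (u k, 0).
    by rewrite pairZ uc scalerA mulVf // scale1r scaler0.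
  by rewrite rpredZ.
have : k + k = k.
  apply: (decomposition_disjoint dec (x := (1q, 0))) => //.
    by rewrite -{1}[1q]qmul1 -{1 2}(qconj1 charF Q) -om_ee Gom.
  by apply/eqP => -[/eqP]; rewrite (negPf (qone_neq0 dimQ)).
by move=> kk; have -> : 0 = k; first by apply: (@addrI _ k); rewrite addr0 kk.
Qed.

(** Right Okubo multiplication by 1 has degree 0 and sends (a, b) to (conj a, wb). Its cube is the
    conjugation and its fourth power is [phi]. *)
Let Gw g x : x \in Gamma g -> (conjC x \in Gamma g) /\ (phi x \in Gamma g).
Proof.
case: x => a b xg; have one := grading_one.
have Gwc : ((cj a, w ** b) : CD Q) \in Gamma g.
  have := Gom xg one; rewrite addr0 /okubo_mul !cd_conjE // !phiE !qmulx0.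
  by rewrite cd_mulE // !qconj1 // qmulx1 !(qmul0, qconj0) // scaler0 addr0 qmulx1 add0r.
have Gwwc c d : ((c, d) : CD Q) \in Gamma g -> ((cj c, w ** d) : CD Q) \in Gamma g.
  move=> xg'; have := Gom xg' one; rewrite addr0 /okubo_mul !cd_conjE // !phiE !qmulx0.
  by rewrite cd_mulE // !qconj1 // qmulx1 !(qmul0, qconj0) // scaler0 addr0 qmulx1 add0r.
have := Gwwc _ _ (Gwwc _ _ Gwc); rewrite cube_w qconjK // => Gc.
have := Gwwc _ _ (Gwwc _ _ (Gwwc _ _ (Gwwc _ _ xg))); rewrite cube_w !qconjK // => Gp.
by rewrite cd_conjE // phiE.
Qed.

Lemma grading_conj g x : x \in Gamma g -> conjC x \in Gamma g.
Proof. by case/Gw. Qed.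

Lemma grading_phi g x : x \in Gamma g -> phi x \in Gamma g.
Proof. by case/Gw. Qed.

Lemma grading_mul g h x y :
  x \in Gamma g -> y \in Gamma h -> mulC x y \in Gamma (g + h).
Proof.
move=> xg yh; rewrite -okubo_mulK.
exact: Gom (grading_phi (grading_phi (grading_conj xg))) (grading_phi (grading_conj yh)).
Qed.

(** Components are stable under [phi] and the conjugation, so the relations of the universal group
    can be read off from nonzero Hurwitz products, whose table is much simpler. *)
Lemma okubo_support_relation g h x y :
  x \in Gamma g -> y \in Gamma h -> mulC x y != 0 ->
  support_relation om Gamma g h (g + h).
Proof.
move=> xg yh; rewrite -okubo_mulK => nz.
apply: (grading_support_relation Gamma_gr.1 _ _ nz).
  exact: grading_phi (grading_phi (grading_conj xg)).
exact: grading_phi (grading_conj yh).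
Qed.

Lemma okubo_qgrading : qgrading w (fun g a => ((a, 0) : CD Q) \in Gamma g)
  (fun g b => ((0, b) : CD Q) \in Gamma g).
Proof.
have nz1 a : a != 0 -> ((a, 0) : CD Q) != 0.
  by apply: contraNneq => -[->].
have nz2 a : a != 0 -> ((0, a) : CD Q) != 0.
  by apply: contraNneq => -[->].
split=> //.
- by move=> g a b ag bg; rewrite -[0]addr0 -pairD rpredD.
- by move=> g k a ag; rewrite -(scaler0 _ k) -pairZ rpredZ.
- by move=> g a b ag bg; rewrite -[0]addr0 -pairD rpredD.
- by move=> g k a ag; rewrite -(scaler0 _ k) -pairZ rpredZ.
- exact: grading_one.
- by move=> g a /grading_conj; rewrite cd_conjE.
- by move=> g h a b ag bh; rewrite -(cd_mul_ee charF alpha) grading_mul.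
- by move=> g h b a bg ah; rewrite -(cd_mul_eo charF alpha) addrC grading_mul.
- move=> g h b d bg dh; have := grading_mul bg dh.
  rewrite cd_mul_oo // => /(memvZ alpha^-1).
  by rewrite pairZ scaler0 scalerA mulVf // scale1r.
- by move=> g b /grading_phi; rewrite phiE.
- by move=> g h a ag ah /nz1; exact: (decomposition_disjoint dec ag ah).
- by move=> g h a ag ah /nz2; exact: (decomposition_disjoint dec ag ah).
Qed.

End FromGrading.

Lemma okubo_grading_intro (A : zmodType) (Delta : A -> {vspace CD Q}) :
  decomposition Delta ->
  (forall g, Delta g = (Delta g :&: cd_even Q + Delta g :&: cd_odd Q)%VS) ->
  (forall g x, x \in Delta g -> conjC x \in Delta g) ->
  (forall g x, x \in Delta g -> phi x \in Delta g) ->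
  (forall g h x y, x \in Delta g -> y \in Delta h -> mulC x y \in Delta (g + h)) ->
  okubo_grading alpha phi Delta.
Proof.
move=> dec super Dc Dp Dm; split=> //; split=> // g h x y xg yh.
by apply: Dm; rewrite ?Dp ?Dc.
Qed.

End OkuboGrading.
(** * Frames and canonical bases *)

Section Frames.

Variables (F : fieldType) (charF : 2%N \in [pchar F]).
Variables (Q : hurwitzAlg F) (dimQ : \dim {: Q} = 4%N).
Variables (alpha : F) (alpha_neq0 : alpha != 0).
Implicit Types (a b c d e x y p q : Q).

Local Notation B := (@qform F Q).
Local Notation cj := (@qconj F Q).
Local Notation "1q" := (hw_one Q).

(* Dual bases of the left ideals Qe and Q(1 + e), which are maximal totally
   isotropic subspaces paired by the norm. *)
Record frame (e b1 b2 d1 d2 : Q) : Prop := Frame {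
  frame_idem : e ** e = e;
  frame_conj : cj e = 1q + e;
  frame_b1 : b1 ** e = b1;
  frame_b2 : b2 ** e = b2;
  frame_d1 : d1 ** e = 0;
  frame_d2 : d2 ** e = 0;
  frame11 : alpha * B b1 d1 = 1;
  frame22 : alpha * B b2 d2 = 1;
  frame12 : B b1 d2 = 0;
  frame21 : B b2 d1 = 0
}.

Lemma frame_dual e b1 b2 d1 d2 :
  frame e b1 b2 d1 d2 -> frame (1q + e) d1 d2 b1 b2.
Proof.
case=> ee ce b1e b2e d1e d2e f11 f22 f12 f21; split.
- by rewrite qmulDl qmul1 qmulDr qmulx1 ee (add2v charF) addr0.
- by rewrite qconjD // qconj1 // ce.
- by rewrite qmulDr qmulx1 d1e addr0.
- by rewrite qmulDr qmulx1 d2e addr0.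
- by rewrite qmulDr qmulx1 b1e (add2v charF).
- by rewrite qmulDr qmulx1 b2e (add2v charF).
- by rewrite qformC.
- by rewrite qformC.
- by rewrite qformC.
- by rewrite qformC.
Qed.

Lemma frame_swap e b1 b2 d1 d2 : frame e b1 b2 d1 d2 -> frame e b2 b1 d2 d1.
Proof. by case; split. Qed.

(** The dual basis changes by the inverse transpose; [D] is the determinant, signs being
    irrelevant. *)
Lemma frame_change e b1 b2 d1 d2 (k l m n : F) (D := k * n + l * m) :
  frame e b1 b2 d1 d2 -> D != 0 ->
  frame e (k *: b1 + l *: b2) (m *: b1 + n *: b2)
    (D^-1 *: (n *: d1 + m *: d2)) (D^-1 *: (l *: d1 + k *: d2)).
Proof.
case=> ee ce b1e b2e d1e d2e f11 f22 f12 f21 D0.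
have form (s t u v : F) : alpha * B (s *: b1 + t *: b2) (D^-1 *: (u *: d1 + v *: d2)) =
    D^-1 * (s * u + t * v).
  rewrite qformZr !(qformDl, qformDr, qformZl, qformZr) f12 f21.
  rewrite [LHS](_ : _ = D^-1 * (s * u * (alpha * B b1 d1) + t * v * (alpha * B b2 d2))).
    by rewrite f11 f22 !mulr1.
  by ring.
have form0 (s t u v : F) : s * u + t * v = 0 ->
    B (s *: b1 + t *: b2) (D^-1 *: (u *: d1 + v *: d2)) = 0.
  move=> h; apply: (mulfI alpha_neq0).
  by rewrite form h !mulr0.
split=> //.
- by rewrite qmulDl !qmulZl b1e b2e.
- by rewrite qmulDl !qmulZl b1e b2e.
- by rewrite qmulZl qmulDl !qmulZl d1e d2e !(scaler0, addr0).
- by rewrite qmulZl qmulDl !qmulZl d1e d2e !(scaler0, addr0).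
- by rewrite form mulVf.
- by rewrite form [m * l]mulrC [n * k]mulrC addrC mulVf.
- by rewrite form0 // mulrC (add2f charF).
- by rewrite form0 // mulrC (add2f charF).
Qed.

Section Ideals.

Variable e : Q.
Hypotheses (ee : e ** e = e) (ce : cj e = 1q + e).

Lemma ideal_conjl x : x ** e = x -> e ** cj x = 0.
Proof.
move=> xe; rewrite -xe qconjM // ce (qmulA charF dimQ) qmulDr qmulx1 ee.
by rewrite (add2v charF) qmul0.
Qed.

Lemma ideal_conjr p : p ** e = 0 -> e ** cj p = cj p.
Proof.
move=> pe; have := congr1 cj pe; rewrite qconjM // ce qconj0 // qmulDl qmul1.
by move/(add2v_eq0 charF).
Qed.

Lemma ideal_mulconj x y : x ** e = x -> y ** e = y -> x ** cj y = 0.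
Proof.
by move=> xe ye; rewrite -xe -(qmulA charF dimQ) ideal_conjl // qmulx0.
Qed.

Lemma ideal_mulconj0 p q : p ** e = 0 -> q ** e = 0 -> p ** cj q = 0.
Proof.
by move=> pe qe; rewrite -(ideal_conjr qe) (qmulA charF dimQ) pe qmul0.
Qed.

Let scal0 (k : F) : k *: 1q = 0 -> k = 0.
Proof.
by move/eqP; rewrite scaler_eq0 (negPf (qone_neq0 dimQ)) orbF => /eqP.
Qed.

Lemma ideal_form x y : x ** e = x -> y ** e = y -> B x y = 0.
Proof.
by move=> xe ye; apply: scal0; rewrite -qform_conj // !ideal_mulconj // addr0.
Qed.

Lemma ideal_form0 p q : p ** e = 0 -> q ** e = 0 -> B p q = 0.
Proof.
by move=> xe ye; apply: scal0; rewrite -qform_conj // !ideal_mulconj0 // addr0.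
Qed.

(** In conj(x) p + conj(p) x = B(x, p) 1, left multiplication by [e] kills the first term and fixes
    the second. *)
Lemma ideal_conj_mul x p : x ** e = x -> p ** e = 0 -> cj p ** x = B x p *: e.
Proof.
move=> xe pe; have := congr1 (hw_mul Q e) (qconj_form charF x p).
rewrite qmulDr !(qmulA charF dimQ) ideal_conjl // ideal_conjr // qmul0 add0r.
by rewrite qmulZr qmulx1.
Qed.

(** By associativity the factor p conj(x) can be replaced by B(x, p) 1 + x conj(p), and conj(p) y is
    a multiple of [e]. This yields the products of [frame_v3] with the odd basis vectors. *)
Lemma ideal_mul_conj x y p : x ** e = x -> y ** e = y -> p ** e = 0 ->
  p ** (cj x ** y) = B x p *: y + B y p *: x.
Proof.
move=> xe ye pe; rewrite (qmulA charF dimQ).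
have -> : p ** cj x = B x p *: 1q + x ** cj p.
  by rewrite -qform_conj // -addrA addrC -addrA (add2v charF) addr0.
rewrite qmulDl qmulZl qmul1 -(qmulA charF dimQ) (ideal_conj_mul ye pe) qmulZr xe.
by [].
Qed.

End Ideals.

Lemma ideal_mul_conj0 e x p q : e ** e = e -> cj e = 1q + e ->
  x ** e = x -> p ** e = 0 -> q ** e = 0 ->
  x ** (cj p ** q) = B x p *: q + B x q *: p.
Proof.
move=> ee ce xe pe qe; rewrite [B x p]qformC [B x q]qformC.
apply: (@ideal_mul_conj (1q + e)).
- by rewrite qmulDl qmul1 qmulDr qmulx1 ee (add2v charF) addr0.
- by rewrite qconjD // qconj1 // ce.
- by rewrite qmulDr qmulx1 pe addr0.
- by rewrite qmulDr qmulx1 qe addr0.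
- by rewrite qmulDr qmulx1 xe (add2v charF).
Qed.

Section Coordinates.

Variables e b1 b2 d1 d2 : Q.
Hypothesis fr : frame e b1 b2 d1 d2.

Let ee := frame_idem fr. Let ce := frame_conj fr.
Let b1e := frame_b1 fr. Let b2e := frame_b2 fr.
Let d1e := frame_d1 fr. Let d2e := frame_d2 fr.
Let f11 := frame11 fr. Let f22 := frame22 fr.
Let f12 := frame12 fr. Let f21 := frame21 fr.

Lemma frame_coord v :
  v = (alpha * B v d1 *: b1 + alpha * B v b1 *: d1) +
      (alpha * B v d2 *: b2 + alpha * B v b2 *: d2).
Proof.
have nz1 : B b1 d1 != 0.
  by apply/eqP => h; move: f11; rewrite h mulr0 => /esym/eqP; rewrite oner_eq0.
have nz2 : B b2 d2 != 0.
  by apply/eqP => h; move: f22; rewrite h mulr0 => /esym/eqP; rewrite oner_eq0.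
have i11 : (B b1 d1)^-1 = alpha by apply: (mulIf nz1); rewrite mulVf.
have i22 : (B b2 d2)^-1 = alpha by apply: (mulIf nz2); rewrite mulVf.
have := @hyperbolic_coord F charF Q dimQ b1 d1 b2 d2 nz1 nz2.
rewrite i11 i22; apply=> //; last exact: (ideal_form0 ce).
  exact: (ideal_form ee ce).
by rewrite qformC.
Qed.

(** Forced by the canonical relations: this is the even component of v_1 v_2, and [frame_v3] that of
    u_1 u_2, when u_i is b_i u and v_i is d_i u. *)
Definition frame_u3 := alpha *: (cj d2 ** d1).
Definition frame_v3 := alpha *: (cj b2 ** b1).

Lemma frame_e11 : alpha *: (cj d1 ** b1) = e.
Proof. by rewrite (ideal_conj_mul ee ce b1e d1e) scalerA f11 scale1r. Qed.

Lemma frame_e22 : alpha *: (cj d2 ** b2) = e.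
Proof. by rewrite (ideal_conj_mul ee ce b2e d2e) scalerA f22 scale1r. Qed.

Lemma frame_e12 : cj d2 ** b1 = 0.
Proof. by rewrite (ideal_conj_mul ee ce b1e d2e) f12 scale0r. Qed.

Lemma frame_e21 : cj d1 ** b2 = 0.
Proof. by rewrite (ideal_conj_mul ee ce b2e d1e) f21 scale0r. Qed.

Lemma frame_v3C : alpha *: (cj b1 ** b2) = frame_v3.
Proof.
congr (_ *: _); apply: (add2v_eq0 charF); rewrite qconj_form //.
by rewrite (ideal_form ee ce b1e b2e) scale0r.
Qed.

Lemma frame_u3C : alpha *: (cj d1 ** d2) = frame_u3.
Proof.
congr (_ *: _); apply: (add2v_eq0 charF); rewrite qconj_form //.
by rewrite (ideal_form0 ce d1e d2e) scale0r.
Qed.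

Lemma frame_v3_conj : cj frame_v3 = frame_v3.
Proof. by rewrite /frame_v3 qconjZ // qconjM // qconjK // frame_v3C. Qed.

Lemma frame_u3_conj : cj frame_u3 = frame_u3.
Proof. by rewrite /frame_u3 qconjZ // qconjM // qconjK // frame_u3C. Qed.

Lemma frame_e_u3 : e ** frame_u3 = frame_u3.
Proof.
by rewrite /frame_u3 qmulZr (qmulA charF dimQ) (ideal_conjr ce d2e).
Qed.

Lemma frame_u3_e : frame_u3 ** e = 0.
Proof. by rewrite /frame_u3 qmulZl -(qmulA charF dimQ) d1e qmulx0 scaler0. Qed.

Lemma frame_e_v3 : e ** frame_v3 = 0.
Proof.
by rewrite /frame_v3 qmulZr (qmulA charF dimQ) (ideal_conjl ee ce b2e) qmul0 scaler0.
Qed.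

Lemma frame_v3_e : frame_v3 ** e = frame_v3.
Proof. by rewrite /frame_v3 qmulZl -(qmulA charF dimQ) b1e. Qed.

Lemma frame_b_u3 : b1 ** frame_u3 = d2 /\ b2 ** frame_u3 = d1.
Proof.
rewrite /frame_u3 !qmulZr !(ideal_mul_conj0 ee ce _ d2e d1e) // f12 f21 !scale0r.
by rewrite add0r addr0 !scalerA f11 f22 !scale1r.
Qed.

Lemma frame_d_v3 : d1 ** frame_v3 = b2 /\ d2 ** frame_v3 = b1.
Proof.
rewrite /frame_v3 !qmulZr !(ideal_mul_conj ee ce b2e b1e) // f12 f21 !scale0r.
by rewrite add0r addr0 !scalerA f11 f22 !scale1r.
Qed.

Lemma frame_b_v3 : b1 ** frame_v3 = 0 /\ b2 ** frame_v3 = 0.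
Proof.
rewrite /frame_v3 !qmulZr !(qmulA charF dimQ).
by rewrite !(ideal_mulconj ee ce) // qmul0 scaler0.
Qed.

Lemma frame_d_u3 : d1 ** frame_u3 = 0 /\ d2 ** frame_u3 = 0.
Proof.
rewrite /frame_u3 !qmulZr !(qmulA charF dimQ).
by rewrite !(ideal_mulconj0 ce) // qmul0 scaler0.
Qed.

Lemma frame_u3v3 : frame_u3 ** frame_v3 = e.
Proof.
rewrite {1}/frame_u3 qmulZl -(qmulA charF dimQ) frame_d_v3.1.
by rewrite frame_e22.
Qed.

Lemma frame_v3u3 : frame_v3 ** frame_u3 = 1q + e.
Proof.
by rewrite -frame_v3_conj -frame_u3_conj -qconjM // frame_u3v3 ce.
Qed.

Lemma frame_sqr_v3 : frame_v3 ** frame_v3 = 0.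
Proof.
by rewrite {1}/frame_v3 qmulZl -(qmulA charF dimQ) frame_b_v3.1 qmulx0 scaler0.
Qed.

Lemma frame_sqr_u3 : frame_u3 ** frame_u3 = 0.
Proof.
by rewrite {1}/frame_u3 qmulZl -(qmulA charF dimQ) frame_d_u3.1 qmulx0 scaler0.
Qed.

Lemma frame_norm_e : nq e = 0.
Proof.
have := qmulxconj charF e; rewrite ce qmulDr qmulx1 ee (add2v charF).
by move/esym/eqP; rewrite scaler_eq0 (negPf (qone_neq0 dimQ)) orbF => /eqP.
Qed.

Lemma frame_e_neq0 : e != 0.
Proof.
apply/eqP => e0; move: f11; rewrite -b1e e0 qmulx0 qform0 mulr0 => /esym/eqP.
by rewrite oner_eq0.
Qed.

(** The hyperbolic pairs are [e], [1q + e] and [frame_u3], [frame_v3]. Their Gram matrix is read off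
    from the products, since conj(x) y + conj(y) x = B(x, y) 1. *)
Lemma frame_even_coord v : exists k l m n : F,
  v = k *: e + l *: (1q + e) + (m *: frame_u3 + n *: frame_v3).
Proof.
have scal1 (k l : F) : k *: 1q = l *: 1q -> k = l.
  move/eqP; rewrite -subr_eq0 -scalerBl scaler_eq0 (negPf (qone_neq0 dimQ)) orbF.
  by rewrite subr_eq0 => /eqP.
have form x y (k : F) : cj x ** y + cj y ** x = k *: 1q -> B x y = k.
  by rewrite qconj_form // => /scal1.
have ce' : cj (1q + e) = e by rewrite qconjD // qconj1 // ce (add2vK charF).
have h1 : B e (1q + e) = 1.
  apply: form; rewrite ce ce' qmulDl qmul1 qmulDr qmulx1 ee (add2v charF) addr0.
  by rewrite scale1r -addrA (add2v charF) addr0.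
have h2 : B frame_u3 frame_v3 = 1.
  apply: form; rewrite frame_u3_conj frame_v3_conj frame_u3v3 frame_v3u3.
  by rewrite scale1r addrC -addrA (add2v charF) addr0.
have h3 : B e frame_u3 = 0.
  apply: form; rewrite frame_u3_conj ce qmulDl qmul1 frame_e_u3 frame_u3_e.
  by rewrite (add2v charF) scale0r addr0.
have h4 : B e frame_v3 = 0.
  apply: form; rewrite frame_v3_conj ce qmulDl qmul1 frame_e_v3 frame_v3_e.
  by rewrite addr0 (add2v charF) scale0r.
have h5 : B (1q + e) frame_u3 = 0.
  apply: form; rewrite frame_u3_conj ce' qmulDr qmulx1 frame_e_u3 frame_u3_e.
  by rewrite addr0 (add2v charF) scale0r.
have h6 : B (1q + e) frame_v3 = 0.
  apply: form; rewrite frame_v3_conj ce' qmulDr qmulx1 frame_e_v3 frame_v3_e.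
  by rewrite (add2v charF) scale0r addr0.
have := @hyperbolic_coord F charF Q dimQ e (1q + e) frame_u3 frame_v3.
rewrite h1 h2 oner_eq0 => /(_ isT isT h3 h4 h5 h6 v) ->.
by do 4!eexists.
Qed.

End Coordinates.

End Frames.

(** * The canonical basis of a frame and the shape of phi *)

Section CanonicalBasis.

Variables (F : fieldType) (charF : 2%N \in [pchar F]).
Variables (Q : hurwitzAlg F) (dimQ : \dim {: Q} = 4%N).
Variables (alpha : F) (alpha_neq0 : alpha != 0).

Local Notation B := (@qform F Q).
Local Notation cj := (@qconj F Q).
Local Notation "1q" := (hw_one Q).

(** The last branch is the index 0, which is also [3] in ['Z_3]. *)
Definition triple (x1 x2 x3 : CD Q) (i : 'Z_3) : CD Q :=
  if i == 1 then x1 else if i == 2 then x2 else x3.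

Lemma Z3_ind (P : 'Z_3 -> Prop) : P 1 -> P 2 -> P 0 -> forall i, P i.
Proof.
move=> P1 P2 P0 [[|[|[|k]]] hk] //.
- by rewrite (_ : Ordinal hk = 0) //; apply: val_inj.
- by rewrite (_ : Ordinal hk = 1) //; apply: val_inj.
- by rewrite (_ : Ordinal hk = 2) //; apply: val_inj.
Qed.

Variables e b1 b2 d1 d2 : Q.
Hypothesis fr : frame alpha e b1 b2 d1 d2.

Definition can_e1 : CD Q := (e, 0).
Definition can_e2 : CD Q := (1q + e, 0).
Definition can_u : 'Z_3 -> CD Q :=
  triple (0, b1) (0, b2) (frame_u3 alpha d1 d2, 0).
Definition can_v : 'Z_3 -> CD Q :=
  triple (0, d1) (0, d2) (frame_v3 alpha b1 b2, 0).

Let dfr := frame_dual charF fr.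

Lemma frame_even_part : cd_even Q = <<[:: can_e1; can_e2; can_u 3; can_v 3]>>%VS.
Proof.
apply/eqP; rewrite eqEsubv; apply/andP; split; last first.
  apply/span_subvP => x; rewrite !inE => /or4P[]/eqP->; apply/even_pairP;
    by eexists.
apply/subvP => x /even_pairP[a ->].
have [k [l [m [n ->]]]] := frame_even_coord charF dimQ fr a.
have -> : (k *: e + l *: (1q + e) +
    (m *: frame_u3 alpha d1 d2 + n *: frame_v3 alpha b1 b2), 0) =
    k *: can_e1 + l *: can_e2 + (m *: can_u 3 + n *: can_v 3) :> CD Q.
  by rewrite !pairZ !pairD !scaler0 !addr0.
by rewrite !rpredD // rpredZ // memv_span // !inE eqxx ?orbT.
Qed.

Lemma frame_odd_part : cd_odd Q = <<[:: can_u 1; can_u 2; can_v 1; can_v 2]>>%VS.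
Proof.
apply/eqP; rewrite eqEsubv; apply/andP; split; last first.
  apply/span_subvP => x; rewrite !inE => /or4P[]/eqP->; apply/odd_pairP;
    by eexists.
apply/subvP => x /odd_pairP[a ->].
rewrite (frame_coord charF dimQ fr a).
move: (alpha * _) (alpha * _) (alpha * _) (alpha * _) => n m l k.
have -> : (0, k *: b1 + l *: d1 + (m *: b2 + n *: d2)) =
    k *: can_u 1 + l *: can_v 1 + (m *: can_u 2 + n *: can_v 2) :> CD Q.
  by rewrite !pairZ !pairD !scaler0 !addr0.
by rewrite !rpredD // rpredZ // memv_span // !inE eqxx ?orbT.
Qed.

(** The multiplication table reduces to the products in [Q] collected for the frame and its dual;
    the minus signs disappear in characteristic 2. *)
Lemma frame_canonical : canonical_basis alpha can_e1 can_e2 can_u can_v.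
Proof.
have [ee ce b1e b2e d1e d2e f11 f22 f12 f21] := fr.
have [ff cf d1f d2f b1f b2f _ _ _ _] := dfr.
have ef : e ** (1q + e) = 0 by rewrite qmulDr qmulx1 ee (add2v charF).
have fe : (1q + e) ** e = 0 by rewrite qmulDl qmul1 ee (add2v charF).
have [b1u b2u] := frame_b_u3 charF dimQ fr.
have [b1v b2v] := frame_b_v3 charF dimQ fr.
have [d1u d2u] := frame_d_u3 charF dimQ fr.
have [d1v d2v] := frame_d_v3 charF dimQ fr.
have eu := frame_e_u3 charF dimQ fr; have ue := frame_u3_e charF dimQ fr.
have ev := frame_e_v3 charF dimQ fr; have ve := frame_v3_e charF dimQ fr.
have fu : (1q + e) ** frame_u3 alpha d1 d2 = 0.
  by rewrite qmulDl qmul1 eu (add2v charF).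
have uf : frame_u3 alpha d1 d2 ** (1q + e) = frame_u3 alpha d1 d2.
  by rewrite qmulDr qmulx1 ue addr0.
have fv : (1q + e) ** frame_v3 alpha b1 b2 = frame_v3 alpha b1 b2.
  by rewrite qmulDl qmul1 ev addr0.
have vf : frame_v3 alpha b1 b2 ** (1q + e) = 0.
  by rewrite qmulDr qmulx1 ve (add2v charF).
have uv := frame_u3v3 charF dimQ fr; have vu := frame_v3u3 charF dimQ fr.
have uu := frame_sqr_u3 charF dimQ fr; have vv := frame_sqr_v3 charF dimQ fr.
have cu := frame_u3_conj charF dimQ fr; have cv := frame_v3_conj charF dimQ fr.
have u12 := frame_u3C charF dimQ fr; have v12 := frame_v3C charF dimQ fr.
have u21 : alpha *: (cj d2 ** d1) = frame_u3 alpha d1 d2 by [].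
have v21 : alpha *: (cj b2 ** b1) = frame_v3 alpha b1 b2 by [].
have cf' : cj (1q + e) = e by rewrite cf (add2vK charF).
have e11 := frame_e11 charF dimQ fr; have e22 := frame_e22 charF dimQ fr.
have e12 := frame_e12 charF dimQ fr; have e21 := frame_e21 charF dimQ fr.
have f11' := frame_e11 charF dimQ dfr; have f22' := frame_e22 charF dimQ dfr.
have f12' := frame_e12 charF dimQ dfr; have f21' := frame_e21 charF dimQ dfr.
(* Elements of the ideal are isotropic, because q(x) 1 is also x conj(x). *)
have nb x : x ** e = x -> cj x ** x = 0.
  move=> xe; rewrite qmul_conj // -qmulxconj //.
  exact: (ideal_mulconj charF dimQ ee ce).
have nd x : x ** e = 0 -> cj x ** x = 0.
  move=> xe; rewrite qmul_conj // -qmulxconj //.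
  exact: (ideal_mulconj0 charF dimQ ce).
have nb1 := nb _ b1e; have nb2 := nb _ b2e.
have nd1 := nd _ d1e; have nd2 := nd _ d2e.
have T := (ee, ff, ef, fe, b1e, b2e, d1e, d2e, d1f, d2f, b1f, b2f, b1u, b2u).
have T1 := (b1v, b2v, d1u, d2u, d1v, d2v, eu, ue, ev, ve, fu, uf, fv, vf).
have T2 := (uv, vu, uu, vv, u12, u21, v12, v21, e11, e22, f11', f22').
have T3 := (e12, e21, f12', f21', nb1, nb2, nd1, nd2).
have C := (ce, cf', cu, cv).
have M := (@cd_mul_ee F charF Q alpha, @cd_mul_eo F charF Q alpha,
  @cd_mul_oe F charF Q alpha, @cd_mul_oo F charF Q alpha).
have s11 : 1 + 1 = 2 :> 'Z_3 by apply: val_inj.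
have s12 : 1 + 2 = 0 :> 'Z_3 by apply: val_inj.
have s21 : 2 + 1 = 0 :> 'Z_3 by apply: val_inj.
have s22 : 2 + 2 = 1 :> 'Z_3 by apply: val_inj.
have S3 := (s11, s12, s21, s22, add0r (1 : 'Z_3), add0r (2 : 'Z_3)).
have u1E : can_u 1 = (0, b1) by [].
have u2E : can_u 2 = (0, b2) by [].
have u0E : can_u 0 = (frame_u3 alpha d1 d2, 0) by [].
have v1E : can_v 1 = (0, d1) by [].
have v2E : can_v 2 = (0, d2) by [].
have v0E : can_v 0 = (frame_v3 alpha b1 b2, 0) by [].
have uE := (u1E, u2E, u0E); have vE := (v1E, v2E, v0E).
have span_full : (fullv <= <<[:: can_e1; can_e2; can_u 1; can_u 2; can_u 3;
    can_v 1; can_v 2; can_v 3]>>)%VS.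
  apply/subvP => -[a b] _.
  have -> : (a, b) = (a, 0) + (0, b) :> CD Q by rewrite pairD addr0 add0r.
  apply: rpredD.
    have : ((a, 0) : CD Q) \in cd_even Q by apply/even_pairP; exists a.
    rewrite frame_even_part; apply/subvP/sub_span => x.
    by rewrite !inE => /or4P[] ->; rewrite ?orbT.
  have : ((0, b) : CD Q) \in cd_odd Q by apply/odd_pairP; exists b.
  rewrite frame_odd_part; apply/subvP/sub_span => x.
  by rewrite !inE => /or4P[] ->; rewrite ?orbT.
rewrite /canonical_basis; split.
- by rewrite basisEdim span_full dim_CD.
- by rewrite /can_e1 /can_e2 !M !T.
- by rewrite /can_e1 /can_e2; apply: Z3_ind; rewrite !uE !vE !M ?C ?T ?T1.
- apply: Z3_ind; rewrite !S3 !uE !vE !M ?C ?T1 ?T ?T2 ?T3 ?scaler0;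
    by rewrite !(opp2v charF).
- rewrite /can_e1 /can_e2; apply: Z3_ind; apply: Z3_ind;
    rewrite !uE !vE !M ?C ?T1 ?T2 ?T3 ?scaler0 ?scale1r ?scale0r;
    by rewrite !(opp2v charF).
Qed.

Lemma frame_adapted : adapted_basis alpha can_e1 can_e2 can_u can_v.
Proof.
split; [exact: frame_canonical | exact: frame_even_part | exact: frame_odd_part].
Qed.

Lemma frame_split : even_part_split Q alpha.
Proof.
exists can_e1; first by apply/even_pairP; exists e.
split; last by rewrite /cd_norm /= (frame_norm_e charF dimQ fr) qnorm0 mulr0 addr0.
by apply/eqP => -[/eqP]; rewrite (negPf (frame_e_neq0 fr)).
Qed.

Variables (phi : 'End(CD Q)) (w : Q).
Hypotheses (Bw : B w 1q = 1) (nw : nq w = 1).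
Hypothesis phiE : forall a b, phi (a, b) = (a, w ** b).

(** Left multiplication by [w] is an isometry commuting with right multiplication by [e]. Hence its
    action on Q(1 + e) is contragredient to that on Qe, and the values of [phi] on the v_i follow
    from those on the u_i. *)
Let form_w a b : B (w ** a) (w ** b) = B a b.
Proof. by rewrite qform_mull nw mul1r. Qed.

Let w_ideal a : a ** e = 0 -> (w ** a) ** e = 0.
Proof. by move=> ae; rewrite -(qmulA charF dimQ) ae qmulx0. Qed.

Let w_d d : d ** e = 0 ->
  w ** d = alpha * B (w ** d) b1 *: d1 + alpha * B (w ** d) b2 *: d2.
Proof.
move=> de; rewrite {1}(frame_coord charF dimQ fr (w ** d)).
have [ee ce _ _ d1e d2e _ _ _ _] := fr.
rewrite (ideal_form0 charF dimQ ce (w_ideal de) d1e).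
by rewrite (ideal_form0 charF dimQ ce (w_ideal de) d2e) mulr0 !scale0r !add0r.
Qed.

Lemma frame_tau_omega (omega : F) :
  omega ^+ 2 + omega + 1 = 0 -> w ** b1 = omega *: b1 -> w ** b2 = omega ^+ 2 *: b2 ->
  is_tau_omega can_e1 can_e2 can_u can_v phi.
Proof.
move=> om wb1 wb2; have [ee ce _ _ d1e d2e f11 f22 f12 f21] := fr.
have om3 : omega ^+ 3 = 1.
  apply/eqP; rewrite -subr_eq0.
  have -> : omega ^+ 3 - 1 = (omega - 1) * (omega ^+ 2 + omega + 1) by ring.
  by rewrite om mulr0.
have om0 : omega != 0.
  by apply/eqP => h; move/eqP: om3; rewrite h expr0n eq_sym oner_eq0.
have om1 : omega != 1.
  apply/eqP => h; move/eqP: om; rewrite h expr1n (add2f charF) add0r.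
  by rewrite oner_eq0.
have om2 : omega ^+ 2 != 1.
  by apply: contraNneq om1 => h; rewrite -om3 exprS h mulr1.
have B11 : B (w ** d1) b1 = omega^-1 * B d1 b1.
  by apply: (mulfI om0); rewrite mulVKf // -qformZr -wb1 form_w.
have B12 : B (w ** d1) b2 = 0.
  apply: (mulfI (expf_neq0 2 om0)); rewrite -qformZr -wb2 form_w mulr0.
  by rewrite qformC.
have B21 : B (w ** d2) b1 = 0.
  by apply: (mulfI om0); rewrite -qformZr -wb1 form_w mulr0 qformC.
have B22 : B (w ** d2) b2 = omega ^- 2 * B d2 b2.
  by apply: (mulfI (expf_neq0 2 om0)); rewrite mulVKf ?expf_neq0 // -qformZr -wb2 form_w.
have wd1 : w ** d1 = omega^-1 *: d1.
  rewrite (w_d d1e) B11 B12 mulr0 scale0r addr0 mulrCA qformC f11 mulr1.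
  by [].
have wd2 : w ** d2 = omega ^- 2 *: d2.
  rewrite (w_d d2e) B21 B22 mulr0 scale0r add0r mulrCA qformC f22 mulr1.
  by [].
exists omega.
  apply/andP; split=> //; apply/forallP => -[[|[|[|i]]] hi] //; rewrite unity_rootE.
  - by rewrite expr1 (negPf om1).
  - by rewrite (negPf om2).
  - by rewrite om3 !eqxx.
split; first by rewrite /can_e1 phiE qmulx0.
- by rewrite /can_e2 phiE qmulx0.
- apply: Z3_ind; rewrite /can_u /triple /= phiE.
  + by rewrite wb1 pairZ scaler0 expr1.
  + by rewrite wb2 pairZ scaler0.
  + by rewrite qmulx0 expr0 scale1r.
- apply: Z3_ind; rewrite /can_v /triple /= phiE.
  + by rewrite wd1 pairZ scaler0 expr1.
  + by rewrite wd2 pairZ scaler0.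
  + by rewrite qmulx0 expr0 invr1 scale1r.
Qed.

Lemma frame_tau_nst :
  w ** b1 = b2 -> w ** b2 = b1 + b2 -> is_tau_nst can_e1 can_e2 can_u can_v phi.
Proof.
move=> wb1 wb2; have [ee ce _ _ d1e d2e f11 f22 f12 f21] := fr.
have B2 d : B (w ** d) b2 = B d b1 by rewrite -wb1 form_w.
have B1 d : B (w ** d) b1 = B d b1 + B d b2.
  rewrite -(form_w d b2) wb2 qformDr B2 addrCA (add2f charF) addr0.
  by [].
have f12' : B d2 b1 = 0 by rewrite qformC.
have f21' : B d1 b2 = 0 by rewrite qformC.
have f11' : alpha * B d1 b1 = 1 by rewrite qformC.
have f22' : alpha * B d2 b2 = 1 by rewrite qformC.
have wd1 : w ** d1 = d1 + d2.
  by rewrite (w_d d1e) B1 B2 f21' addr0 f11' !scale1r.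
have wd2 : w ** d2 = d1.
  by rewrite (w_d d2e) B1 B2 f12' add0r f22' mulr0 scale0r scale1r addr0.
split; first by rewrite /can_e1 /can_e2 /can_u /can_v /triple /= !phiE !qmulx0.
- by rewrite /can_u /triple /= phiE wb1.
- by rewrite /can_u /triple /= phiE wb2 !(opp2v charF) pairD addr0.
- by rewrite /can_v /triple /= phiE wd1 !(opp2v charF) pairD addr0.
- by rewrite /can_v /triple /= phiE wd2 !(opp2v charF).
Qed.

End CanonicalBasis.
(** * Homogeneous elements *)

Section Cases.

Variables (F : fieldType) (charF : 2%N \in [pchar F]).
Variables (Q : hurwitzAlg F) (dimQ : \dim {: Q} = 4%N).
Variables (alpha : F) (alpha_neq0 : alpha != 0).

Local Notation B := (@qform F Q).
Local Notation cj := (@qconj F Q).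
Local Notation "1q" := (hw_one Q).

Variables (w : Q) (H : zmodType) (E N : H -> Q -> Prop).
Hypotheses (Bw : B w 1q = 1) (nw : nq w = 1) (gr : qgrading w E N).

Let mulA := qmulA charF dimQ.

Definition homog_frame (g h : H) (e b1 b2 d1 d2 : Q) : Prop :=
  frame alpha e b1 b2 d1 d2 /\ [/\ N g b1, N h b2, N (- g) d1 & N (- h) d2].

Lemma even_one_deg g (k : F) : k != 0 -> E g (k *: 1q) -> g = 0.
Proof.
move=> k0 /(qgr_evenZ gr k^-1); rewrite scalerA mulVf // scale1r => e1.
exact: (even_uniq gr e1 (even1 gr) (qone_neq0 dimQ)).
Qed.

(** B(a, b) 1 = conj(a) b + conj(b) a is homogeneous of degree g + h, while 1 has degree 0. *)
Lemma even_form g h a b : E g a -> E h b -> B a b != 0 -> g + h = 0.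
Proof.
move=> ag bh /even_one_deg; apply; rewrite -qconj_form //.
apply: (qgr_evenD gr); first exact: (even_mul gr (even_conj gr ag) bh).
by rewrite addrC; apply: (even_mul gr (even_conj gr bh) ag).
Qed.

Lemma odd_form g h a b : N g a -> N h b -> B a b != 0 -> g + h = 0.
Proof.
move=> ag bh /even_one_deg; apply; rewrite -qconj_form //.
apply: (qgr_evenD gr); last exact: (odd_conj_mul gr ag bh).
by rewrite addrC; apply: (odd_conj_mul gr bh ag).
Qed.

Lemma even_form0 g h a b : E g a -> E h b -> g + h != 0 -> B a b = 0.
Proof.
move=> ag bh gh; apply: NNPP => /eqP /(even_form ag bh)/eqP.
by rewrite (negPf gh).
Qed.

Lemma odd_form0 g h a b : N g a -> N h b -> g + h != 0 -> B a b = 0.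
Proof.
move=> ag bh gh; apply: NNPP => /eqP /(odd_form ag bh)/eqP.
by rewrite (negPf gh).
Qed.

Lemma even_ex (l : Q -> F) : {morph l : x y / x + y} -> forall z, l z != 0 ->
  exists g a, E g a /\ l a != 0.
Proof.
move=> lD z lz; apply: NNPP => nex; case/eqP: lz; move: z.
apply: (even_ind gr) => [|a b ha hb|g a ag].
- by apply: (@addrI _ (l 0)); rewrite -lD !addr0.
- by rewrite lD ha hb addr0.
- by apply: NNPP => /eqP la; apply: nex; exists g, a.
Qed.

Lemma odd_ex (l : Q -> F) : {morph l : x y / x + y} -> forall z, l z != 0 ->
  exists g a, N g a /\ l a != 0.
Proof.
move=> lD z lz; apply: NNPP => nex; case/eqP: lz; move: z.
apply: (odd_ind gr) => [|a b ha hb|g a ag].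
- by apply: (@addrI _ (l 0)); rewrite -lD !addr0.
- by rewrite lD ha hb addr0.
- by apply: NNPP => /eqP la; apply: nex; exists g, a.
Qed.

Lemma even_dual g a : E g a -> a != 0 -> exists b, E (- g) b /\ B a b != 0.
Proof.
move=> ag /qform_ex[z az].
have [h [b [bh ab]]] := even_ex (fun x y => qformDr a x y) az.
exists b; split=> //; have gh := even_form ag bh ab.
by rewrite (addr0_eq gh).
Qed.

Lemma odd_dual g a : N g a -> a != 0 -> exists b, N (- g) b /\ B a b != 0.
Proof.
move=> ag /qform_ex[z az].
have [h [b [bh ab]]] := odd_ex (fun x y => qformDr a x y) az.
exists b; split=> //; have gh := odd_form ag bh ab.
by rewrite (addr0_eq gh).
Qed.

Lemma odd_anisotropic g b : N g b -> nq b != 0 ->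
  g + g = 0 /\
  exists w', [/\ w ** b = b ** w', E 0 w', B w' 1q = 1 & nq w' = 1].
Proof.
move=> bg nb; have gg : g + g = 0.
  by apply: (even_one_deg nb); rewrite -qmul_conj //; apply: (odd_conj_mul gr).
split=> //; exists ((nq b)^-1 *: (cj b ** (w ** b))).
have bw : b ** ((nq b)^-1 *: (cj b ** (w ** b))) = w ** b.
  by rewrite qmulZr qmulK_conjl // scalerA mulVf // scale1r.
split=> //.
- apply: (qgr_evenZ gr); rewrite -gg.
  exact: (odd_conj_mul gr (odd_w gr bg) bg).
- apply: (mulfI nb); rewrite -qform_mull bw qmulx1 mulr1.
  by rewrite -{2}(qmul1 b) qform_mulr Bw mul1r.
- by apply: (mulfI nb); rewrite -qnormM bw qnormM nw mul1r mulr1.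
Qed.

(** If 2g = 0, a homogeneous partner [d] of [b] has the same degree, and [b + d] is homogeneous of
    norm B(b, d), which is nonzero. *)
Lemma isotropic_deg g b : (forall g b, N g b -> nq b = 0) ->
  N g b -> b != 0 -> g + g != 0.
Proof.
move=> iso bg b0; apply/eqP => gg.
have [d [dg bd]] := odd_dual bg b0.
have gN : - g = g by apply/esym/eqP; rewrite -addr_eq0 gg.
rewrite gN in dg; have := iso _ _ (qgr_oddD gr bg dg).
by rewrite qnormD (iso _ _ bg) (iso _ _ dg) !add0r; apply/eqP.
Qed.

(* The even part of degree zero is K = <1, w'>, and x, y span its orthogonal. *)
Lemma split_even_frame g h b x w' :
  N g b -> nq b != 0 -> w ** b = b ** w' -> E 0 w' -> B w' 1q = 1 -> nq w' = 1 ->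
  (forall h x, h != 0 -> E h x -> nq x = 0) -> h != 0 -> E h x -> x != 0 ->
  exists omega e b1 b2 d1 d2,
    [/\ homog_frame g (g - h) e b1 b2 d1 d2, omega ^+ 2 + omega + 1 = 0,
        w ** b1 = omega *: b1, w ** b2 = omega ^+ 2 *: b2 & h + h != 0].
Proof.
move=> bg nb wb w'0 Bw' nw' iso h0 xh x0.
have [y [yh xy]] := even_dual xh x0.
have [gg _] := odd_anisotropic bg nb.
have hN0 : - h != 0 by rewrite oppr_eq0.
have nx := iso _ _ h0 xh; have ny := iso _ _ hN0 yh.
have hh : h + h != 0.
  apply/eqP => hh; have hN : - h = h by apply/esym/eqP; rewrite -addr_eq0 hh.
  rewrite hN in yh; have := iso _ _ h0 (qgr_evenD gr xh yh).
  by rewrite qnormD nx ny !add0r; apply/eqP.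
have e1 := even1 gr.
have x1 : B x 1q = 0 by apply: (even_form0 xh e1); rewrite addr0.
have xw : B x w' = 0 by apply: (even_form0 xh w'0); rewrite addr0.
have y1 : B y 1q = 0 by apply: (even_form0 yh e1); rewrite addr0.
have yw : B y w' = 0 by apply: (even_form0 yh w'0); rewrite addr0.
have w'w' : w' ** w' = w' + 1q by rewrite qsqr // Bw' nw' !scale1r.
have cw' : cj w' = 1q + w' by rewrite qconjE // Bw' scale1r.
have wxh : E h (w' ** x) by rewrite -(add0r h); apply: (even_mul gr).
(* The element w'x has degree h, so it is orthogonal to 1, [w'] and [x] and must be a multiple of
   [x]; omega is the coefficient. *)
pose omega := (B x y)^-1 * B (w' ** x) y.
have wx : w' ** x = omega *: x.
  have := @hyperbolic_coord F charF Q dimQ 1q w' x y.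
  rewrite (qformC 1q w') Bw' oner_eq0 (qformC 1q x) x1 (qformC 1q y) y1.
  rewrite (qformC w' x) xw (qformC w' y) yw.
  move=> /(_ isT xy erefl erefl erefl erefl (w' ** x)).
  rewrite (even_form0 wxh w'0) ?addr0 // (even_form0 wxh e1) ?addr0 //.
  by rewrite (even_form0 wxh xh) // !mulr0 !scale0r !add0r addr0.
have om : omega ^+ 2 + omega + 1 = 0.
  have := mulA w' w' x; rewrite w'w' qmulDl qmul1 wx qmulZr wx scalerA.
  move/eqP; rewrite -subr_eq0 (opp2v charF) -[X in _ + (_ + X)]scale1r -!scalerDl.
  by rewrite scaler_eq0 (negPf x0) orbF addrA -expr2 => /eqP.
have om2 : omega ^+ 2 = omega + 1.
  by apply/eqP; rewrite -subr_eq0 (opp2f charF) addrA om.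
have om1 : omega ^+ 2 + omega = 1.
  by rewrite om2 addrAC (add2f charF) add0r.
have om3 : omega ^+ 2 * omega = 1 by rewrite om2 mulrDl mul1r -expr2 om1.
have wy : w' ** y = omega ^+ 2 *: y.
  have wyh : E (- h) (w' ** y) by rewrite -(add0r (- h)); apply: (even_mul gr).
  have hNN : - h - h != 0 by rewrite -opprD oppr_eq0.
  have yx : B y x != 0 by rewrite qformC.
  have := @hyperbolic_coord F charF Q dimQ 1q w' y x.
  rewrite (qformC 1q w') Bw' oner_eq0 (qformC 1q x) x1 (qformC 1q y) y1.
  rewrite (qformC w' x) xw (qformC w' y) yw.
  move=> /(_ isT yx erefl erefl erefl erefl (w' ** y)).
  rewrite (even_form0 wyh w'0) ?addr0 // (even_form0 wyh e1) ?addr0 //.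
  rewrite (even_form0 wyh yh) // !mulr0 !scale0r !add0r addr0 => {1}->.
  rewrite qadjl // cw' qmulDl qmul1 wx qformDr qformZr mulrDr mulrCA mulVf //.
  by rewrite mulr1 om2 addrC.
(* As omega is a root of t^2 + t + 1, the algebra <1, w'> splits; [e] is its idempotent with w'e =
   omega e. From the left it fixes [x] and kills [y]. *)
pose e := w' + omega ^+ 2 *: 1q.
have e0 : E 0 e by apply: (qgr_evenD gr) => //; apply: (qgr_evenZ gr).
have ee : e ** e = e.
  rewrite /e qmulDl qmulZl qmul1 qmulDr qmulZr qmulx1 w'w' scalerDr scalerA.
  rewrite -!addrA (add2vK charF) -{1}(scale1r 1q) -scalerDl.
  congr (_ + _ *: _).
  by rewrite {2}om2 mulrDr mulr1 om3 addrA (add2f charF) add0r.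
have ce : cj e = 1q + e by rewrite /e qconjD // qconjZ // qconj1 // cw' addrA.
have ex : e ** x = x.
  by rewrite /e qmulDl qmulZl qmul1 wx -scalerDl addrC om1 scale1r.
have ey : e ** y = 0.
  by rewrite /e qmulDl qmulZl qmul1 wy (add2v charF).
have perpC z : B z 1q = 0 -> B z w' = 0 -> z ** e = cj e ** z.
  move=> z1 zw; have ze : B z (cj e) = 0.
    by rewrite ce /e !qformDr qformZr z1 zw mulr0 !addr0.
  have := qform_conj charF z (cj e).
  by rewrite ze scale0r qconjK // (qconj_tr0 charF z1) => /(add2v_eq0 charF).
have xe : x ** e = 0 by rewrite perpC // ce qmulDl qmul1 ex (add2v charF).
have ye : y ** e = y by rewrite perpC // ce qmulDl qmul1 ey addr0.
have Be1 : B e (1q + e) = 1.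
  by rewrite qformDr qformxx // addr0 /e qformDl qformZl qform11 // Bw' mulr0 addr0.
have Bxe : B e x = 0.
  by rewrite qformC /e qformDr qformZr xw x1 mulr0 addr0.
have Bye : B y (1q + e) = 0.
  by rewrite /e !qformDr qformZr yw y1 mulr0 !addr0.
have gN : - g = g by apply/esym/eqP; rewrite -addr_eq0 gg.
have a1 : alpha * nq b != 0 by rewrite mulf_neq0.
have a2 : alpha * (nq b * B y x) != 0 by rewrite !mulf_neq0 // qformC.
(* Left multiplication by [b] multiplies the form by q(b) and preserves left ideals' right-hand
   condition, so it carries the pairs [e], [1q + e] and [y], [x] to dual bases up to scalars. The
   degrees match since -g = g. *)
exists omega, e, (b ** e), (b ** y), ((alpha * nq b)^-1 *: (b ** (1q + e))),
  ((alpha * (nq b * B y x))^-1 *: (b ** x)).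
split=> //.
- split.
    split=> //.
    + by rewrite -mulA ee.
    + by rewrite -mulA ye.
    + by rewrite qmulZl -mulA qmulDl qmul1 ee (add2v charF) qmulx0 scaler0.
    + by rewrite qmulZl -mulA xe qmulx0 scaler0.
    + by rewrite qformZr qform_mull Be1 mulr1 mulrCA mulVf.
    + by rewrite qformZr qform_mull mulrCA mulVf.
    + by rewrite qformZr qform_mull Bxe !mulr0.
    + by rewrite qformZr qform_mull Bye !mulr0.
  split.
  + by rewrite -(addr0 g); apply: (odd_mul gr).
  + exact: (odd_mul gr).
  + apply: (qgr_oddZ gr); rewrite gN -(addr0 g); apply: (odd_mul gr) => //.
    exact: (qgr_evenD gr).
  + by apply: (qgr_oddZ gr); rewrite opprD gN opprK; apply: (odd_mul gr).
- rewrite mulA wb -mulA -qmulZr; congr (_ ** _).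
  rewrite /e qmulDr qmulZr qmulx1 w'w' addrAC -{1}(scale1r w') -scalerDl.
  have -> : 1 + omega ^+ 2 = omega by rewrite om2 addrCA (add2f charF) addr0.
  by rewrite scalerDr scalerA mulrC om3 scale1r.
- by rewrite mulA wb -mulA wy qmulZr.
Qed.

(** Once a first dual pair has produced the idempotent, a second pair is obtained by homogeneous
    projections: to Qe and Q(1 + e), and to the orthogonal of the first pair. *)
Lemma isotropic_frame : (forall g b, N g b -> nq b = 0) ->
  exists g h e b1 b2 d1 d2,
    [/\ homog_frame g h e b1 b2 d1 d2, g + g != 0 & h + h != 0].
Proof.
move=> iso; have [z Bz] := qform_ex (qone_neq0 dimQ).
(* The functional B(1, .) serves only to guarantee a nonzero homogeneous [b1]. *)
have [g [b1 [b1g lb1]]] := odd_ex (fun x y => qformDr 1q x y) Bz.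
have b10 : b1 != 0 by apply: contraNneq lb1 => ->; rewrite qformx0.
have [d0 [d0g bd0]] := odd_dual b1g b10.
have gg := isotropic_deg iso b1g b10.
pose d1 := (alpha * B b1 d0)^-1 *: d0.
have d1g : N (- g) d1 by apply: (qgr_oddZ gr).
have f11 : alpha * B b1 d1 = 1.
  by rewrite qformZr mulrCA mulVf // mulf_neq0.
clearbody d1; clear d0 d0g bd0.
have nb1 := iso _ _ b1g; have nd1 := iso _ _ d1g.
pose e := alpha *: (cj d1 ** b1).
have e0 : E 0 e.
  apply: (qgr_evenZ gr); rewrite -(subrr g); exact: (odd_conj_mul gr).
have b1e : b1 ** e = b1.
  have := congr1 (fun x => x ** b1) (qform_conj charF b1 d1).
  rewrite qmulDl -!mulA qmul_conj // nb1 scale0r qmulx0 addr0 qmulZl qmul1.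
  by rewrite /e qmulZr => ->; rewrite scalerA f11 scale1r.
have d1e : d1 ** e = 0.
  by rewrite /e qmulZr mulA qmulxconj // nd1 scale0r qmul0 scaler0.
have ee : e ** e = e by rewrite {1}/e qmulZl -mulA b1e.
have ce : cj e = 1q + e.
  apply: (add2v_eq0 charF); rewrite {1}/e qconjZ // qconjM // qconjK //.
  rewrite addrCA -scalerDr qconj_form // scalerA f11 scale1r.
  exact: add2v.
clearbody e.
(* The part of [v] in Qe orthogonal to [d1]. It preserves degrees: the correction is nonzero only
   when [v] has the degree of [b1]. *)
pose T v := v ** e + (alpha * B (v ** e) d1) *: b1.
have Te v : T v ** e = T v by rewrite /T qmulDl qmulZl -mulA ee b1e.
have Td v : B (T v) d1 = 0.
  rewrite /T qformDl qformZl mulrAC f11 mul1r.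
  exact: add2f.
have Tdeg h v : N h v -> N h (T v).
  move=> vh; have veh : N h (v ** e) by rewrite -(addr0 h); apply: (odd_mul gr).
  apply: (qgr_oddD gr) => //; have [->|nz] := eqVneq (B (v ** e) d1) 0.
    rewrite mulr0 scale0r -(scale0r (v ** e)); exact: (qgr_oddZ gr).
  apply: (qgr_oddZ gr); have /eqP := odd_form veh d1g nz.
  by rewrite subr_eq0 => /eqP ->.
have TD u v : T (u + v) = T u + T v.
  by rewrite /T qmulDl qformDl mulrDr scalerDl addrACA.
(* Otherwise Qe is the line of [b1]. A vector orthogonal to [b1] and [d1] then lies in Qe, so it is
   a multiple of [b1] orthogonal to [d1], hence 0, and [Q] would have dimension at most 2. *)
have [v Tv] : exists v, T v != 0.
  apply: NNPP => nex; have T0 v : v ** e = (alpha * B (v ** e) d1) *: b1.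
    apply: (add2v_eq0 charF); apply: NNPP => /eqP h.
    by apply: nex; exists v.
  have : (fullv <= <<[:: b1; d1]>>)%VS.
    apply/subvP => u _.
    pose p := u + (alpha * B u d1 *: b1 + alpha * B u b1 *: d1).
    have pd : B p d1 = 0.
      rewrite /p !qformDl !qformZl qformxx // mulr0 addr0 mulrAC f11 mul1r.
      exact: add2f.
    have pb : B p b1 = 0.
      rewrite /p !qformDl !qformZl qformxx // mulr0 add0r (qformC d1) mulrAC f11.
      by rewrite mul1r; apply: add2f.
    have pE : u = p + (alpha * B u d1 *: b1 + alpha * B u b1 *: d1).
      by rewrite /p -addrA (add2v charF) addr0.
    have pce : p ** (1q + e) = 0.
      apply: (qform_inj charF) => t; rewrite qform0 qadjr // qconjD // qconj1 // ce.
      by rewrite (add2vK charF) T0 qformZr pb mulr0.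
    have pe : p = p ** e.
      by apply: (add2v_eq0 charF); rewrite -{1}(qmulx1 p) -qmulDr.
    have p0 : p = 0 by rewrite pe T0 -pe pd mulr0 scale0r.
    rewrite pE p0 add0r; clear.
    by rewrite rpredD // rpredZ // memv_span // !inE eqxx ?orbT.
  move/dimvS/leq_trans/(_ (dim_span _)).
  by rewrite dimQ.
have [t Bt] := qform_ex Tv.
have [h [v2 [v2h Bv2]]] := odd_ex (l := fun v => B (T v) t)
  (fun x y => etrans (congr1 (B^~ t) (TD x y)) (qformDl _ _ _)) Bt.
pose b2 := T v2; have b2e : b2 ** e = b2 := Te v2.
have b2d1 : B b2 d1 = 0 := Td v2.
have b2h : N h b2 := Tdeg _ _ v2h.
have b20 : b2 != 0 by apply: contraNneq Bv2; rewrite -/b2 => ->; rewrite qform0.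
clearbody b2.
have [d [dh bd]] := odd_dual b2h b20.
(* Projection to Q(1 + e), which does not change the pairing with [b2]; afterwards a multiple of
   [d1] is added to make it orthogonal to [b1]. *)
pose d' := d ** (1q + e).
have d'h : N (- h) d'.
  rewrite -(addr0 (- h)); apply: (odd_mul gr) => //.
  by apply: (qgr_evenD gr) => //; apply: (even1 gr).
have d'e : d' ** e = 0.
  by rewrite /d' -mulA qmulDl qmul1 ee (add2v charF) qmulx0.
have bd' : B b2 d' != 0.
  rewrite qformC /d' qadjr // qconjD // qconj1 // ce (add2vK charF) b2e.
  by rewrite qformC.
clearbody d'.
pose d'' := d' + (alpha * B b1 d') *: d1.
have d''h : N (- h) d''.
  apply: (qgr_oddD gr) => //; have [->|nz] := eqVneq (B b1 d') 0.
    rewrite mulr0 scale0r -(scale0r d'); exact: (qgr_oddZ gr).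
  apply: (qgr_oddZ gr); have /eqP := odd_form b1g d'h nz.
  by rewrite subr_eq0 => /eqP <-.
have c0 : alpha * B b2 d'' != 0.
  by rewrite mulf_neq0 // /d'' qformDr qformZr b2d1 mulr0 addr0.
have b1d'' : B b1 d'' = 0.
  by rewrite /d'' qformDr qformZr mulrAC f11 mul1r (add2f charF).
exists g, h, e, b1, b2, d1, ((alpha * B b2 d'')^-1 *: d''); split=> //.
- split; last by split=> //; apply: (qgr_oddZ gr).
  split=> //.
  + by rewrite qmulZl /d'' qmulDl qmulZl d'e d1e scaler0 addr0 scaler0.
  + by rewrite qformZr mulrCA mulVf.
  + by rewrite qformZr b1d'' mulr0.
- exact: (isotropic_deg iso b2h).
Qed.

Lemma eigen_root (omega : F) b : b != 0 -> w ** b = omega *: b ->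
  omega ^+ 2 + omega + 1 = 0.
Proof.
move=> b0 wb; have := mulA w w b; rewrite qsqr // Bw nw !scale1r qmulDl qmul1.
rewrite wb qmulZr wb scalerA => /eqP; rewrite -subr_eq0 (opp2v charF).
rewrite -[X in _ + (_ + X)]scale1r -!scalerDl.
by rewrite scaler_eq0 (negPf b0) orbF addrA -expr2 => /eqP.
Qed.

(** Since conj(w b2)(w b1) = q(w) conj(b2) b1, the nonzero element [frame_v3] is multiplied by lk =
    1. The eigenvalues are therefore inverse cubic roots of 1. *)
Lemma frame_eigen e b1 b2 d1 d2 (k l : F) : frame alpha e b1 b2 d1 d2 ->
  w ** b1 = k *: b1 -> w ** b2 = l *: b2 -> k ^+ 2 + k + 1 = 0 /\ l = k ^+ 2.
Proof.
move=> fr wb1 wb2; have [ee ce b1e b2e d1e d2e f11 f22 f12 f21] := fr.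
have b10 : b1 != 0.
  apply/eqP => h; move: f11; rewrite h qform0 mulr0 => /esym/eqP.
  by rewrite oner_eq0.
have kk := eigen_root b10 wb1; split=> //.
have k2 : k ^+ 2 = k + 1.
  by apply/eqP; rewrite -subr_eq0 (opp2f charF) addrA kk.
have k3 : k * k ^+ 2 = 1.
  by rewrite k2 mulrDr mulr1 -expr2 k2 addrAC (add2f charF) add0r.
have k0 : k != 0.
  by apply/eqP => h; move/eqP: k3; rewrite h mul0r eq_sym oner_eq0.
have v0 : frame_v3 alpha b1 b2 != 0.
  apply/eqP => h; have := frame_u3v3 charF dimQ fr; rewrite h qmulx0 => /esym/eqP.
  by rewrite (negPf (frame_e_neq0 fr)).
have : (l * k) *: frame_v3 alpha b1 b2 = frame_v3 alpha b1 b2.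
  rewrite {1}/frame_v3 scalerA mulrC -scalerA; congr (_ *: _).
  rewrite -scalerA -qmulZr -qmulZl -qconjZ // -wb1 -wb2 qconjM // -mulA.
  by rewrite qmul_conjK // nw scale1r.
move/eqP; rewrite -subr_eq0 -{2}(scale1r (frame_v3 _ _ _)) -scalerBl scaler_eq0.
rewrite (negPf v0) orbF subr_eq0 => /eqP lk.
by apply: (mulIf k0); rewrite lk mulrC k3.
Qed.

Lemma frame_w e b1 b2 d1 d2 b : frame alpha e b1 b2 d1 d2 -> b ** e = b ->
  exists k l, w ** b = k *: b1 + l *: b2 /\ l = alpha * B (w ** b) d2.
Proof.
move=> fr be; have [ee ce b1e b2e d1e d2e f11 f22 f12 f21] := fr.
have wbe : (w ** b) ** e = w ** b by rewrite -mulA be.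
exists (alpha * B (w ** b) d1), (alpha * B (w ** b) d2); split=> //.
rewrite {1}(frame_coord charF dimQ fr (w ** b)).
rewrite (ideal_form charF dimQ ee ce wbe b1e) (ideal_form charF dimQ ee ce wbe b2e).
by rewrite mulr0 !scale0r !addr0.
Qed.

(** If neither [b1] nor [b2] is cyclic for [w], both are eigenvectors, with distinct eigenvalues k
    and k^2, and then [b1 + b2] is cyclic. *)
Lemma frame_cyclic e b1 b2 d1 d2 : frame alpha e b1 b2 d1 d2 ->
  exists k l m n : F,
    k * n + l * m != 0 /\ w ** (k *: b1 + l *: b2) = m *: b1 + n *: b2.
Proof.
move=> fr; have [k [l [wb1 _]]] := frame_w fr (frame_b1 fr).
have [m [n [wb2 _]]] := frame_w fr (frame_b2 fr).
have [l0|l0] := eqVneq l 0; last first.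
  by exists 1, 0, k, l; rewrite mul1r mul0r addr0 scale1r scale0r addr0.
have [m0|m0] := eqVneq m 0; last first.
  by exists 0, 1, m, n; rewrite mul1r mul0r add0r scale1r scale0r add0r.
rewrite l0 scale0r addr0 in wb1; rewrite m0 scale0r add0r in wb2.
have [kk nk] := frame_eigen fr wb1 wb2.
exists 1, 1, k, n; split; last by rewrite !scale1r qmulDr wb1 wb2.
rewrite !mul1r nk; apply/eqP => h; move/eqP: kk.
by rewrite h add0r oner_eq0.
Qed.

(** The alternatives lead, in order, to the main grading, to the grading built on a quadratic
    subalgebra or its coarsening, to [phi] of type tau_omega and to type tau_nst. *)
Theorem qgrading_cases : ~ ((forall a, E 0 a) /\ (forall b, N 0 b)) ->
  [\/ exists g b, [/\ N g b, nq b != 0, g != 0, g + g = 0 & forall a, E 0 a],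
      exists g h b w' j, [/\ [/\ N g b, nq b != 0, g + g = 0 & g != h],
         [/\ E h j, nq j != 0, h != 0 & h + h = 0] &
         [/\ w ** b = b ** w', E 0 w', B w' 1q = 1 & nq w' = 1]],
      exists omega g h e b1 b2 d1 d2,
        [/\ homog_frame g h e b1 b2 d1 d2, omega ^+ 2 + omega + 1 = 0,
            w ** b1 = omega *: b1, w ** b2 = omega ^+ 2 *: b2 &
            h + h != 0 /\ g != h] |
      exists g e b1 b2 d1 d2,
        [/\ homog_frame g g e b1 b2 d1 d2, g + g != 0,
            w ** b1 = b2 & w ** b2 = b1 + b2]].
Proof.
move=> nt.
have [[g [b [bg nb]]]|iso] := classic (exists g b, N g b /\ nq b != 0); last first.
  have {}iso g b : N g b -> nq b = 0.
    by move=> bg; apply: NNPP => /eqP nb; apply: iso; exists g, b.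
  have [g [h [e [b1 [b2 [d1 [d2 [fr gg hh]]]]]]]] := isotropic_frame iso.
  have [fr0 [b1g b2h d1g d2h]] := fr.
  have [gh|gh] := eqVneq g h; last first.
    apply: Or43.
    have [ee ce b1e b2e d1e d2e f11 f22 f12 f21] := fr0.
    (* Multiplication by [w] keeps the degree, and g differs from h, so w b1 is orthogonal to [d2]
       and has no component along [b2]. *)
    have wb1 : w ** b1 = (alpha * B (w ** b1) d1) *: b1.
      have [k [l [wb lE]]] := frame_w fr0 b1e.
      rewrite {}lE (odd_form0 (odd_w gr b1g) d2h) ?subr_eq0 // mulr0 in wb.
      rewrite {1}wb scale0r addr0; congr (_ *: _).
      by rewrite wb scale0r addr0 qformZl mulrCA f11 mulr1.
    have wb2 : w ** b2 = (alpha * B (w ** b2) d2) *: b2.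
      have [k [l [wb lE]]] := frame_w (frame_swap fr0) b2e.
      rewrite {}lE (odd_form0 (odd_w gr b2h) d1g) ?subr_eq0 1?eq_sym // mulr0 in wb.
      rewrite {1}wb scale0r addr0; congr (_ *: _).
      by rewrite wb scale0r addr0 qformZl mulrCA f22 mulr1.
    have [kk lE] := frame_eigen fr0 wb1 wb2; rewrite lE in wb2.
    by exists (alpha * B (w ** b1) d1), g, h, e, b1, b2, d1, d2.
  apply: Or44; rewrite -gh in b2h d2h.
  have [k [l [m [n [D wb]]]]] := frame_cyclic fr0.
  exists g, e; do 4!eexists; split; [split; first exact: (frame_change charF alpha_neq0 fr0 D)| | |] => //.
    by split; do ?[apply: (qgr_oddZ gr) => //|apply: (qgr_oddD gr)].
  by rewrite -wb mulA qsqr // Bw nw !scale1r qmulDl qmul1 addrC.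
have [gg [w' [wb w'0 Bw' nw']]] := odd_anisotropic bg nb.
have [E0|nE0] := classic (forall a, E 0 a).
  (* Were g = 0, every odd element would have degree 0, being [b] times an element of [Q], and the
     grading would be trivial. *)
  apply: Or41; exists g, b; split=> //; apply/eqP => g0; apply: nt; split=> // z.
  have -> : z = b ** ((nq b)^-1 *: (cj b ** z)).
    by rewrite qmulZr qmulK_conjl // scalerA mulVf // scale1r.
  by rewrite -(addr0 0) -{1}g0; apply: (odd_mul gr).
have [[h [j [jh nj h0]]]|iso] := classic (exists h j, [/\ E h j, nq j != 0 & h != 0]).
  have hh : h + h = 0.
    apply: (even_one_deg nj); rewrite -qmul_conj //.
    exact: (even_mul gr (even_conj gr jh) jh).
  apply: Or42; have [gh|gh] := eqVneq g h; last first.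
    by exists g, h, b, w', j.
  (* When g = h, replacing [b] by [b ** j] moves the odd generator to degree 0, so that the two
     degrees differ again. *)
  have bj : N 0 (b ** j) by rewrite -hh -{1}gh; apply: (odd_mul gr).
  have nbj : nq (b ** j) != 0 by rewrite qnormM mulf_neq0.
  have [_ [w'' [wb' w''0 Bw'' nw'']]] := odd_anisotropic bj nbj.
  by exists 0, h, (b ** j), w'', j; split; split; rewrite ?addr0 // eq_sym.
have {}iso h x : h != 0 -> E h x -> nq x = 0.
  by move=> h0 xh; apply: NNPP => /eqP nx; apply: iso; exists h, x.
have [h [x [h0 xh x0]]] : exists h x, [/\ h != 0, E h x & x != 0].
  apply: NNPP => nex; apply: nE0; apply: (even_ind gr) => [|a c|h a ah].
  - by rewrite -(scale0r 1q); apply: (qgr_evenZ gr); apply: (even1 gr).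
  - exact: (qgr_evenD gr).
  have [h0|h0] := eqVneq h 0; first by rewrite -h0.
  have -> : a = 0 by apply: NNPP => /eqP a0; apply: nex; exists h, a.
  by rewrite -(scale0r 1q); apply: (qgr_evenZ gr); apply: (even1 gr).
have [omega [e [b1 [b2 [d1 [d2 [fr om wb1 wb2 hh]]]]]]] :=
  split_even_frame bg nb wb w'0 Bw' nw' iso h0 xh x0.
apply: Or43; exists omega, g, (g - h), e, b1, b2, d1, d2; split=> //; split.
  by rewrite addrACA gg add0r -opprD oppr_eq0.
by rewrite -subr_eq0 opprB addrCA subrr addr0.
Qed.

End Cases.
(** * Universal groups *)

Section AdditiveMaps.

Lemma additive_ex (A K : zmodType) (f : A -> K) :
  {morph f : x y / x - y} -> exists theta : {additive A -> K}, theta =1 f.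
Proof.
move=> fB; pose g : {additive A -> K} := HB.pack f
  (GRing.isZmodMorphism.Build A K f fB).
by exists g.
Qed.

Variable K : zmodType.
Implicit Types k l : K.

Lemma additive_int k : exists theta : {additive int -> K}, theta 1 = k.
Proof.
have [|theta thE] := @additive_ex int K (fun z => k *~ z).
  by move=> x y; rewrite mulrzBr.
by exists theta; rewrite thE.
Qed.

Lemma additive_ord n k : k *+ n.+2 = 0 ->
  exists theta : {additive 'I_n.+2 -> K}, theta 1 = k.
Proof.
move=> kn; have kmod m : k *+ (m %% n.+2) = k *+ m.
  by rewrite [in RHS](divn_eq m n.+2) mulrnDr mulnC mulrnA kn mul0rn add0r.
have [|theta thE] := @additive_ex 'I_n.+2 K (fun x => k *+ x).
  move=> x y; rewrite /= kmod mulrnDr kmod mulrnBr ?kn ?sub0r //.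
  exact: ltnW.
by exists theta; rewrite thE.
Qed.

Lemma additive_pair (A1 A2 : zmodType) (f : {additive A1 -> K})
    (g : {additive A2 -> K}) :
  exists theta : {additive A1 * A2 -> K}, forall x y, theta (x, y) = f x + g y.
Proof.
have [|theta thE] := @additive_ex (A1 * A2)%type K (fun x => f x.1 + g x.2).
  by move=> x y; rewrite !raddfB /= opprD addrACA.
by exists theta => x y; rewrite thE.
Qed.

Lemma additive_int_eq (f g : {additive int -> K}) : f 1 = g 1 -> f =1 g.
Proof.
move=> fg z; rewrite -[z]intz.
by rewrite -[z%:~R]/(1 *~ z) !raddfMz fg.
Qed.

Lemma additive_ord_eq n (f g : {additive 'I_n.+2 -> K}) : f 1 = g 1 -> f =1 g.
Proof. by move=> fg x; rewrite -(natr_Zp x) !raddfMn fg. Qed.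

Lemma additive_pair_eq (A1 A2 : zmodType) (f g : {additive A1 * A2 -> K}) :
  (forall x, f (x, 0) = g (x, 0)) -> (forall y, f (0, y) = g (0, y)) -> f =1 g.
Proof.
move=> f1 f2 [x y].
have -> : (x, y) = (x, 0) + (0, y) by congr pair; rewrite /= ?addr0 ?add0r.
by rewrite !raddfD f1 f2.
Qed.

End AdditiveMaps.

(* A is generated by a1 and a2, subject to the relations which the degrees of
   the canonical basis impose: u_i has degree a_i and v_i has degree - a_i, with
   a1 + a2 + a3 = 0, and f need only be defined on degrees. *)
Definition cartan_presented (A : zmodType) (a1 a2 : A) : Prop :=
  forall (K : zmodType) (f : A -> K),
    f 0 = 0 -> f (- a1) = - f a1 -> f (- a2) = - f a2 ->
    f (a1 + a2) = f a1 + f a2 -> f (- (a1 + a2)) = - (f a1 + f a2) ->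
  exists theta : {additive A -> K},
    [/\ theta a1 = f a1, theta a2 = f a2 &
        forall theta' : {additive A -> K},
          theta' a1 = f a1 -> theta' a2 = f a2 -> theta' =1 theta].

Lemma additive_fst (A1 A2 K : zmodType) (f : {additive A1 * A2 -> K}) :
  exists g : {additive A1 -> K}, forall x, f (x, 0) = g x.
Proof.
have [|g gE] := @additive_ex A1 K (fun x => f (x, 0)).
  by move=> x y; rewrite -raddfB; congr (f (_, _)); rewrite /= subrr.
by exists g => x; rewrite gE.
Qed.

Lemma additive_snd (A1 A2 K : zmodType) (f : {additive A1 * A2 -> K}) :
  exists g : {additive A2 -> K}, forall y, f (0, y) = g y.
Proof.
have [|g gE] := @additive_ex A2 K (fun y => f (0, y)).
  by move=> x y; rewrite -raddfB; congr (f (_, _)); rewrite /= subrr.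
by exists g => x; rewrite gE.
Qed.

Lemma additive_int_pair_eq n (K : zmodType) (f g : {additive int * 'I_n.+2 -> K}) :
  f (1, 0) = g (1, 0) -> f (0, 1) = g (0, 1) -> f =1 g.
Proof.
have [f1 f1E] := additive_fst f; have [g1 g1E] := additive_fst g.
have [f2 f2E] := additive_snd f; have [g2 g2E] := additive_snd g.
rewrite f1E g1E f2E g2E => e1 e2; apply: additive_pair_eq => z.
  by rewrite f1E g1E; apply: additive_int_eq.
by rewrite f2E g2E; apply: additive_ord_eq.
Qed.

Lemma additive_int2_eq (K : zmodType) (f g : {additive int * int -> K}) :
  f (1, 0) = g (1, 0) -> f (0, 1) = g (0, 1) -> f =1 g.
Proof.
have [f1 f1E] := additive_fst f; have [g1 g1E] := additive_fst g.
have [f2 f2E] := additive_snd f; have [g2 g2E] := additive_snd g.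
rewrite f1E g1E f2E g2E => e1 e2; apply: additive_pair_eq => z.
  by rewrite f1E g1E; apply: additive_int_eq.
by rewrite f2E g2E; apply: additive_int_eq.
Qed.

Lemma additive_int2 (K : zmodType) (k l : K) :
  exists theta : {additive int * int -> K}, theta (1, 0) = k /\ theta (0, 1) = l.
Proof.
have [f f1] := additive_int k; have [g g1] := additive_int l.
have [theta thE] := additive_pair f g.
by exists theta; rewrite !thE f1 g1 !raddf0 addr0 add0r.
Qed.

Lemma additive_int_ord n (K : zmodType) (k l : K) : l *+ n.+2 = 0 ->
  exists theta : {additive int * 'I_n.+2 -> K},
    theta (1, 0) = k /\ theta (0, 1) = l.
Proof.
have [f f1] := additive_int k; case/additive_ord => g g1.
have [theta thE] := additive_pair f g.
by exists theta; rewrite !thE f1 g1 !raddf0 addr0 add0r.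
Qed.

(** No two of the degrees 0, a1, a2, a1 + a2 and their opposites coincide here, so the values of [f]
    at the generators are free. In the variants below each coincidence is an equation on [f],
    because [f] is a function of the degree. *)
Lemma int2_presented : cartan_presented ((1, 0) : int * int) (0, 1).
Proof.
move=> K f _ _ _ _ _; have [th [th1 th2]] := additive_int2 (f (1, 0)) (f (0, 1)).
by exists th; split=> // th' e1 e2; apply: additive_int2_eq; rewrite ?e1 ?e2.
Qed.

Lemma int_presented_11 : cartan_presented (1 : int) 1.
Proof.
move=> K f _ _ _ _ _; have [th th1] := additive_int (f 1).
by exists th; split=> // th' e1 _; apply: additive_int_eq; rewrite e1.
Qed.

Lemma int_presented_1N1 : cartan_presented (1 : int) (- 1).
Proof.
move=> K f _ fN _ _ _; have [th th1] := additive_int (f 1).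
exists th; split=> // [|th' e1 _]; first by rewrite fN raddfN th1.
by apply: additive_int_eq; rewrite e1.
Qed.

Lemma int_presented_0N1 : cartan_presented (0 : int) (- 1).
Proof.
move=> K f f0 _ fN _ _; have [th th1] := additive_int (f 1).
rewrite opprK in fN.
exists th; split=> [||th' _ e1]; first by rewrite raddf0 f0.
  by rewrite raddfN th1 fN opprK.
by apply: additive_int_eq; rewrite th1 fN -e1 raddfN opprK.
Qed.

(** The degrees a1 + a2 and - a2 are both -1; comparing the two values of [f] there gives f(-2) = -2
    f(1). *)
Lemma int_presented_N21 : cartan_presented (- 2 : int) 1.
Proof.
move=> K f _ fN2 fN1 f12 _; have [th th1] := additive_int (f 1).
exists th; split=> // [|th' _ e1]; last by apply: additive_int_eq; rewrite e1.
have e : (- 2 + 1 : int) = - 1 by [].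
rewrite e fN1 in f12; rewrite -[X in th X]/(- (1 + 1) : int) raddfN raddfD th1.
by rewrite opprD {1}f12 addrK.
Qed.

Lemma Z3_presented : cartan_presented (1 : 'Z_3) 1.
Proof.
move=> K f _ fN1 _ f11 _.
have e : (1 + 1 : 'Z_3) = - 1 by apply: val_inj.
rewrite e fN1 in f11.
have [|th th1] := @additive_ord K 1 (f 1).
  by rewrite mulrS mulr2n -f11 subrr.
by exists th; split=> // th' e1 _; apply: additive_ord_eq; rewrite e1.
Qed.

Lemma Z4_presented_11 : cartan_presented (1 : 'Z_4) 1.
Proof.
move=> K f _ _ _ f11 f11N.
have e : - (1 + 1 : 'Z_4) = 1 + 1 by apply: val_inj.
rewrite e f11 in f11N.
have [|th th1] := @additive_ord K 2 (f 1).
  by rewrite (mulrnDr _ 2 2) !mulr2n {1}f11N addNr.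
by exists th; split=> // th' e1 _; apply: additive_ord_eq; rewrite e1.
Qed.

(** From a1 + a2 = - a2 follows f(2) = -2 f(1), and from a1 = - a1 follows f(2) = - f(2); together 4
    f(1) = 0. *)
Lemma Z4_presented_21 : cartan_presented (2 : 'Z_4) 1.
Proof.
move=> K f _ fN2 fN1 f21 _.
have e : - 2 = 2 :> 'Z_4 by apply: val_inj.
have e' : 2 + 1 = - 1 :> 'Z_4 by apply: val_inj.
rewrite e in fN2; rewrite e' fN1 in f21.
have f2 : f 2 = - (f 1 + f 1) by rewrite opprD {1}f21 addrK.
have f4 : f 1 + f 1 + (f 1 + f 1) = 0.
  by apply: oppr_inj; rewrite opprD -f2 {1}fN2 addNr oppr0.
have [|th th1] := @additive_ord K 2 (f 1).
  by rewrite (mulrnDr _ 2 2) !mulr2n.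
exists th; split=> // [|th' _ e1]; last by apply: additive_ord_eq; rewrite e1.
rewrite (_ : 2 = 1 + 1 :> 'Z_4); last by apply: val_inj.
rewrite raddfD th1 (_ : 1 + 1 = 2 :> 'Z_4) ?f2; last by apply: val_inj.
by apply/eqP; rewrite -addr_eq0 f4.
Qed.

Lemma intZ2_presented_a : cartan_presented ((0, 1) : int * 'Z_2) (1, 0).
Proof.
move=> K f _ fN _ _ _.
have e : - ((0, 1) : int * 'Z_2) = (0, 1) by congr pair; apply: val_inj.
rewrite e in fN.
have [|th [th1 th2]] := @additive_int_ord 0 K (f (1, 0)) (f (0, 1)).
  by rewrite mulr2n {1}fN addNr.
by exists th; split=> // th' e1 e2; apply: additive_int_pair_eq;
  rewrite ?th1 ?th2.
Qed.

(** The torsion generator (0, 1) is a1 + a2; as it equals its opposite, f(a1) + f(a2) is killed by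
    2. *)
Lemma intZ2_presented_b : cartan_presented ((- 1, 1) : int * 'Z_2) (1, 0).
Proof.
move=> K f _ _ _ fD fND.
have e : ((- 1, 1) : int * 'Z_2) + (1, 0) = (0, 1) by congr pair; apply: val_inj.
have e' : - ((0, 1) : int * 'Z_2) = (0, 1) by congr pair; apply: val_inj.
rewrite e in fD; rewrite e e' fD in fND.
have [|th [th1 th2]] := @additive_int_ord 0 K (f (1, 0)) (f (0, 1)).
  by rewrite fD mulr2n {1}fND addNr.
have e2 : ((- 1, 1) : int * 'Z_2) = (0, 1) - (1, 0).
  by rewrite -e addrK.
exists th; split=> // [|th' f1 f2]; first by rewrite {1}e2 raddfB th1 th2 fD addrK.
apply: additive_int_pair_eq; first by rewrite th1.
by rewrite th2 fD -e raddfD f1 f2.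
Qed.

(** * Gradings with a homogeneous canonical basis *)

Section Cartan.

Variables (F : fieldType) (charF : 2%N \in [pchar F]).
Variables (Q : hurwitzAlg F) (dimQ : \dim {: Q} = 4%N).
Variables (alpha : F) (alpha_neq0 : alpha != 0).

Local Notation B := (@qform F Q).
Local Notation cj := (@qconj F Q).
Local Notation "1q" := (hw_one Q).
Local Notation mulC := (@cd_mul F Q alpha).

Lemma cd_mulDl x y z : mulC (x + y) z = mulC x z + mulC y z.
Proof.
case: x y z => a b [c d] [f g]; rewrite [(a, b) + _]pairD !cd_mulE // pairD.
by congr pair; rewrite !(qmulDl, qmulDr) ?scalerDr addrACA.
Qed.

Lemma cd_mulDr x y z : mulC x (y + z) = mulC x y + mulC x z.
Proof.
case: x y z => a b [c d] [f g]; rewrite [(c, d) + _]pairD !cd_mulE // pairD !qconjD //.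
by congr pair; rewrite !(qmulDl, qmulDr) ?scalerDr addrACA.
Qed.

Lemma cd_mulZl k x y : mulC (k *: x) y = k *: mulC x y.
Proof.
case: x y => a b [c d]; rewrite [k *: (a, b)]pairZ !cd_mulE // pairZ.
congr pair; rewrite !(qmulZl, qmulZr) scalerDr //.
by rewrite !scalerA mulrC.
Qed.

Lemma cd_mulZr k x y : mulC x (k *: y) = k *: mulC x y.
Proof.
case: x y => a b [c d]; rewrite [k *: (c, d)]pairZ !cd_mulE // pairZ !qconjZ //.
congr pair; rewrite !(qmulZl, qmulZr) scalerDr //.
by rewrite !scalerA mulrC.
Qed.

Lemma cd_mul0 x : mulC 0 x = 0.
Proof. by have := cd_mulZl 0 0 x; rewrite !scale0r. Qed.

Lemma cd_mulx0 x : mulC x 0 = 0.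
Proof. by have := cd_mulZr 0 x 0; rewrite !scale0r. Qed.

Lemma span_comp_mul (A : zmodType) (M : seq (A * CD Q)) :
  (forall p q, p \in M -> q \in M -> mulC p.2 q.2 \in span_comp M (p.1 + q.1)) ->
  forall a b x y, x \in span_comp M a -> y \in span_comp M b ->
    mulC x y \in span_comp M (a + b).
Proof.
move=> MM a b x y xa yb; move: x xa; apply: span_ind => [|x x' hx hx'|k x hx|].
- by rewrite cd_mul0 mem0v.
- by rewrite cd_mulDl rpredD.
- by rewrite cd_mulZl rpredZ.
move=> _ /mapP[p + ->]; rewrite mem_filter => /andP[/eqP <- pM].
move: y yb; apply: span_ind => [|y y' hy hy'|k y hy|].
- by rewrite cd_mulx0 mem0v.
- by rewrite cd_mulDr rpredD.
- by rewrite cd_mulZr rpredZ.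
by move=> _ /mapP[q + ->]; rewrite mem_filter => /andP[/eqP <- qM]; apply: MM.
Qed.

Variables (phi : 'End(CD Q)) (w : Q).
Hypotheses (Bw : B w 1q = 1) (nw : nq w = 1).
Hypothesis phiE : forall a b, phi (a, b) = (a, w ** b).

Local Notation om := (okubo_mul alpha phi).

Variables (H : zmodType) (Gamma : H -> {vspace CD Q}).
Hypothesis Gamma_gr : okubo_grading alpha phi Gamma.

Let gr := okubo_qgrading charF dimQ alpha_neq0 Bw nw phiE Gamma_gr.

Variables (g h : H) (e b1 b2 d1 d2 : Q).
Hypothesis hf :
  homog_frame alpha (fun g b => ((0, b) : CD Q) \in Gamma g) g h e b1 b2 d1 d2.

Let fr := hf.1.
Local Notation e1 := (can_e1 e).
Local Notation e2 := (can_e2 e).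
Local Notation u := (can_u alpha b1 b2 d1 d2).
Local Notation v := (can_v alpha b1 b2 d1 d2).

(** All six degrees are parameters, although two determine the rest, so that they can be given as
    the literals displayed in the statement, such as 3 for -1 in ['Z_4]. *)
Definition cartan_list (A : zmodType) (a1 a2 a3 n1 n2 n3 : A) :
    seq (A * CD Q) :=
  [:: (0, e1); (0, e2); (a1, u 1); (a2, u 2); (a3, u 3);
      (n1, v 1); (n2, v 2); (n3, v 3)].

Definition cartan_deg (A : zmodType) (a1 a2 : A) (i : 'Z_3) : A :=
  if i == 1 then a1 else if i == 2 then a2 else - (a1 + a2).

Lemma cartan_listP (A : zmodType) (a1 a2 : A) p (d := cartan_deg a1 a2) :
  p \in cartan_list a1 a2 (- (a1 + a2)) (- a1) (- a2) (a1 + a2) ->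
  (p.1 = 0) \/ exists i, p = (d i, u i) \/ p = (- d i, v i).
Proof.
rewrite !inE => /or4P[/eqP->|/eqP->|/eqP->|]; try by left.
  by right; exists 1; left.
case/orP => [/eqP->|]; first by right; exists 2; left.
case/or4P => /eqP->; first by right; exists 0; left.
- by right; exists 1; right.
- by right; exists 2; right.
by right; exists 0; right; rewrite /d /cartan_deg /= opprK.
Qed.

Lemma frame_homogeneous p : p \in cartan_list g h (- (g + h)) (- g) (- h) (g + h) ->
  p.2 \in Gamma p.1.
Proof.
have [_ [b1g b2h d1g d2h]] := hf.
have e0 : (e1 : CD Q) \in Gamma 0.
  rewrite /e1 -(frame_e11 charF dimQ fr); apply: (qgr_evenZ gr).
  by rewrite -(subrr g); apply: (odd_conj_mul gr).
have e20 : (e2 : CD Q) \in Gamma 0.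
  exact: (qgr_evenD gr (even1 gr) e0).
rewrite !inE => /or4P[/eqP->|/eqP->|/eqP->|] //.
case/orP => [/eqP->|] //; case/or4P => /eqP-> //.
  by apply: (qgr_evenZ gr); rewrite opprD; apply: (odd_conj_mul gr).
by apply: (qgr_evenZ gr); apply: (odd_conj_mul gr).
Qed.

(** Parity, conjugation and [phi] act within one component and are inherited from [Gamma]. Products
    are a separate premise: [theta] is injective on [s] only, so a sum of two degrees might leave
    [s] in [A] although its image is a degree of [Gamma]. *)
Lemma span_comp_grading (A : zmodType) (M : seq (A * CD Q)) (theta : A -> H)
    (s : seq A) :
  basis_of fullv (map snd M) -> (forall p, p \in M -> p.2 \in Gamma (theta p.1)) ->
  {subset map fst M <= s} -> uniq s -> {in s &, injective theta} ->
  [/\ forall a, a \in s -> Gamma (theta a) = span_comp M a,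
      forall a, a \notin s -> span_comp M a = 0%VS,
      (\sum_(a <- s) span_comp M a)%VS = fullv &
      (forall p q, p \in M -> q \in M ->
        mulC p.2 q.2 \in span_comp M (p.1 + q.1)) ->
      okubo_grading alpha phi (span_comp M)].
Proof.
move=> bM MG Ms us inj; have full := span_comp_full Ms (span_basis bM).
have sub a : a \in s -> (span_comp M a <= Gamma (theta a))%VS.
  move=> _; apply/span_subvP => _ /mapP[p + ->].
  by rewrite mem_filter => /andP[/eqP <- /MG].
have [eqGM _] := decomposition_match Gamma_gr.1.1 us inj sub full.
have z a : a \notin s -> span_comp M a = 0%VS.
  by apply: contraNeq => /span_comp_supp; apply: Ms.
split=> // MM; apply: okubo_grading_intro.
- exact: span_comp_decomposition.
- move=> a; have [sa|/z ->] := boolP (a \in s); last by rewrite !cap0v addv0.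
  by rewrite -eqGM //; apply: Gamma_gr.2.
- move=> a x; have [sa|/z ->] := boolP (a \in s); last first.
    by rewrite memv0 => /eqP ->; rewrite -[0]/(0, 0) cd_conjE // qconj0 // mem0v.
  by rewrite -eqGM //; apply: (grading_conj charF dimQ Bw nw phiE Gamma_gr).
- move=> a x; have [sa|/z ->] := boolP (a \in s); last first.
    by rewrite memv0 => /eqP ->; rewrite linear0 mem0v.
  by rewrite -eqGM //; apply: (grading_phi charF dimQ Bw nw phiE Gamma_gr).
- exact: span_comp_mul.
Qed.

(** The equations required by [cartan_presented] come from the nonzero products e_1 e_1, u_i v_i and
    u_1 u_2. *)
Lemma cartan_list_universal (A : zmodType) (a1 a2 : A)
    (M := cartan_list a1 a2 (- (a1 + a2)) (- a1) (- a2) (a1 + a2)) :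
  okubo_grading alpha phi (span_comp M) ->
  (forall a, span_comp M a != 0%VS ->
    a \in [:: 0; a1; a2; - (a1 + a2); - a1; - a2; a1 + a2]) ->
  cartan_presented a1 a2 -> universal_degree om (span_comp M) id.
Proof.
move=> Mgr supp pres; have can := frame_canonical charF dimQ fr.
have [bM [ee1 _ _ _] _ uprod uv] := can.
have mem p : p \in M -> p.2 \in span_comp M p.1 by apply: span_comp_mem.
have nz x : x \in map snd M -> x != 0 by apply: (free_not0 (basis_free bM)).
have memi i : (i < 8)%N -> (nth (0, 0) M i).2 \in span_comp M (nth (0, 0) M i).1.
  by move=> i8; apply/mem/mem_nth.
have nzi i : (i < 8)%N -> (nth (0, 0) M i).2 != 0.
  by move=> i8; apply/nz/map_f/mem_nth.
apply: (universal_degree_id Mgr.1) => K f fresp.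
(* Positions in the list: 0 and 1 are the idempotents, 2 to 4 the u_i, 5 to 7 the v_i. *)
have rel i j : (i < 8)%N -> (j < 8)%N ->
    mulC (nth (0, 0) M i).2 (nth (0, 0) M j).2 != 0 ->
    f (nth (0, 0) M i).1 + f (nth (0, 0) M j).1 =
    f ((nth (0, 0) M i).1 + (nth (0, 0) M j).1).
  move=> i8 j8 nzm; apply: fresp.
  apply: (okubo_support_relation charF dimQ Bw nw phiE Mgr _ _ nzm); exact: memi.
have neg (x : CD Q) : x != 0 -> - x != 0 by rewrite oppr_eq0.
have e1nz : e1 != 0 := nzi 0%N isT.
have uvnz i : mulC (u i) (v i) != 0.
  by have [-> _] := uv i i; rewrite eqxx scale1r neg.
have f0 : f 0 = 0.
  have eenz : mulC e1 e1 != 0 by rewrite ee1.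
  have := rel 0%N 0%N isT isT eenz.
  by rewrite /= addr0 => h0; apply: (@addrI _ (f 0)); rewrite h0 addr0.
have f1 : f (- a1) = - f a1.
  have := rel 2%N 5%N isT isT (uvnz 1); rewrite /= subrr f0.
  by move/eqP; rewrite addrC addr_eq0 => /eqP.
have f2 : f (- a2) = - f a2.
  have := rel 3%N 6%N isT isT (uvnz 2); rewrite /= subrr f0.
  by move/eqP; rewrite addrC addr_eq0 => /eqP.
have f12 : f (a1 + a2) = f a1 + f a2.
  have unz : mulC (u 1) (u 2) != 0.
    have [[uu _ _ _] _] := uprod 1; rewrite -[u 2]/(u (1 + 1)) uu.
    exact: (nzi 7%N isT).
  exact: esym (rel 2%N 3%N isT isT unz).
have f3 : f (- (a1 + a2)) = - (f a1 + f a2).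
  have := rel 4%N 7%N isT isT (uvnz 3); rewrite /= addNr f0 f12.
  by move/eqP; rewrite addr_eq0 => /eqP.
have [th [th1 th2 thU]] := pres K f f0 f1 f2 f12 f3.
exists th; split=> [a /supp|th' th'E].
  rewrite !inE => /or4P[/eqP->|/eqP->|/eqP->|] //; first by rewrite raddf0.
  case/or4P => /eqP->.
  - by rewrite raddfN raddfD th1 th2.
  - by rewrite raddfN th1.
  - by rewrite raddfN th2.
  - by rewrite raddfD th1 th2.
have snz i : (i < 8)%N -> span_comp M (nth (0, 0) M i).1 != 0%VS.
  move=> i8; apply: contraNneq (nzi i i8) => s0.
  by have := memi i i8; rewrite s0 memv0.
by apply: thU; apply: th'E; [exact: (snz 2%N)|exact: (snz 3%N)].
Qed.


(** The three u-degrees add up to 0, so u_i u_{i+1} and v_i v_{i+1} have a listed degree, as do u_i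
    v_i and v_i u_i; the other products of u's and v's vanish. This holds in any [A], independently
    of [H]. *)
Lemma cartan_list_mul (A : zmodType) (a1 a2 : A) p q
    (M := cartan_list a1 a2 (- (a1 + a2)) (- a1) (- a2) (a1 + a2)) :
  p \in M -> q \in M -> mulC p.2 q.2 = 0 \/ p.1 + q.1 \in map fst M.
Proof.
have [_ _ _ uprod uv] := frame_canonical charF dimQ fr.
move=> pM qM; have pd := map_f fst pM; have qd := map_f fst qM.
have [p0|[i pE]] := cartan_listP pM; first by right; rewrite p0 add0r.
have [q0|[j qE]] := cartan_listP qM; first by right; rewrite q0 addr0.
clear pd qd pM qM; set d := cartan_deg a1 a2 in pE qE.
have memd k : d k \in map fst M /\ - d k \in map fst M.
  by move: k; apply: Z3_ind; rewrite /d /cartan_deg /= ?opprK !inE !eqxx ?orbT.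
have dD k : d k + d (k + 1) = - d (k + 2).
  move: k; apply: Z3_ind.
  - by rewrite /d /cartan_deg /= opprK.
  - by rewrite /d /cartan_deg /= opprD addrCA subrr addr0.
  - by rewrite /d /cartan_deg /= opprD addrAC addNr add0r.
have dDm k : d k + d (k + 1) \in map fst M by rewrite dD; apply: (memd _).2.
have dDm' k : - d k - d (k + 1) \in map fst M.
  by rewrite -opprD dD opprK; apply: (memd _).1.
have three (k l : 'Z_3) : [|| l == k, l == k + 1 | k == l + 1].
  by elim/Z3_ind: k; elim/Z3_ind: l.
case: pE qE => -> [] -> /=.
- case/or3P: (three i j) => /eqP ->; last by right; rewrite addrC.
    by left; have [_ [-> _]] := uprod i.
  by right.
- have [->|ij] := eqVneq i j; first by right; rewrite subrr inE eqxx.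
  by left; have [-> _] := uv i j; rewrite (negPf ij) scale0r oppr0.
- have [->|ij] := eqVneq i j; first by right; rewrite addNr inE eqxx.
  by left; have [_ ->] := uv i j; rewrite (negPf ij) scale0r oppr0.
- case/or3P: (three i j) => /eqP ->; last by right; rewrite addrC.
    by left; have [_ [_ ->]] := uprod i.
  by right.
Qed.

(** Common engine of the targets: [L] groups the basis by degree, [idx] says in which order it uses
    the eight vectors, and [C] contains, up to sign, all differences of distinct degrees.
    Injectivity of [theta] on degrees then means that it vanishes nowhere on [C]. *)
Theorem cartan_up_to_equiv (A : zmodType) (a1 a2 a3 n1 n2 n3 : A)
    (theta : {additive A -> H}) (L : seq (A * seq (CD Q))) (idx : seq nat)
    (C : seq A) :
  a3 = - (a1 + a2) -> n1 = - a1 -> n2 = - a2 -> n3 = a1 + a2 ->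
  theta a1 = g -> theta a2 = h ->
  [seq (p.1, x) | p <- L, x <- p.2] =
    [seq nth (0, 0) (cartan_list a1 a2 a3 n1 n2 n3) i | i <- idx] ->
  perm_eq idx (iota 0 8) -> uniq (map fst L) ->
  all (fun a => all (fun b => [|| a == b, a - b \in C | b - a \in C])
    (map fst L)) (map fst L) ->
  all (fun c => theta c != 0) C ->
  cartan_presented a1 a2 ->
  is_up_to_equiv alpha phi Gamma (components [seq (p.1, <<p.2>>%VS) | p <- L]).
Proof.
move=> -> -> -> -> th1 th2 LM idx8 uL diff /allP thC pres.
set M := cartan_list _ _ _ _ _ _ in LM.
have permM : perm_eq [seq (p.1, x) | p <- L, x <- p.2] M.
  rewrite LM -[X in perm_eq _ X](mkseq_nth (0, 0)) /mkseq.
  exact: perm_map.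
have -> : components [seq (p.1, <<p.2>>%VS) | p <- L] = span_comp M.
  apply: functional_extensionality => a.
  by rewrite components_span; apply: span_comp_perm.
have Ms : {subset map fst M <= map fst L}.
  move=> a; rewrite -(perm_mem (perm_map fst permM)) => /mapP[[b x]].
  by case/allpairsPdep => p [y [pL _ [-> _]]] ->; apply: map_f.
have inj : {in map fst L &, injective theta}.
  move=> a b aL bL thab; apply/eqP; apply/negP => /negP ab.
  have := allP (allP diff a aL) b bL; rewrite (negPf ab) /=.
  by case/orP => /thC; rewrite raddfB thab subrr eqxx.
have bM : basis_of fullv (map snd M) by case: (frame_canonical charF dimQ fr).
have MG p : p \in M -> p.2 \in Gamma (theta p.1).
  move=> pM; pose M' := cartan_list g h (- (g + h)) (- g) (- h) (g + h).
  have M'E : M' = [seq (theta q.1, q.2) | q <- M].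
    by rewrite /M' /M /cartan_list /= !(raddfN, raddfD) raddf0 th1 th2.
  apply: (@frame_homogeneous (theta p.1, p.2)); rewrite -/M' M'E.
  exact: (map_f (fun q : A * CD Q => (theta q.1, q.2)) pM).
have [eqGM z full grM] := span_comp_grading bM MG Ms uL inj.
have Mgr : okubo_grading alpha phi (span_comp M).
  apply: grM => p q pM qM; have [->|pqs] := cartan_list_mul pM qM.
    exact: mem0v.
  rewrite -eqGM ?Ms // raddfD.
  by apply: (grading_mul charF dimQ Bw nw phiE Gamma_gr); apply: MG.
apply: (is_up_to_equiv_match (okubo_mul0v charF alpha phiE)
  (okubo_mulv0 charF alpha phiE) Gamma_gr Mgr _ uL inj _ full).
  apply: cartan_list_universal => // a /span_comp_supp.
  by rewrite !inE => /orP[->|].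
by move=> a aL; rewrite eqGM.
Qed.

End Cartan.

(** * Transfer along injective maps and refinement by parity *)

Section FullSupport.

Variables (F : fieldType) (V : vectType F).

Lemma decomposition_intro (G : zmodType) (Gamma : G -> {vspace V}) (s : seq G) :
  uniq s -> (forall g, Gamma g != 0%VS -> g \in s) ->
  (\sum_(g <- s) \dim (Gamma g) <= \dim {: V})%N ->
  (\sum_(g <- s) Gamma g)%VS = fullv -> decomposition Gamma.
Proof.
move=> us Gs dims full; exists [seq g <- s | Gamma g != 0%VS].
have full' : (\sum_(g <- [seq g <- s | Gamma g != 0%VS]) Gamma g)%VS = fullv.
  rewrite big_filter big_mkcond -full; apply: eq_bigr => g _.
  by case: eqP => [->|].
split=> //; first exact: filter_uniq.
  by move=> g; rewrite mem_filter andb_idr //; apply: Gs.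
rewrite directvEgeq /= full' big_filter; apply: leq_trans dims.
by rewrite [leqLHS]big_mkcond /= leq_sum // => g _; case: ifP.
Qed.

Lemma decomposition_pull (A G : zmodType) (Gamma : G -> {vspace V})
    (theta : A -> G) :
  decomposition Gamma -> injective theta ->
  (forall g, Gamma g != 0%VS -> exists a, g = theta a) ->
  decomposition (Gamma \o theta).
Proof.
case=> t [ut memt dirt fullt] inj Gt.
have [s ts] : exists s, t = map theta s.
  have : forall g, g \in t -> exists a, g = theta a by move=> g; rewrite memt => /Gt.
  elim: t {ut memt dirt fullt} => [_|g t IH ht]; first by exists [::].
  have [s ->] : exists s, t = map theta s.
    by apply: IH => k kt; apply: ht; rewrite inE kt orbT.
  by have [a ->] := ht g (mem_head _ _); exists (a :: s).
exists s; rewrite ts in ut memt dirt fullt; split.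
- exact: map_uniq ut.
- by move=> a; rewrite /= -memt mem_map.
- by move: dirt; rewrite !directvE /= !big_map.
- by move: fullt; rewrite big_map.
Qed.

End FullSupport.

Section FullOkubo.

Variables (F : fieldType) (charF : 2%N \in [pchar F]).
Variables (Q : hurwitzAlg F) (dimQ : \dim {: Q} = 4%N).
Variables (alpha : F) (alpha_neq0 : alpha != 0).

Local Notation B := (@qform F Q).
Local Notation cj := (@qconj F Q).
Local Notation "1q" := (hw_one Q).
Local Notation mulC := (@cd_mul F Q alpha).

Variables (phi : 'End(CD Q)) (w : Q).
Hypotheses (Bw : B w 1q = 1) (nw : nq w = 1).
Hypothesis phiE : forall a b, phi (a, b) = (a, w ** b).

Local Notation om := (okubo_mul alpha phi).

(** Here [theta] is injective on all of [A], so [Delta] is the pullback of [Gamma] and inherits its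
    grading without any multiplication table. *)
Lemma full_transfer (H A : zmodType) (Gamma : H -> {vspace CD Q})
    (Delta : A -> {vspace CD Q}) (theta : {additive A -> H}) (s : seq A) :
  okubo_grading alpha phi Gamma ->
  uniq s -> (forall a, a \in s) -> injective theta ->
  (forall a, (Delta a <= Gamma (theta a))%VS) ->
  (\sum_(a <- s) Delta a)%VS = fullv ->
  okubo_grading alpha phi Delta /\
  (universal_degree om Delta id -> is_up_to_equiv alpha phi Gamma Delta).
Proof.
move=> Ggr us sT inj sub full.
have [eqGD Gs] := decomposition_match Ggr.1.1 us (in2W inj) (fun a _ => sub a) full.
have DE : Delta = Gamma \o theta.
  by apply: functional_extensionality => a; rewrite /= eqGD.
have Dgr : okubo_grading alpha phi Delta.
  split; last by move=> a; rewrite DE; apply: Ggr.2.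
  split.
    rewrite DE; apply: decomposition_pull inj _ => [|g /Gs[a _ ->]].
      exact: Ggr.1.1.
    by exists a.
  by move=> a b x y; rewrite DE /= raddfD; apply: Ggr.1.2.
split=> // univ.
apply: (is_up_to_equiv_match (okubo_mul0v charF alpha phiE)
  (okubo_mulv0 charF alpha phiE) Ggr Dgr univ us (in2W inj) _ full) => a _.
exact: sub.
Qed.

Lemma conj_part (x : CD Q) :
  (x \in cd_even Q -> phi (cd_conj alpha x) \in cd_even Q) /\
  (x \in cd_odd Q -> phi (cd_conj alpha x) \in cd_odd Q).
Proof.
split=> [/even_pairP[a ->]|/odd_pairP[a ->]]; rewrite cd_conjE // phiE.
  by apply/even_pairP; exists (cj a); rewrite qmulx0.
by apply/odd_pairP; exists (w ** a); rewrite qconj0.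
Qed.

Lemma phi_part (x : CD Q) :
  (x \in cd_even Q -> phi x \in cd_even Q) /\
  (x \in cd_odd Q -> phi x \in cd_odd Q).
Proof.
split=> [/even_pairP[a ->]|/odd_pairP[a ->]]; rewrite phiE.
  by apply/even_pairP; exists a; rewrite qmulx0.
by apply/odd_pairP; exists (w ** a).
Qed.

Definition part (i : 'Z_2) : {vspace CD Q} := if i == 0 then cd_even Q else cd_odd Q.

Lemma Z2_ind (P : 'Z_2 -> Prop) : P 0 -> P 1 -> forall i, P i.
Proof.
move=> P0 P1 [[|[|k]] hk] //.
- by rewrite (_ : Ordinal hk = 0) //; apply: val_inj.
- by rewrite (_ : Ordinal hk = 1) //; apply: val_inj.
Qed.

Lemma part_mul i j x y : x \in part i -> y \in part j -> om x y \in part (i + j).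
Proof.
have c11 : 1 + 1 = 0 :> 'Z_2 by apply: val_inj.
rewrite /okubo_mul; move: i j; apply: Z2_ind; apply: Z2_ind;
  rewrite ?c11 ?addr0 ?add0r /part /=.
- move=> /(conj_part x).1/even_pairP[a ->].
  move=> /(conj_part y).1/(phi_part _).1/even_pairP[b ->].
  by rewrite cd_mul_ee //; apply/even_pairP; exists (a ** b).
- move=> /(conj_part x).1/even_pairP[a ->].
  move=> /(conj_part y).2/(phi_part _).2/odd_pairP[b ->].
  by rewrite cd_mul_eo //; apply/odd_pairP; exists (b ** a).
- move=> /(conj_part x).2/odd_pairP[a ->].
  move=> /(conj_part y).1/(phi_part _).1/even_pairP[b ->].
  by rewrite cd_mul_oe //; apply/odd_pairP; exists (a ** cj b).
- move=> /(conj_part x).2/odd_pairP[a ->].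
  move=> /(conj_part y).2/(phi_part _).2/odd_pairP[b ->].
  by rewrite cd_mul_oo //; apply/even_pairP; exists (alpha *: (cj b ** a)).
Qed.

Lemma part_cap : (cd_even Q :&: cd_odd Q = 0)%VS.
Proof.
apply/eqP; rewrite -subv0; apply/subvP => x; rewrite memv_cap.
by case/andP => /even_pairP[a ->] /odd_pairP[b [-> _]]; rewrite mem0v.
Qed.

(* The common refinement of a grading with the main grading. *)
Definition refined (H : zmodType) (Gamma : H -> {vspace CD Q})
    (p : H * 'Z_2) : {vspace CD Q} := (Gamma p.1 :&: part p.2)%VS.

(** Every component is the direct sum of its even and odd parts, so dimensions add up. It serves to
    recover the four-component grading when [Gamma] is only its coarsening. *)
Lemma refined_grading (H : zmodType) (Gamma : H -> {vspace CD Q}) :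
  okubo_grading alpha phi Gamma -> okubo_grading alpha phi (refined Gamma).
Proof.
move=> Ggr; have [s [us mems dirs fulls]] := Ggr.1.1.
have split2 g : (\dim (Gamma g) = \dim (refined Gamma (g, 0%R)) +
    \dim (refined Gamma (g, 1%R)))%N.
  rewrite -dimv_disjoint_sum; first by rewrite [in LHS]Ggr.2.
  apply/eqP; rewrite -subv0 -part_cap /refined /part /=.
  by apply: capvS; apply: capvSr.
split.
  split; last first.
    move=> [g i] [h j] x y /[!memv_cap]/andP[xg xi] /andP[yh yj].
    by rewrite /= Ggr.1.2 // part_mul.
  apply: (@decomposition_intro _ _ _ _ [seq (g, i) | g <- s, i <- [:: 0; 1] : seq 'Z_2]).
  - by apply: allpairs_uniq => // -[? ?] [? ?] _ _ [-> ->].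
  - move=> [g i] nz; apply/allpairsP; exists (g, i); split=> //=.
      rewrite mems; apply: contraNneq nz => g0.
      by rewrite /refined /= g0 cap0v.
    by move: i {nz}; apply: Z2_ind.
  - rewrite big_allpairs /=.
    rewrite (eq_bigr (fun g => \dim (Gamma g))) => [|g _].
      by move: dirs; rewrite directvE /= => /eqP <-; rewrite fulls.
    by rewrite split2 big_cons big_seq1.
  - rewrite big_allpairs /= -fulls; apply: eq_bigr => g _.
    by rewrite big_cons big_seq1 [in RHS]Ggr.2.
move=> [g i]; apply/eqP; rewrite eqEsubv; apply/andP; split; last first.
  by rewrite subv_add !capvSl.
rewrite /refined /part /=; case: ifP => _.
  by apply: subv_trans (addvSl _ _); rewrite subv_cap subvv capvSr.
by apply: subv_trans (addvSr _ _); rewrite subv_cap subvv capvSr.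
Qed.

Lemma grading_one_nz : ((1q, 0) : CD Q) != 0.
Proof. by apply/eqP => -[/eqP]; rewrite (negPf (qone_neq0 dimQ)). Qed.

Lemma respects0 (A K : zmodType) (Delta : A -> {vspace CD Q}) (f : A -> K) :
  okubo_grading alpha phi Delta -> respects_relations om Delta f -> f 0 = 0.
Proof.
move=> Dgr fresp; have one := grading_one charF dimQ phiE Dgr.
have := okubo_support_relation charF dimQ Bw nw phiE Dgr one one.
rewrite cd_mul_ee // qmul1 => /(_ grading_one_nz)/fresp; rewrite addr0 => h.
by apply: (@addrI _ (f 0)); rewrite h addr0.
Qed.

Lemma Z2_universal (Delta : 'Z_2 -> {vspace CD Q}) x y :
  okubo_grading alpha phi Delta -> x \in Delta 1 -> y \in Delta 1 ->
  mulC x y != 0 -> universal_degree om Delta id.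
Proof.
move=> Dgr x1 y1 xy; apply: (universal_degree_id Dgr.1) => K f fresp.
have rel := okubo_support_relation charF dimQ Bw nw phiE Dgr x1 y1 xy.
have [nz _ _] := support_relation_nz (okubo_mul0v charF alpha phiE)
  (okubo_mulv0 charF alpha phiE) rel.
have f0 := respects0 Dgr fresp.
have [|th th1] := @additive_ord K 0 (f 1).
  rewrite mulr2n (fresp _ _ _ rel) (_ : 1 + 1 = 0) //; exact: val_inj.
exists th; split=> [a _|th' th'E].
  by move: a; apply: Z2_ind; rewrite ?raddf0.
by apply: additive_ord_eq; rewrite th1 th'E.
Qed.

End FullOkubo.
(** * Gradings with an anisotropic odd component *)

Section StarGrading.

Variables (F : fieldType) (charF : 2%N \in [pchar F]).
Variables (Q : hurwitzAlg F) (dimQ : \dim {: Q} = 4%N).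
Variables (alpha : F) (alpha_neq0 : alpha != 0).

Local Notation B := (@qform F Q).
Local Notation cj := (@qconj F Q).
Local Notation "1q" := (hw_one Q).
Local Notation mulC := (@cd_mul F Q alpha).

Variables (phi : 'End(CD Q)) (w : Q).
Hypotheses (Bw : B w 1q = 1) (nw : nq w = 1).
Hypothesis phiE : forall a b, phi (a, b) = (a, w ** b).

Local Notation om := (okubo_mul alpha phi).

Variables (H : zmodType) (Gamma : H -> {vspace CD Q}).
Hypothesis Gamma_gr : okubo_grading alpha phi Gamma.

Let gr := okubo_qgrading charF dimQ alpha_neq0 Bw nw phiE Gamma_gr.

Variables (g : H) (b : Q).
Hypotheses (bg : ((0, b) : CD Q) \in Gamma g) (nb : nq b != 0) (gg : g + g = 0).

(** The norm of bu, and the Cayley-Dickson parameter when bu takes the place of u. *)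
Let beta := alpha * nq b.
Local Notation ub := ((0, b) : CD Q).

Let beta_neq0 : beta != 0. Proof. by rewrite mulf_neq0. Qed.

Let divb c : b ** ((nq b)^-1 *: (cj b ** c)) = c.
Proof. by rewrite qmulZr qmulK_conjl // scalerA mulVf // scale1r. Qed.

Lemma even_odd_full : (cd_even Q + cd_odd Q)%VS = fullv.
Proof.
apply/eqP; rewrite eqEsubv subvf; apply/subvP => -[a c] _.
have -> : (a, c) = (a, 0) + (0, c) :> CD Q by rewrite pairD addr0 add0r.
by rewrite memv_add //; [apply/even_pairP; exists a|apply/odd_pairP; exists c].
Qed.

Lemma main_up_to_equiv : g != 0 -> (forall a, ((a, 0) : CD Q) \in Gamma 0) ->
  is_up_to_equiv alpha phi Gamma (components [:: (0 : 'Z_2, cd_even Q); (1, cd_odd Q)]).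
Proof.
move=> g0 E0; set Delta := components _.
have D0 : Delta 0 = cd_even Q.
  by rewrite /Delta /components !big_cons big_nil /= addv0.
have D1 : Delta 1 = cd_odd Q.
  by rewrite /Delta /components !big_cons big_nil /= addv0.
have [|th th1] := @additive_ord H 0 g; first by rewrite mulr2n.
have [|||||Dgr] := full_transfer charF phiE (Delta := Delta) (theta := th)
    (s := [:: 0; 1]) Gamma_gr.
- by [].
- by apply: Z2_ind.
- apply: raddf_inj; apply: Z2_ind => //; rewrite th1 => g0'.
  by rewrite g0' eqxx in g0.
- apply: Z2_ind; rewrite ?D0 ?D1 ?raddf0 ?th1; apply/subvP => x.
    by case/even_pairP => a ->; apply: E0.
  case/odd_pairP => c ->; rewrite -(divb c) -(addr0 g).
  by apply: (odd_mul gr).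
- by rewrite big_cons big_seq1 D0 D1 even_odd_full.
apply; apply: (Z2_universal charF dimQ Bw nw phiE Dgr (x := ub) (y := ub)).
- by rewrite D1; apply/odd_pairP; exists b.
- by rewrite D1; apply/odd_pairP; exists b.
rewrite cd_mul_oo // qmul_conj // scalerA.
apply/eqP => -[/eqP]; rewrite scaler_eq0 (negPf (qone_neq0 dimQ)) orbF.
by rewrite (negPf beta_neq0).
Qed.

Variables (h : H) (w' j : Q).
Hypotheses (jh : ((j, 0) : CD Q) \in Gamma h) (nj : nq j != 0) (h0 : h != 0).
Hypotheses (hh : h + h = 0) (wb : w ** b = b ** w').
Hypotheses (w'0 : ((w', 0) : CD Q) \in Gamma 0) (Bw' : B w' 1q = 1) (nw' : nq w' = 1).

Definition starK : {vspace CD Q} := (<[cd_one Q]> + <[((w', 0%R) : CD Q)]>)%VS.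

Let sqr_w' : w' ** w' = w' + 1q.
Proof. by rewrite qsqr // Bw' nw' !scale1r. Qed.

Lemma starKP x : reflect (exists k l : F, x = (k *: 1q + l *: w', 0)) (x \in starK).
Proof.
apply: (iffP memv_addP) => [[_ /vlineP[k ->] [_ /vlineP[l ->] ->]]|[k [l ->]]].
  by exists k, l; rewrite /cd_one !pairZ pairD !scaler0 addr0.
exists (k *: cd_one Q); first exact: memvZ (memv_line _).
exists (l *: (w', 0)); first exact: memvZ (memv_line _).
by rewrite /cd_one !pairZ pairD !scaler0 addr0.
Qed.

Lemma starK_even : (starK <= cd_even Q)%VS.
Proof.
apply/subvP => x /starKP[k [l ->]]; apply/even_pairP.
by exists (k *: 1q + l *: w').
Qed.

Lemma star_quadratic : is_quadratic_subalgebra alpha starK (w', 0).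
Proof.
split=> //.
- exact: starK_even.
- have -> : starK = <<[:: cd_one Q; (w', 0%R)]>>%VS by rewrite span_cons span_seq1.
  apply/eqP; rewrite -[_ == _]/(free [:: cd_one Q; (w', 0)]) free_cons span_seq1.
  apply/andP; split; last first.
    rewrite free_cons span_nil nil_free andbT memv0.
    apply/eqP => -[w0]; move/eqP: Bw'; rewrite w0 qform0 eq_sym.
    by rewrite oner_eq0.
  apply/negP => /vlineP[k /(congr1 fst) /= e1].
  have := congr1 (B^~ 1q) e1; rewrite qform11 // qformZl Bw' mulr1 => k0.
  by have := qone_neq0 dimQ; rewrite e1 -k0 scale0r eqxx.
- move=> x y /starKP[k [l ->]] /starKP[m [n ->]]; apply/starKP.
  exists (k * m + l * n), (k * n + l * m + l * n).
  rewrite cd_mul_ee //; congr pair.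
  rewrite qmulDl !qmulDr !(qmulZl, qmulZr, qmul1, qmulx1) sqr_w' !scalerDr !scalerA.
  rewrite !scalerDl -!addrA; congr (_ + _).
  rewrite [RHS]addrCA; congr (_ + _); rewrite addrC -addrA addrC -!addrA.
  by congr (_ + _); rewrite addrC.
- rewrite cd_mul_ee // sqr_w' /cd_one !pairD !addr0.
  by rewrite -addrA (add2v charF).
Qed.

Lemma cd_rmulP (W : {vspace CD Q}) (u x : CD Q) :
  reflect (exists2 y, y \in W & x = mulC y u) (x \in cd_rmul alpha W u).
Proof.
have lin : linear (mulC^~ u).
  by move=> k x1 x2; rewrite cd_mulDl // cd_mulZl.
pose f : {linear CD Q -> CD Q} := HB.pack (mulC^~ u)
  (GRing.isLinear.Build F (CD Q) (CD Q) _ _ lin).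
have fE : linfun (mulC^~ u) =1 f by move=> a; rewrite (lfunE f).
apply: (iffP memv_imgP) => -[y yW ->]; exists y => //; exact: fE.
Qed.

(** Multiplying c by bu from the right gives (bc)u, and conj(bf)(bc) = q(b) conj(f) c by
    associativity, so [alpha] is replaced by [beta] in the product. *)
Lemma star_is_CD : is_CD_by alpha beta ub.
Proof.
have bD c d : mulC (d, 0) (0, b) = (0, b ** d) by rewrite cd_mul_eo.
split.
- apply/eqP; rewrite eqEsubv; apply/andP; split; apply/subvP => x.
    case/odd_pairP => c ->; apply/cd_rmulP; exists ((nq b)^-1 *: (cj b ** c), 0).
      by apply/even_pairP; eexists.
    by rewrite cd_mul_eo // divb.
  case/cd_rmulP => y /even_pairP[a ->] ->; rewrite cd_mul_eo //.
  by apply/odd_pairP; exists (b ** a).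
- move=> x y z t /even_pairP[a ->] /even_pairP[c ->] /even_pairP[d ->] /even_pairP[f ->].
  rewrite cd_conjE // cd_conjE // (cd_mul_eo charF alpha c b) (cd_mul_eo charF alpha f b).
  rewrite [(a, 0) + _]pairD [(d, 0) + _]pairD !addr0 !add0r cd_mulE //.
  rewrite !cd_mul_ee // [X in mulC X]pairD addr0 cd_mul_eo //.
  rewrite pairZ scaler0 (opp2v charF) !pairD !addr0 !add0r.
  congr pair; last by rewrite qmulDr !(qmulA charF dimQ).
  congr (_ + _); rewrite qconjM // -(qmulA charF dimQ) qmul_conjK // qmulZr.
  by rewrite scalerA.
- move=> x y /even_pairP[a ->] /even_pairP[c ->].
  rewrite cd_mul_eo // pairD addr0 add0r /cd_norm /= qnorm0 mulr0 addr0 qnormM.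
  by rewrite addr0 mulrA.
- rewrite cd_mul_oo // qmul_conj // scalerA /cd_one pairZ scaler0.
  by [].
Qed.

(** Passing from u to bu conjugates [w]: phi(bu) = (wb)u = (bw')u, which is the product of w' and
    bu. *)
Lemma star_star_data : star_data alpha phi starK (w', 0) ub.
Proof.
split; first exact: star_quadratic.
exists beta => //; split; first exact: star_is_CD.
  by move=> x /even_pairP[a ->]; rewrite phiE qmulx0.
by rewrite phiE wb cd_mul_eo.
Qed.

Let addr_neq0 (k : H) : k != 0 -> k + 0 != 0. Proof. by rewrite addr0. Qed.
Let j1 : B j 1q = 0.
Proof. exact: (even_form0 charF dimQ gr jh (even1 gr) (addr_neq0 h0)). Qed.
Let jw : B j w' = 0.
Proof. exact: (even_form0 charF dimQ gr jh w'0 (addr_neq0 h0)). Qed.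
Let wjh : ((w' ** j, 0) : CD Q) \in Gamma h.
Proof. by rewrite -(add0r h); apply: (even_mul gr). Qed.
Let wj1 : B (w' ** j) 1q = 0.
Proof. exact: (even_form0 charF dimQ gr wjh (even1 gr) (addr_neq0 h0)). Qed.
Let wjw : B (w' ** j) w' = 0.
Proof. exact: (even_form0 charF dimQ gr wjh w'0 (addr_neq0 h0)). Qed.

Lemma star_coord a :
  a = (B a w' *: 1q + B a 1q *: w') +
      ((nq j)^-1 * B a (w' ** j) *: j + (nq j)^-1 * B a j *: (w' ** j)).
Proof.
apply: (quaternion_coord charF dimQ Bw' j1 jw nj).
Qed.

(** Orthogonality is tested on a chosen basis of the plane; additivity in the second argument
    extends it to 1 and [w']. *)
Lemma even_perpP x :
  reflect (exists2 a, x = (a, 0) & B a 1q = 0 /\ B a w' = 0)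
          (x \in even_perp alpha starK).
Proof.
have lin (y : CD Q) : linear (polar (cd_norm alpha) ^~ y : CD Q -> F^o).
  case: y => c d k [a1 a2] [c1 c2]; rewrite pairZ pairD !cd_polarE //.
  rewrite !qformDl !qformZl /= scalerDr mulrDr addrACA.
  by congr (_ + _ + _); rewrite /GRing.scale /= mulrCA.
have inP y : (x \in lker (linfun (polar (cd_norm alpha) ^~ y : CD Q -> F^o))) =
    (polar (cd_norm alpha) x y == 0).
  pose f : {linear CD Q -> F^o} := HB.pack (polar (cd_norm alpha) ^~ y : CD Q -> F^o)
    (GRing.isLinear.Build F (CD Q) F^o _ _ (lin y)).
  by rewrite memv_ker -[linfun _]/(linfun f) lfunE.
have inS (s : seq (CD Q)) : (x \in (\bigcap_(y <- s)
     lker (linfun (polar (cd_norm alpha) ^~ y : CD Q -> F^o)))%VS) =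
    all (fun y => polar (cd_norm alpha) x y == 0) s.
  elim: s => [|y s IH]; first by rewrite big_nil memvf.
  by rewrite big_cons memv_cap inP IH.
rewrite /even_perp /perp memv_cap inS; apply: (iffP andP).
  case=> /allP xK /even_pairP[a xa]; exists a => //; rewrite xa in xK.
  have orth y : y \in starK -> polar (cd_norm alpha) (a, 0) y = 0.
    rewrite -(span_basis (vbasisP starK)).
    move: y; apply: span_ind => [|[c d] [c1 d1]|k [c d]|y /xK/eqP //].
    - by rewrite -[X in polar _ _ X]/((0, 0) : CD Q) cd_polarE // !qformx0 mulr0 addr0.
    - rewrite pairD !cd_polarE // !qform0 !mulr0 !addr0 qformDr => -> ->.
      by rewrite addr0.
    - by rewrite pairZ !cd_polarE // !qform0 !mulr0 !addr0 qformZr => ->; rewrite mulr0.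
  split.
    have := orth (cd_one Q); rewrite cd_polarE // qform0 mulr0 addr0; apply.
    by apply/starKP; exists 1, 0; rewrite scale1r scale0r addr0.
  have := orth (w', 0); rewrite cd_polarE // qform0 mulr0 addr0; apply.
  by apply/starKP; exists 0, 1; rewrite scale1r scale0r add0r.
case=> a -> [a1 aw]; split; last by apply/even_pairP; exists a.
apply/allP => y /vbasis_mem/starKP[k [l ->]].
rewrite cd_polarE // qform0 mulr0 addr0 qformDr !qformZr a1 aw !mulr0 addr0.
by [].
Qed.

Local Notation K := starK.
Local Notation P := (even_perp alpha starK).

Lemma star_even_full : (K + P)%VS = cd_even Q.
Proof.
apply/eqP; rewrite eqEsubv; apply/andP; split; apply/subvP => x.
  case/memv_addP => _ /starKP[k [l ->]] [_ /even_perpP[a -> _] ->].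
  by apply/even_pairP; eexists; rewrite pairD addr0.
case/even_pairP => a ->; rewrite (star_coord a).
move: (B a w') (B a 1q) (_ * _) (_ * _) => k l m n.
have -> : (k *: 1q + l *: w' + (n *: j + m *: (w' ** j)), 0) =
  (k *: 1q + l *: w', 0) + (n *: j + m *: (w' ** j), 0) :> CD Q.
  by rewrite pairD addr0.
apply: memv_add; first by apply/starKP; exists k, l.
apply/even_perpP; exists (n *: j + m *: (w' ** j)) => //.
by rewrite !qformDl !qformZl j1 wj1 jw wjw !mulr0 addr0.
Qed.

Lemma star_K_sub : (K <= Gamma 0)%VS.
Proof.
apply/subvP => x /starKP[k [l ->]]; apply: (qgr_evenD gr).
  exact: (qgr_evenZ gr _ (even1 gr)).
exact: (qgr_evenZ gr).
Qed.

Lemma star_P_sub : (P <= Gamma h)%VS.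
Proof.
apply/subvP => x /even_perpP[a -> [a1 aw]]; rewrite (star_coord a) a1 aw !scale0r.
rewrite !add0r; apply: (qgr_evenD gr).
  exact: (qgr_evenZ gr).
exact: (qgr_evenZ gr).
Qed.

Lemma star_rmul_sub (W : {vspace CD Q}) k : (W <= cd_even Q)%VS -> (W <= Gamma k)%VS ->
  (cd_rmul alpha W ub <= Gamma (g + k))%VS.
Proof.
move=> We Wk; apply/subvP => x /cd_rmulP[y yW ->].
have /even_pairP[a ya] := subvP We y yW.
rewrite ya cd_mul_eo //; apply: (odd_mul gr) => //.
by rewrite -ya; apply: (subvP Wk).
Qed.

Lemma star_P_even : (P <= cd_even Q)%VS.
Proof. exact: capvSr. Qed.

Lemma star_odd_full : (cd_rmul alpha K ub + cd_rmul alpha P ub)%VS = cd_odd Q.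
Proof.
by rewrite /cd_rmul -limgD star_even_full; case: star_is_CD.
Qed.

Lemma star_rmul_odd (W : {vspace CD Q}) : (W <= cd_even Q)%VS ->
  (cd_rmul alpha W ub <= cd_odd Q)%VS.
Proof.
move=> We; apply/subvP => x /cd_rmulP[y yW ->].
have /even_pairP[a ->] := subvP We y yW.
by rewrite cd_mul_eo //; apply/odd_pairP; exists (b ** a).
Qed.

Let S := star_grading alpha K ub.

Lemma star_gradingE :
  [/\ S (0, 0) = K, S (1, 0) = P, S (0, 1) = cd_rmul alpha K ub &
      S (1, 1) = cd_rmul alpha P ub].
Proof.
by split; rewrite /S /star_grading /components !big_cons big_nil /= ?addv0 ?add0v.
Qed.

Lemma Z22_ind (R : 'Z_2 * 'Z_2 -> Prop) :
  R (0, 0) -> R (1, 0) -> R (0, 1) -> R (1, 1) -> forall a, R a.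
Proof. by move=> R00 R10 R01 R11 [x y]; move: x y; do 2!(apply: Z2_ind => //). Qed.

Let Z22 : seq ('Z_2 * 'Z_2) := [:: (0, 0); (1, 0); (0, 1); (1, 1)].

Lemma star_full : (\sum_(a <- Z22) S a)%VS = fullv.
Proof.
have [S0 S1 S2 S3] := star_gradingE.
rewrite !big_cons big_nil S0 S1 S2 S3 addv0 addvA star_even_full star_odd_full.
exact: even_odd_full.
Qed.

Let jnz : mulC (j, 0) (j, 0) != 0.
Proof.
rewrite cd_mul_ee //; apply/eqP => -[/(congr1 (@hw_norm F Q))/eqP].
by rewrite qnormM qnorm0 mulf_eq0 (negPf nj).
Qed.

Let bnz : mulC (0, b) (0, b) != 0.
Proof.
rewrite cd_mul_oo // qmul_conj // scalerA; apply/eqP => -[/eqP].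
by rewrite scaler_eq0 (negPf (qone_neq0 dimQ)) orbF (negPf beta_neq0).
Qed.

Let jbnz : mulC (j, 0) (0, b) != 0.
Proof.
rewrite cd_mul_eo //; apply/eqP => -[/(congr1 (@hw_norm F Q))/eqP].
by rewrite qnormM qnorm0 mulf_eq0 (negPf nj) (negPf nb).
Qed.

Let jP : ((j, 0) : CD Q) \in P.
Proof. by apply/even_perpP; exists j. Qed.

Let bK : ub \in cd_rmul alpha K ub.
Proof.
apply/cd_rmulP; exists (cd_one Q); last by rewrite cd_mul_eo // qmulx1.
by apply/starKP; exists 1, 0; rewrite scale1r scale0r addr0.
Qed.

(** The squares of [j] and bu are nonzero, so both generators have order dividing 2; their product
    is nonzero of degree (1, 1), which ties that degree to the generators. *)
Lemma star_universal : okubo_grading alpha phi S -> universal_degree om S id.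
Proof.
move=> Sgr; apply: (universal_degree_id Sgr.1) => L f fresp.
have [S0 S1 S2 S3] := star_gradingE.
have c11 : (1 + 1 : 'Z_2) = 0 by apply: val_inj.
have rel x y p q : x \in S p -> y \in S q -> mulC x y != 0 ->
    support_relation om S p q (p + q).
  exact: (okubo_support_relation charF dimQ Bw nw phiE Sgr).
have rj : support_relation om S (1, 0) (1, 0) (0, 0).
  have -> : (0, 0) = (1, 0) + (1, 0) :> 'Z_2 * 'Z_2 by congr pair; apply: val_inj.
  by apply: (rel (j, 0) (j, 0)); rewrite ?S1.
have rb : support_relation om S (0, 1) (0, 1) (0, 0).
  have -> : (0, 0) = (0, 1) + (0, 1) :> 'Z_2 * 'Z_2 by congr pair; apply: val_inj.
  by apply: (rel ub ub); rewrite ?S2.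
have rjb : support_relation om S (1, 0) (0, 1) (1, 1).
  have -> : (1, 1) = (1, 0) + (0, 1) :> 'Z_2 * 'Z_2 by congr pair; apply: val_inj.
  by apply: (rel (j, 0) ub); rewrite ?S1 ?S2.
have f0 : f (0, 0) = 0 := respects0 charF dimQ Bw nw phiE Sgr fresp.
have [|t1 t1E] := @additive_ord L 0 (f (1, 0)); first by rewrite mulr2n (fresp _ _ _ rj).
have [|t2 t2E] := @additive_ord L 0 (f (0, 1)); first by rewrite mulr2n (fresp _ _ _ rb).
have [th thE] := additive_pair t1 t2.
have nzj := support_relation_nz (okubo_mul0v charF alpha phiE)
  (okubo_mulv0 charF alpha phiE) rjb.
exists th; split=> [a _|th' th'E].
  move: a; apply: Z22_ind; rewrite thE ?t1E ?t2E ?raddf0 ?addr0 ?add0r ?f0 //.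
  exact: fresp rjb.
have [f1 f1E] := additive_fst th'; have [f2 f2E] := additive_snd th'.
have [nz1 nz2 _] := nzj.
apply: additive_pair_eq => x; rewrite ?f1E ?f2E thE raddf0 ?addr0 ?add0r.
  by apply: additive_ord_eq; rewrite -f1E th'E // t1E.
by apply: additive_ord_eq; rewrite -f2E th'E // t2E.
Qed.

Lemma star_theta (G : zmodType) (k l : G) : k + k = 0 -> l + l = 0 ->
  exists theta : {additive 'Z_2 * 'Z_2 -> G}, theta (1, 0) = k /\ theta (0, 1) = l.
Proof.
move=> kk ll; have [|t1 t1E] := @additive_ord G 0 k; first by rewrite mulr2n.
have [|t2 t2E] := @additive_ord G 0 l; first by rewrite mulr2n.
have [th thE] := additive_pair t1 t2.
by exists th; rewrite !thE t1E t2E !raddf0 addr0 add0r.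
Qed.

Lemma star_sub (theta : {additive 'Z_2 * 'Z_2 -> H}) :
  theta (1, 0) = h -> theta (0, 1) = g -> forall a, (S a <= Gamma (theta a))%VS.
Proof.
move=> th1 th2; have [S0 S1 S2 S3] := star_gradingE; apply: Z22_ind.
- by rewrite S0 -[(0, 0)]/(0 : 'Z_2 * 'Z_2) raddf0 star_K_sub.
- by rewrite S1 th1 star_P_sub.
- by rewrite S2 th2 -(addr0 g) star_rmul_sub ?starK_even ?star_K_sub.
rewrite S3 (_ : (1, 1) = (0, 1) + (1, 0)); last by congr pair; apply: val_inj.
by rewrite raddfD th1 th2 star_rmul_sub ?star_P_even ?star_P_sub.
Qed.

(** The kernel of [theta] is trivial exactly because h, g and g + h are nonzero. *)
Lemma star_up_to_equiv : g != 0 -> g != h ->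
  is_up_to_equiv alpha phi Gamma S.
Proof.
move=> g0 gh; have [th [th1 th2]] := star_theta hh gg.
have [|||||Sgr] := full_transfer charF phiE (Delta := S) (theta := th)
    (s := Z22) Gamma_gr.
- by [].
- by apply: Z22_ind.
- apply: raddf_inj; apply: Z22_ind => //.
  + by rewrite th1 => /eqP; rewrite (negPf h0).
  + by rewrite th2 => /eqP; rewrite (negPf g0).
  rewrite (_ : (1, 1) = (0, 1) + (1, 0)); last by congr pair; apply: val_inj.
  rewrite raddfD th1 th2 => /eqP; rewrite addr_eq0 => /eqP gE.
  have hN : - h = h by apply/esym/eqP; rewrite -addr_eq0 hh.
  by rewrite gE hN eqxx in gh.
- exact: star_sub.
- exact: star_full.
by apply; apply: star_universal.
Qed.

Section Coarse.

Hypothesis g0 : g = 0.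

(** When g = 0, [Gamma] no longer separates [K] from its odd translate. Its refinement by parity
    does, with [j] in degree (h, 0) and bu in degree (0, 1). *)
Lemma star_okubo : okubo_grading alpha phi S.
Proof.
have hp : (h, 0) + (h, 0) = 0 :> H * 'Z_2 by congr pair; rewrite /= ?hh ?addr0.
have op : (0, 1) + (0, 1) = 0 :> H * 'Z_2.
  by congr pair; [exact: addr0|apply: val_inj].
have [th [th1 th2]] := star_theta hp op.
have [S0 S1 S2 S3] := star_gradingE.
have RK : (K <= refined Gamma 0%R)%VS.
  by rewrite subv_cap star_K_sub starK_even.
have RP : (P <= refined Gamma (h, 0%R))%VS.
  by rewrite subv_cap star_P_sub star_P_even.
have RKb : (cd_rmul alpha K ub <= refined Gamma (0%R, 1%R))%VS.
  rewrite subv_cap /= star_rmul_odd ?starK_even // andbT.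
  by have := star_rmul_sub starK_even star_K_sub; rewrite g0 addr0.
have RPb : (cd_rmul alpha P ub <= refined Gamma (h, 1%R))%VS.
  rewrite subv_cap /= star_rmul_odd ?star_P_even // andbT.
  by have := star_rmul_sub star_P_even star_P_sub; rewrite g0 add0r.
have th11 : th (1, 1) = (h, 1).
  rewrite (_ : (1, 1) = (1, 0) + (0, 1)); last by congr pair; apply: val_inj.
  by rewrite raddfD th1 th2; congr pair; rewrite /= ?addr0 ?add0r.
have [|||||//] := full_transfer charF phiE (Delta := S) (theta := th) (s := Z22)
  (refined_grading charF phiE Gamma_gr).
- by [].
- by apply: Z22_ind.
- apply: raddf_inj; apply: Z22_ind => //.
  + by rewrite th1 => -[/eqP]; rewrite (negPf h0).
  + by rewrite th2.
  by rewrite th11.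
- apply: Z22_ind.
  + by rewrite S0 -[(0, 0)]/(0 : 'Z_2 * 'Z_2) raddf0.
  + by rewrite S1 th1.
  + by rewrite S2 th2.
  + by rewrite S3 th11.
exact: star_full.
Qed.

Definition star_coarse : 'Z_2 -> {vspace CD Q} :=
  components [:: (0 : 'Z_2, (K + cd_rmul alpha K ub)%VS);
                 (1, (P + cd_rmul alpha P ub)%VS)].

Lemma star_coarseE : star_coarse 0 = (K + cd_rmul alpha K ub)%VS /\
  star_coarse 1 = (P + cd_rmul alpha P ub)%VS.
Proof. by split; rewrite /star_coarse /components !big_cons big_nil /= addv0. Qed.

Lemma star_coarsening : coarsening star_coarse S.
Proof.
have [S0 S1 S2 S3] := star_gradingE; have [D0 D1] := star_coarseE.
apply: Z22_ind; rewrite ?S0 ?S1 ?S2 ?S3.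
- by exists 0; rewrite D0 addvSl.
- by exists 1; rewrite D1 addvSl.
- by exists 0; rewrite D0 addvSr.
- by exists 1; rewrite D1 addvSr.
Qed.

Lemma star_coarse_up_to_equiv : is_up_to_equiv alpha phi Gamma star_coarse.
Proof.
have [D0 D1] := star_coarseE.
have [|th th1] := @additive_ord H 0 h; first by rewrite mulr2n.
have [|||||Dgr] := full_transfer charF phiE (Delta := star_coarse) (theta := th)
    (s := [:: 0; 1]) Gamma_gr.
- by [].
- by apply: Z2_ind.
- by apply: raddf_inj; apply: Z2_ind => //; rewrite th1 => /eqP; rewrite (negPf h0).
- have KS := star_rmul_sub starK_even star_K_sub.
  have PS := star_rmul_sub star_P_even star_P_sub.
  rewrite g0 !add0r in KS PS.
  apply: Z2_ind; rewrite ?D0 ?D1 ?raddf0 ?th1 subv_add.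
    by rewrite star_K_sub KS.
  by rewrite star_P_sub PS.
- rewrite big_cons big_seq1 D0 D1 Monoid.mulmACA /= star_even_full star_odd_full.
  exact: even_odd_full.
apply; apply: (Z2_universal charF dimQ Bw nw phiE Dgr (x := (j, 0)) (y := (j, 0))).
- by rewrite D1; apply: (subvP (addvSl _ _)).
- by rewrite D1; apply: (subvP (addvSl _ _)).
exact: jnz.
Qed.

End Coarse.

End StarGrading.

(** * The target gradings with a canonical basis *)

Section Targets.

Variables (F : fieldType) (charF : 2%N \in [pchar F]).
Variables (Q : hurwitzAlg F) (dimQ : \dim {: Q} = 4%N).
Variables (alpha : F) (alpha_neq0 : alpha != 0).

Local Notation B := (@qform F Q).
Local Notation "1q" := (hw_one Q).

Variables (phi : 'End(CD Q)) (w : Q).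
Hypotheses (Bw : B w 1q = 1) (nw : nq w = 1).
Hypothesis phiE : forall a b, phi (a, b) = (a, w ** b).

Variables (H : zmodType) (Gamma : H -> {vspace CD Q}).
Hypothesis Gamma_gr : okubo_grading alpha phi Gamma.

Variables (g h : H) (e b1 b2 d1 d2 : Q).
Hypothesis hf :
  homog_frame alpha (fun g b => ((0, b) : CD Q) \in Gamma g) g h e b1 b2 d1 d2.

Local Notation e1 := (can_e1 e).
Local Notation e2 := (can_e2 e).
Local Notation u := (can_u alpha b1 b2 d1 d2).
Local Notation v := (can_v alpha b1 b2 d1 d2).

Let key := cartan_up_to_equiv charF dimQ alpha_neq0 Bw nw phiE Gamma_gr hf.

(** The nine conditions say that 0, g, h, g + h and their opposites are seven distinct elements of
    [H]. *)
Lemma up_to_equiv_int2 :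
  g != 0 -> h != 0 -> g + h != 0 -> g + g != 0 -> h + h != 0 ->
  g + h + (g + h) != 0 -> g - h != 0 -> g + g + h != 0 -> g + h + h != 0 ->
  is_up_to_equiv alpha phi Gamma (components
       [:: ((0, 0) : int * int, <<[:: e1; e2]>>%VS);
           ((1, 1), <[v 3]>%VS); ((-1, -1), <[u 3]>%VS);
           ((1, 0), <[u 1]>%VS); ((-1, 0), <[v 1]>%VS);
           ((0, 1), <[u 2]>%VS); ((0, -1), <[v 2]>%VS)]).
Proof.
move=> n1 n2 n3 n4 n5 n6 n7 n8 n9; have [th [th1 th2]] := additive_int2 g h.
rewrite -!span_seq1.
apply: (key (a1 := (1, 0)) (a2 := (0, 1)) (a3 := (-1, -1)) (n1 := (-1, 0))
  (n2 := (0, -1)) (n3 := (1, 1)) (theta := th)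
  (L := [:: ((0, 0), [:: e1; e2]); ((1, 1), [:: v 3]); ((-1, -1), [:: u 3]);
    ((1, 0), [:: u 1]); ((-1, 0), [:: v 1]); ((0, 1), [:: u 2]); ((0, -1), [:: v 2])])
  (idx := [:: 0; 1; 7; 4; 2; 5; 3; 6]%N)
  (C := [:: (1, 0); (0, 1); (1, 0) + (0, 1); (1, 0) + (1, 0); (0, 1) + (0, 1);
     (1, 0) + (0, 1) + ((1, 0) + (0, 1)); (1, 0) - (0, 1);
     (1, 0) + (1, 0) + (0, 1); (1, 0) + (0, 1) + (0, 1)])) => //.
- by rewrite /= !(raddfB, raddfD) th1 th2 n1 n2 n3 n4 n5 n6 n7 n8 n9.
- exact: int2_presented.
Qed.

Lemma up_to_equiv_int_4a : g + h = 0 -> g != 0 -> g + g != 0 ->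
  is_up_to_equiv alpha phi Gamma (components
        [:: (0 : int, <<[:: e1; e2; u 3; v 3]>>%VS);
            (1, <<[:: u 1; v 2]>>%VS); (-1, <<[:: u 2; v 1]>>%VS)]).
Proof.
move=> gh n1 n2; have [th th1] := additive_int g.
apply: (key (a1 := 1) (a2 := -1) (a3 := 0) (n1 := -1) (n2 := 1) (n3 := 0)
  (theta := th)
  (L := [:: (0, [:: e1; e2; u 3; v 3]); (1, [:: u 1; v 2]); (-1, [:: u 2; v 1])])
  (idx := [:: 0; 1; 4; 7; 2; 6; 3; 5]%N) (C := [:: 1; 1 + 1])) => //.
- by rewrite -[X in th X]/(- 1 : int) raddfN th1; apply: addr0_eq.
- by rewrite /= raddfD th1 n1 n2.
- exact: int_presented_1N1.
Qed.

Lemma up_to_equiv_int_4b : g = 0 -> h != 0 -> h + h != 0 ->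
  is_up_to_equiv alpha phi Gamma (components
        [:: (0 : int, <<[:: e1; e2; u 1; v 1]>>%VS);
            (1, <<[:: u 3; v 2]>>%VS); (-1, <<[:: u 2; v 3]>>%VS)]).
Proof.
(* The displayed grading has u_2 in degree -1, so 1 must be sent to - h. *)
move=> g0 n1 n2; have [th th1] := additive_int (- h).
apply: (key (a1 := 0) (a2 := -1) (a3 := 1) (n1 := 0) (n2 := 1) (n3 := -1)
  (theta := th)
  (L := [:: (0, [:: e1; e2; u 1; v 1]); (1, [:: u 3; v 2]); (-1, [:: u 2; v 3])])
  (idx := [:: 0; 1; 2; 5; 4; 6; 3; 7]%N) (C := [:: 1; 1 + 1])) => //.
- by rewrite raddf0.
- by rewrite -[X in th X]/(- 1 : int) raddfN th1 opprK.
- by rewrite /= raddfD th1 -opprD !oppr_eq0 n1 n2.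
- exact: int_presented_0N1.
Qed.

Lemma up_to_equiv_int_5a : g = h -> g != 0 -> g + g != 0 -> g + g + g != 0 ->
  g + g + (g + g) != 0 ->
  is_up_to_equiv alpha phi Gamma (components
        [:: (0 : int, <<[:: e1; e2]>>%VS);
            (1, <<[:: u 1; u 2]>>%VS); (2, <[v 3]>%VS);
            (-1, <<[:: v 1; v 2]>>%VS); (-2, <[u 3]>%VS)]).
Proof.
move=> gh n1 n2 n3 n4; have [th th1] := additive_int g.
rewrite -!span_seq1.
apply: (key (a1 := 1) (a2 := 1) (a3 := -2) (n1 := -1) (n2 := -1) (n3 := 2)
  (theta := th)
  (L := [:: (0, [:: e1; e2]); (1, [:: u 1; u 2]); (2, [:: v 3]);
     (-1, [:: v 1; v 2]); (-2, [:: u 3])])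
  (idx := [:: 0; 1; 2; 3; 7; 5; 6; 4]%N)
  (C := [:: 1; 1 + 1; 1 + 1 + 1; 1 + 1 + (1 + 1)])) => //.
- by rewrite -gh.
- by rewrite /= !raddfD th1 n1 n2 n3 n4.
- exact: int_presented_11.
Qed.

Lemma up_to_equiv_int_5b : g + h + h = 0 -> h != 0 -> h + h != 0 ->
  h + h + h != 0 -> h + h + (h + h) != 0 ->
  is_up_to_equiv alpha phi Gamma (components
        [:: (0 : int, <<[:: e1; e2]>>%VS);
            (1, <<[:: u 3; u 2]>>%VS); (2, <[v 1]>%VS);
            (-1, <<[:: v 3; v 2]>>%VS); (-2, <[u 1]>%VS)]).
Proof.
move=> gh n1 n2 n3 n4; have [th th1] := additive_int h.
rewrite -!span_seq1.
apply: (key (a1 := -2) (a2 := 1) (a3 := 1) (n1 := 2) (n2 := -1) (n3 := -1)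
  (theta := th)
  (L := [:: (0, [:: e1; e2]); (1, [:: u 3; u 2]); (2, [:: v 1]);
     (-1, [:: v 3; v 2]); (-2, [:: u 1])])
  (idx := [:: 0; 1; 4; 3; 5; 7; 6; 2]%N)
  (C := [:: 1; 1 + 1; 1 + 1 + 1; 1 + 1 + (1 + 1)])) => //.
- rewrite -[X in th X]/(- (1 + 1) : int) raddfN raddfD th1.
  by apply: addr0_eq; rewrite addrC addrA.
- by rewrite /= !raddfD th1 n1 n2 n3 n4.
- exact: int_presented_N21.
Qed.

Lemma up_to_equiv_Z3 : g = h -> g != 0 -> g + g + g = 0 ->
  is_up_to_equiv alpha phi Gamma (components
       [:: (0 : 'Z_3, <<[:: e1; e2]>>%VS);
           (1, <<[:: u 1; u 2; u 3]>>%VS); (2, <<[:: v 1; v 2; v 3]>>%VS)]).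
Proof.
move=> gh n1 n3; have [|th th1] := @additive_ord H 1 g.
  by rewrite !mulrS mulr0n addr0 addrA.
apply: (key (a1 := 1) (a2 := 1) (a3 := 1) (n1 := 2) (n2 := 2) (n3 := 2)
  (theta := th)
  (L := [:: (0, [:: e1; e2]); (1, [:: u 1; u 2; u 3]); (2, [:: v 1; v 2; v 3])])
  (idx := [:: 0; 1; 2; 3; 4; 5; 6; 7]%N) (C := [:: 1])) => //;
  try exact: val_inj.
- by rewrite -gh.
- by rewrite /= th1 n1.
- exact: Z3_presented.
Qed.

Lemma up_to_equiv_Z4_7a : g = h -> g != 0 -> g + g != 0 -> g + g + (g + g) = 0 ->
  is_up_to_equiv alpha phi Gamma (components
        [:: (0 : 'Z_4, <<[:: e1; e2]>>%VS); (1, <<[:: u 1; u 2]>>%VS);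
            (2, <<[:: u 3; v 3]>>%VS); (3, <<[:: v 1; v 2]>>%VS)]).
Proof.
move=> gh n1 n2 n4; have [|th th1] := @additive_ord H 2 g.
  by rewrite (mulrnDr _ 2 2) !mulr2n.
apply: (key (a1 := 1) (a2 := 1) (a3 := 2) (n1 := 3) (n2 := 3) (n3 := 2)
  (theta := th)
  (L := [:: (0, [:: e1; e2]); (1, [:: u 1; u 2]); (2, [:: u 3; v 3]);
     (3, [:: v 1; v 2])])
  (idx := [:: 0; 1; 2; 3; 4; 7; 5; 6]%N) (C := [:: 1; 1 + 1])) => //;
  try exact: val_inj.
- by rewrite -gh.
- by rewrite /= raddfD th1 n1 n2.
- exact: Z4_presented_11.
Qed.

Lemma up_to_equiv_Z4_7b : g + h + h = 0 -> g + g = 0 -> h != 0 -> h + h != 0 ->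
  is_up_to_equiv alpha phi Gamma (components
        [:: (0 : 'Z_4, <<[:: e1; e2]>>%VS); (1, <<[:: u 2; u 3]>>%VS);
            (2, <<[:: u 1; v 1]>>%VS); (3, <<[:: v 2; v 3]>>%VS)]).
Proof.
move=> ghh gg n1 n2.
have hE : h + h = - g by apply/esym/addr0_eq; rewrite addrA.
have gN : - g = g by apply: addr0_eq.
have [|th th1] := @additive_ord H 2 h.
  by rewrite (mulrnDr _ 2 2) !mulr2n hE gN.
apply: (key (a1 := 2) (a2 := 1) (a3 := 1) (n1 := 2) (n2 := 3) (n3 := 3)
  (theta := th)
  (L := [:: (0, [:: e1; e2]); (1, [:: u 2; u 3]); (2, [:: u 1; v 1]);
     (3, [:: v 2; v 3])])
  (idx := [:: 0; 1; 3; 4; 2; 5; 6; 7]%N) (C := [:: 1; 1 + 1])) => //;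
  try exact: val_inj.
- rewrite (_ : 2 = 1 + 1); last exact: val_inj.
  by rewrite raddfD th1 hE gN.
- by rewrite /= raddfD th1 n1 n2.
- exact: Z4_presented_21.
Qed.

Let pairZ2 (x : int) (y z : 'Z_2) : val y = val z -> (x, y) = (x, z).
Proof. by move=> yz; congr pair; apply: val_inj. Qed.

Lemma up_to_equiv_intZ2_8a : g + g = 0 -> g != 0 -> h != 0 -> h + h != 0 ->
  g + h != 0 -> g + h + h != 0 ->
  is_up_to_equiv alpha phi Gamma (components
        [:: ((0, 0) : int * 'Z_2, <<[:: e1; e2]>>%VS);
            ((1, 0), <[u 2]>%VS); ((-1, 0), <[v 2]>%VS);
            ((0, 1), <<[:: u 1; v 1]>>%VS);
            ((-1, 1), <[u 3]>%VS); ((1, 1), <[v 3]>%VS)]).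
Proof.
move=> gg n1 n2 n3 n4 n5; have [|th [th2 th1]] := @additive_int_ord 0 H h g.
  by rewrite mulr2n.
rewrite -!span_seq1.
apply: (key (a1 := (0, 1)) (a2 := (1, 0)) (a3 := (-1, 1)) (n1 := (0, 1))
  (n2 := (-1, 0)) (n3 := (1, 1)) (theta := th)
  (L := [:: ((0, 0), [:: e1; e2]); ((1, 0), [:: u 2]); ((-1, 0), [:: v 2]);
     ((0, 1), [:: u 1; v 1]); ((-1, 1), [:: u 3]); ((1, 1), [:: v 3])])
  (idx := [:: 0; 1; 3; 6; 2; 5; 4; 7]%N)
  (C := [:: (0, 1); (1, 0); (1, 0) + (1, 0); (0, 1) + (1, 0);
     (0, 1) + (1, 0) + (1, 0)])) => //; try exact: pairZ2.
- by rewrite /= !raddfD th1 th2 n1 n2 n3 n4 n5.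
- exact: intZ2_presented_a.
Qed.

(** The torsion generator goes to g + h, the degree of v_3, and g = (g + h) - h gives u_1 the degree
    (-1, 1). *)
Lemma up_to_equiv_intZ2_8b : g + h + (g + h) = 0 -> h != 0 -> h + h != 0 ->
  g + h != 0 -> g + h + h != 0 -> g + h + h + h != 0 ->
  is_up_to_equiv alpha phi Gamma (components
        [:: ((0, 0) : int * 'Z_2, <<[:: e1; e2]>>%VS);
            ((1, 0), <[u 2]>%VS); ((-1, 0), <[v 2]>%VS);
            ((0, 1), <<[:: u 3; v 3]>>%VS);
            ((-1, 1), <[u 1]>%VS); ((1, 1), <[v 1]>%VS)]).
Proof.
move=> gg n1 n2 n3 n4 n5; have [|th [th2 th1]] := @additive_int_ord 0 H h (g + h).
  by rewrite mulr2n.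
rewrite -!span_seq1.
apply: (key (a1 := (-1, 1)) (a2 := (1, 0)) (a3 := (0, 1)) (n1 := (1, 1))
  (n2 := (-1, 0)) (n3 := (0, 1)) (theta := th)
  (L := [:: ((0, 0), [:: e1; e2]); ((1, 0), [:: u 2]); ((-1, 0), [:: v 2]);
     ((0, 1), [:: u 3; v 3]); ((-1, 1), [:: u 1]); ((1, 1), [:: v 1])])
  (idx := [:: 0; 1; 3; 6; 4; 7; 2; 5]%N)
  (C := [:: (0, 1); (1, 0); (1, 0) + (1, 0); (0, 1) + (1, 0);
     (0, 1) + (1, 0) + (1, 0)])) => //; try exact: pairZ2.
- rewrite (_ : (-1, 1) = (0, 1) - (1, 0)) ?raddfB ?th1 ?th2 ?addrK //.
  exact: pairZ2.
- by rewrite /= !raddfD th1 th2 n1 n2 n3 n4 n5.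
- exact: intZ2_presented_b.
Qed.

End Targets.

(** * Assembling the classification from the coincidences among degrees *)

Theorem theorem37 (F : fieldType) (charF : 2%N \in [pchar F])
    (Q : hurwitzAlg F) (dimQ : \dim {: Q} = 4%N)
    (alpha : F) (alpha_neq0 : alpha != 0)
    (phi : 'End(CD Q)) (phi_aut : cd_automorphism alpha phi)
    (phi_neq1 : phi != \1%VF) (phi3 : forall x, phi (phi (phi x)) = x)
    (phiQ : forall a : Q, phi (a, 0) = (a, 0))
    (H : zmodType) (Gamma : H -> {vspace CD Q})
    (Gamma_gr : okubo_grading alpha phi Gamma)
    (Gamma_nt : ~ trivial_grading Gamma) :
  (* (1) *)
  (exists K w u, star_data alpha phi K w u /\
     is_up_to_equiv alpha phi Gamma (star_grading alpha K u))
  \/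
  (* (2) *)
  (is_up_to_equiv alpha phi Gamma
     (components [:: (0 : 'Z_2, cd_even Q); (1, cd_odd Q)])
   \/
   exists K w u, star_data alpha phi K w u /\
     let Delta := components
       [:: (0 : 'Z_2, (K + cd_rmul alpha K u)%VS);
           (1, (even_perp alpha K + cd_rmul alpha (even_perp alpha K) u)%VS)] in
     [/\ okubo_grading alpha phi (star_grading alpha K u),
         coarsening Delta (star_grading alpha K u) &
         is_up_to_equiv alpha phi Gamma Delta])
  \/
  (exists e1 e2 u v,
    [/\ even_part_split Q alpha, adapted_basis alpha e1 e2 u v &
    (* (3) *)
    (is_tau_omega e1 e2 u v phi /\
     is_up_to_equiv alpha phi Gamma (components
       [:: ((0, 0) : int * int, <<[:: e1; e2]>>%VS);
           ((1, 1), <[v 3]>%VS); ((-1, -1), <[u 3]>%VS);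
           ((1, 0), <[u 1]>%VS); ((-1, 0), <[v 1]>%VS);
           ((0, 1), <[u 2]>%VS); ((0, -1), <[v 2]>%VS)]))
    \/
    (* (4) *)
    (is_tau_omega e1 e2 u v phi /\
     (is_up_to_equiv alpha phi Gamma (components
        [:: (0 : int, <<[:: e1; e2; u 3; v 3]>>%VS);
            (1, <<[:: u 1; v 2]>>%VS); (-1, <<[:: u 2; v 1]>>%VS)])
      \/
      is_up_to_equiv alpha phi Gamma (components
        [:: (0 : int, <<[:: e1; e2; u 1; v 1]>>%VS);
            (1, <<[:: u 3; v 2]>>%VS); (-1, <<[:: u 2; v 3]>>%VS)])))
    \/
    (* (5) *)
    ((is_tau_nst e1 e2 u v phi /\
      is_up_to_equiv alpha phi Gamma (components
        [:: (0 : int, <<[:: e1; e2]>>%VS);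
            (1, <<[:: u 1; u 2]>>%VS); (2, <[v 3]>%VS);
            (-1, <<[:: v 1; v 2]>>%VS); (-2, <[u 3]>%VS)]))
     \/
     (is_tau_omega e1 e2 u v phi /\
      is_up_to_equiv alpha phi Gamma (components
        [:: (0 : int, <<[:: e1; e2]>>%VS);
            (1, <<[:: u 3; u 2]>>%VS); (2, <[v 1]>%VS);
            (-1, <<[:: v 3; v 2]>>%VS); (-2, <[u 1]>%VS)])))
    \/
    (* (6) *)
    (is_tau_nst e1 e2 u v phi /\
     is_up_to_equiv alpha phi Gamma (components
       [:: (0 : 'Z_3, <<[:: e1; e2]>>%VS);
           (1, <<[:: u 1; u 2; u 3]>>%VS); (2, <<[:: v 1; v 2; v 3]>>%VS)]))
    \/
    (* (7) *)
    ((is_tau_nst e1 e2 u v phi /\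
      is_up_to_equiv alpha phi Gamma (components
        [:: (0 : 'Z_4, <<[:: e1; e2]>>%VS); (1, <<[:: u 1; u 2]>>%VS);
            (2, <<[:: u 3; v 3]>>%VS); (3, <<[:: v 1; v 2]>>%VS)]))
     \/
     (is_tau_omega e1 e2 u v phi /\
      is_up_to_equiv alpha phi Gamma (components
        [:: (0 : 'Z_4, <<[:: e1; e2]>>%VS); (1, <<[:: u 2; u 3]>>%VS);
            (2, <<[:: u 1; v 1]>>%VS); (3, <<[:: v 2; v 3]>>%VS)])))
    \/
    (* (8) *)
    (is_tau_omega e1 e2 u v phi /\
     (is_up_to_equiv alpha phi Gamma (components
        [:: ((0, 0) : int * 'Z_2, <<[:: e1; e2]>>%VS);
            ((1, 0), <[u 2]>%VS); ((-1, 0), <[v 2]>%VS);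
            ((0, 1), <<[:: u 1; v 1]>>%VS);
            ((-1, 1), <[u 3]>%VS); ((1, 1), <[v 3]>%VS)])
      \/
      is_up_to_equiv alpha phi Gamma (components
        [:: ((0, 0) : int * 'Z_2, <<[:: e1; e2]>>%VS);
            ((1, 0), <[u 2]>%VS); ((-1, 0), <[v 2]>%VS);
            ((0, 1), <<[:: u 3; v 3]>>%VS);
            ((-1, 1), <[u 1]>%VS); ((1, 1), <[v 1]>%VS)])))]).
Proof.
have [w [Bw nw phiE]] :=
  automorphism_odd_mul charF dimQ alpha_neq0 phi_aut phi_neq1 phi3 phiQ.
have gr := okubo_qgrading charF dimQ alpha_neq0 Bw nw phiE Gamma_gr.
have [] := qgrading_cases charF dimQ alpha_neq0 Bw nw gr.
- case=> E0 N0; apply: Gamma_nt; apply/eqP; rewrite /trivial_grading eqEsubv subvf.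
  apply/subvP => -[a b] _.
  have -> : (a, b) = (a, 0) + (0, b) :> CD Q by rewrite pairD addr0 add0r.
  by rewrite rpredD.
- case=> g [b [bg nb g0 gg E0]]; right; left; left.
  exact: (main_up_to_equiv charF dimQ alpha_neq0 Bw nw phiE Gamma_gr bg nb gg g0 E0).
- case=> g [h [b [w' [j [[bg nb gg gh] [jh nj h0 hh] [wb w'0 Bw' nw']]]]]].
  have data := star_star_data charF dimQ alpha_neq0 phiE nb wb Bw' nw'.
  (* With g and h distinct and h nonzero, the degree g decides between four components and the
     coarsening. *)
  have [g0|g0] := eqVneq g 0; last first.
    left; exists (starK w'), (w', 0), (0, b); split=> //.
    exact: (star_up_to_equiv charF dimQ alpha_neq0 Bw nw phiE Gamma_gr bg nb gg
      jh nj h0 hh w'0 Bw' g0 gh).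
  right; left; right; exists (starK w'), (w', 0), (0, b); split=> //=; split.
  + exact: (star_okubo charF dimQ alpha_neq0 Bw nw phiE Gamma_gr bg nb
      jh nj h0 hh w'0 Bw' g0).
  + exact: (star_coarsening alpha b w').
  + exact: (star_coarse_up_to_equiv charF dimQ alpha_neq0 Bw nw phiE Gamma_gr bg nb
      jh nj h0 hh w'0 Bw' g0).
- case=> om [g [h [e [b1 [b2 [d1 [d2 [hf omE wb1 wb2 [hh gh]]]]]]]]].
  have h0 : h != 0 by apply: contraNneq hh => ->; rewrite addr0.
  (* Stated for an arbitrary frame over [e], because one subcase exchanges the two basis vectors. *)
  have omega_case (g' h' : H) (om' : F) c1 c2 f1 f2 :
      homog_frame alpha (fun g b => ((0, b) : CD Q) \in Gamma g) g' h' e c1 c2 f1 f2 ->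
      om' ^+ 2 + om' + 1 = 0 -> w ** c1 = om' *: c1 -> w ** c2 = om' ^+ 2 *: c2 ->
      [/\ even_part_split Q alpha,
        adapted_basis alpha (can_e1 e) (can_e2 e) (can_u alpha c1 c2 f1 f2)
          (can_v alpha c1 c2 f1 f2) &
        is_tau_omega (can_e1 e) (can_e2 e) (can_u alpha c1 c2 f1 f2)
          (can_v alpha c1 c2 f1 f2) phi].
    case=> fr _ omE' wc1 wc2; split.
    - exact: (frame_split charF dimQ fr).
    - exact: (frame_adapted charF dimQ fr).
    - exact: (frame_tau_omega charF dimQ fr nw phiE omE' wc1 wc2).
  have [split adapted tau] := omega_case _ _ _ _ _ _ _ hf omE wb1 wb2.
  right; right.
  (* Already 2h and g - h are nonzero. The remaining possible coincidences are g = 0, 2g = 0, g + h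
     = 0, g + 2h = 0, 2g + h = 0 and 2(g + h) = 0. *)
  have [gg|gg] := eqVneq (g + g) 0.
    have gN : - g = g by apply: addr0_eq.
    have [g0|g0] := eqVneq g 0.
      exists (can_e1 e), (can_e2 e), (can_u alpha b1 b2 d1 d2), (can_v alpha b1 b2 d1 d2).
      split=> //; right; left; split=> //; right.
      exact: (up_to_equiv_int_4b charF dimQ alpha_neq0 Bw nw phiE Gamma_gr hf g0 h0 hh).
    exists (can_e1 e), (can_e2 e), (can_u alpha b1 b2 d1 d2), (can_v alpha b1 b2 d1 d2).
    split=> //; do 4!right.
    have [ghh|ghh] := eqVneq (g + h + h) 0.
      left; right; split=> //.
      exact: (up_to_equiv_Z4_7b charF dimQ alpha_neq0 Bw nw phiE Gamma_gr hf ghh gg h0 hh).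
    right; split=> //; left.
    apply: (up_to_equiv_intZ2_8a charF dimQ alpha_neq0 Bw nw phiE Gamma_gr hf) => //.
    by apply: contraNneq gh => /addr0_eq <-; rewrite gN.
  have g0 : g != 0 by apply: contraNneq gg => ->; rewrite addr0.
  have [gNh|gNh] := eqVneq (g + h) 0.
    exists (can_e1 e), (can_e2 e), (can_u alpha b1 b2 d1 d2), (can_v alpha b1 b2 d1 d2).
    split=> //; right; left; split=> //; left.
    exact: (up_to_equiv_int_4a charF dimQ alpha_neq0 Bw nw phiE Gamma_gr hf gNh g0 gg).
  have [ghh|ghh] := eqVneq (g + h + h) 0.
    exists (can_e1 e), (can_e2 e), (can_u alpha b1 b2 d1 d2), (can_v alpha b1 b2 d1 d2).
    have hE : h + h = - g by apply/esym/addr0_eq; rewrite addrA.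
    split=> //; do 2!right; left; right; split=> //.
    apply: (up_to_equiv_int_5b charF dimQ alpha_neq0 Bw nw phiE Gamma_gr hf) => //.
      by rewrite hE addrC subr_eq0 eq_sym.
    by rewrite hE -opprD oppr_eq0.
  (* Symmetric to the previous case after swapping the frame; omega is then replaced by its square,
     whose square is omega again. *)
  have [ggh|ggh] := eqVneq (g + g + h) 0.
    have hf' : homog_frame alpha (fun g b => ((0, b) : CD Q) \in Gamma g) h g
        e b2 b1 d2 d1.
      by case: hf => fr []; split=> //; apply: frame_swap.
    have om2 : om ^+ 2 = om + 1.
      by apply/eqP; rewrite -subr_eq0 (opp2f charF) addrA omE.
    have om4 : (om ^+ 2) ^+ 2 = om.
      rewrite {1}om2 sqrrD1 mulr2n (add2f charF) addr0 om2 -addrA (add2f charF).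
      by rewrite addr0.
    have omE' : (om ^+ 2) ^+ 2 + om ^+ 2 + 1 = 0 by rewrite om4 [om + _]addrC omE.
    have wb1' : w ** b1 = (om ^+ 2) ^+ 2 *: b1 by rewrite om4.
    have [split' adapted' tau'] := omega_case _ _ _ _ _ _ _ hf' omE' wb2 wb1'.
    exists (can_e1 e), (can_e2 e), (can_u alpha b2 b1 d2 d1), (can_v alpha b2 b1 d2 d1).
    have gE : g + g = - h by apply/esym/addr0_eq; rewrite addrC.
    split=> //; do 2!right; left; right; split=> //.
    apply: (up_to_equiv_int_5b charF dimQ alpha_neq0 Bw nw phiE Gamma_gr hf') => //.
    + by rewrite -addrA addrC.
    + by rewrite gE addrC subr_eq0.
    + by rewrite gE -opprD oppr_eq0.
  exists (can_e1 e), (can_e2 e), (can_u alpha b1 b2 d1 d2), (can_v alpha b1 b2 d1 d2).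
  split=> //.
  have [s2|s2] := eqVneq (g + h + (g + h)) 0.
    do 5!right; split=> //; right.
    apply: (up_to_equiv_intZ2_8b charF dimQ alpha_neq0 Bw nw phiE Gamma_gr hf) => //.
    (* If also g + 3h = 0, subtracting it from 2(g + h) = 0 would give g = h. *)
    apply: contraNneq gh => s3; apply/eqP/(@addIr _ h)/(@addrI _ (g + h)).
    by rewrite s2 -s3 !addrA.
  left; split=> //.
  apply: (up_to_equiv_int2 charF dimQ alpha_neq0 Bw nw phiE Gamma_gr hf) => //.
  by rewrite subr_eq0.
- case=> g [e [b1 [b2 [d1 [d2 [hf gg wb1 wb2]]]]]]; right; right.
  have [fr _] := hf; have g0 : g != 0 by apply: contraNneq gg => ->; rewrite addr0.
  exists (can_e1 e), (can_e2 e), (can_u alpha b1 b2 d1 d2), (can_v alpha b1 b2 d1 d2).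
  have tau := frame_tau_nst charF dimQ fr nw phiE wb1 wb2.
  split; first exact: (frame_split charF dimQ fr).
    exact: (frame_adapted charF dimQ fr).
  (* All degrees are multiples of g with absolute value at most 2, and 2g is nonzero, so only 3g = 0
     and 4g = 0 can make two of them coincide. *)
  have [g3|g3] := eqVneq (g + g + g) 0.
    do 3!right; left; split=> //.
    exact: (up_to_equiv_Z3 charF dimQ alpha_neq0 Bw nw phiE Gamma_gr hf (erefl g) g0 g3).
  have [g4|g4] := eqVneq (g + g + (g + g)) 0.
    do 4!right; left; left; split=> //.
    exact: (up_to_equiv_Z4_7a charF dimQ alpha_neq0 Bw nw phiE Gamma_gr hf (erefl g) g0 gg g4).
  do 2!right; left; left; split=> //.
  exact: (up_to_equiv_int_5a charF dimQ alpha_neq0 Bw nw phiE Gamma_gr hf (erefl g) g0 gg g3 g4).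
Qed.
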